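(* Let $A_1$ be the family of finite quasisimple groups $H$ such that $H/Z(H)$ is isomorphic to a simple group $\mathrm{PSL}_2(q)$ with $q$ a prime power, excluding those $H$ with $H/Z(H)\cong \mathrm{PSL}_2(4)\cong\mathrm{PSL}_2(5)$ or $H/Z(H)\cong\mathrm{PSL}_2(9)$. For all integers $n>1$ and for any prime $\ell$, $$s_n(A_1,\ell)\le n+3.$$
   Context: A finite group $H$ is quasisimple if it is perfect and $H/Z(H)$ is non-abelian simple. For a finite quasisimple group $H$ with $H/Z(H)$ a simple group of Lie type defined over a field of characteristic $p$, and a prime $\ell\neq p$, let $r_n^f(H,\ell)$ denote the number of equivalence classes of faithful irreducible $n$-dimensional representations of $H$ over the algebraic closure of the prime field $\mathbb{F}_\ell$. For a family $\mathcal{L}$ of finite quasisimple groups of Lie type, $$s_n(\mathcal{L},\ell)=\sum_{H\in\mathcal{L}}r_n^f(H,\ell),$$ where the sum is over a set of representatives of isomorphism classes of groups $H$ in $\mathcal{L}$ whose defining characteristic $p$ (as members of $\mathcal{L}$, i.e. $q$ is a power of $p$) is different from $\ell$. *)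

(* Defs.v *)
From HB Require Import structures.
From mathcomp Require Import all_boot all_order all_algebra all_fingroup.
From mathcomp Require Import all_solvable mxpoly mxrepresentation.
From mathcomp Require Import all_classical reals ereal esum measure.

Set Implicit Arguments.
Unset Strict Implicit.
Unset Printing Implicit Defensive.

Import GroupScope GRing.Theory.
Local Open Scope ring_scope.
Local Open Scope group_scope.

Definition quasisimple (gT : finGroupType) (H : {group gT}) : Prop :=
  [/\ [~: H, H] = H, simple (H / 'Z(H)) & ~~ abelian (H / 'Z(H))].

Section PSL2.
Variable F : finFieldType.

Definition SL2 : {set {'GL_2[F]}} := [set g | \det (GLval g) == 1%R].

Lemma SL2_group_set : group_set SL2.
Proof.
apply/group_setP; split=> [|x y]; first by rewrite inE GL_1E det1.
by rewrite !inE => /eqP dx /eqP dy; rewrite GL_MxE det_mulmx dx dy mulr1.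
Qed.
Canonical SL2_group := Group SL2_group_set.

Definition PSL2 := SL2 / 'Z(SL2).
End PSL2.

Definition is_PSL2 (q : nat) (gT : finGroupType) (G : {group gT}) : Prop :=
  exists2 F : finFieldType, #|F| = q & G \isog PSL2 F.

Definition is_PSL2_char (p : nat) (gT : finGroupType) (G : {group gT}) : Prop :=
  prime p /\ exists2 k : nat, (0 < k)%N & is_PSL2 (p ^ k)%N G.

(* The non-simple groups PSL_2(2) and PSL_2(3) are ruled out by the
   quasisimplicity of H. *)
Definition A1 (gT : finGroupType) (H : {group gT}) : Prop :=
  [/\ quasisimple H,
      exists p : nat, is_PSL2_char p (H / 'Z(H))
    & ~ [\/ is_PSL2 4 (H / 'Z(H)), is_PSL2 5 (H / 'Z(H))
          | is_PSL2 9 (H / 'Z(H))]].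

(* Once PSL_2(4) = PSL_2(5) is excluded, PSL_2(q) determines q, so the p below
   is the defining characteristic of H as a member of A_1. *)
Definition A1_cross_char (l : nat) (gT : finGroupType) (H : {group gT}) : Prop :=
  A1 H /\ exists2 p : nat, p <> l & is_PSL2_char p (H / 'Z(H)).

Definition iso_representatives
    (L : forall gT : finGroupType, {group gT} -> Prop)
    (I : Type) (gT : I -> finGroupType) (H : forall i, {group gT i}) : Prop :=
  [/\ forall i, L (gT i) (H i),
      forall i j, H i \isog H j -> i = j
    & forall (rT : finGroupType) (K : {group rT}), L rT K ->
        exists i, K \isog H i].

Lemma isog_perm_ord (gT : finGroupType) (G : {group gT}) :
  exists (m : nat) (K : {group 'S_m}), G \isog K.
Proof.
pose f (x : gT) : 'S_#|gT| :=
  perm (fun i j (e : enum_rank (enum_val i * x) = enum_rank (enum_val j * x)) =>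
    enum_val_inj (@mulIg gT x _ _ (enum_rank_inj e))).
have fM : {in G &, {morph f : x y / x * y}}.
  by move=> x y _ _; apply/permP => i; rewrite permM !permE enum_rankK mulgA.
have finj : {in G &, injective f}.
  move=> x y _ _ /permP /(_ (enum_rank 1)); rewrite !permE => /enum_rank_inj.
  by move=> /mulgI.
exists #|gT|, (Morphism fM @* G)%G.
by apply: (@sub_isog _ _ G (Morphism fM)) => //; apply/injmP.
Qed.

Lemma iso_representatives_exist
    (L : forall gT : finGroupType, {group gT} -> Prop) :
  exists (I : choiceType) (gT : I -> finGroupType) (H : forall i, {group gT i}),
    iso_representatives L H.
Proof.
pose T : choiceType := {m : nat & {group 'S_m}}.
pose iso (x : T) : pred T := fun y => tagged x \isog tagged y.
pose rep (x : T) := choose (iso x) x.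
have isox x : iso x (rep x) by apply: chooseP; apply: isog_refl.
have repE x y : iso x y -> rep x = rep y.
  move=> xy; have e : iso x =1 iso y.
    by move=> z; rewrite /iso (isog_transl _ xy).
  by rewrite /rep (eq_choose e); apply: choose_id; rewrite /iso ?isog_refl // isog_sym.
pose Q (x : T) (p : {gT : finGroupType & {group gT}}) :=
  L (tag p) (tagged p) /\ tagged x \isog tagged p.
pose P (x : T) := (rep x == x) && `[< exists p, Q x p >].
have PQ (i : {x | P x}) : exists p, Q (val i) p.
  by case: i => x /= /andP[_ /asboolP].
pose h i := projT1 (cid (PQ i)).
have hQ i : Q (val i) (h i) by apply: (projT2 (cid (PQ i))).
exists {x | P x}, (fun i => tag (h i)), (fun i => tagged (h i)); split.
- by move=> i; have [] := hQ i.
- move=> i j ij; apply: val_inj.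
  have [/andP[/eqP<- _] /andP[/eqP<- _]] := (valP i, valP j).
  apply: repE; apply: isog_trans (proj2 (hQ i)) (isog_trans ij _).
  by rewrite isog_sym; exact: (proj2 (hQ j)).
- move=> rT K LK; have [m [K' KK']] := isog_perm_ord K.
  pose x : T := Tagged (fun m => {group 'S_m}) K'.
  have xr : iso x (rep x) := isox x.
  have KR : K \isog tagged (rep x) by apply: isog_trans KK' xr.
  have Pr : P (rep x).
    apply/andP; split; first by rewrite -(repE _ _ xr).
    apply/asboolP; exists (Tagged (fun gT : finGroupType => {group gT}) K).
    by split => //=; rewrite isog_sym.
  exists (Sub (rep x) Pr); apply: isog_trans KR _.
  exact: (proj2 (hQ (Sub (rep x) Pr))).
Qed.
Section Count.
Variables (K : fieldType) (n : nat).
Local Open Scope classical_set_scope.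

Definition rep_class (gT : finGroupType) (H : {group gT})
    (rH : mx_representation K H n) : set (mx_representation K H n) :=
  [set rH' | mx_rsim rH rH'].

Definition faithful_irr_classes (gT : finGroupType) (H : {group gT}) :
    set (set (mx_representation K H n)) :=
  [set rep_class rH | rH in
    [set rH : mx_representation K H n | mx_irreducible rH /\ mx_faithful rH]].
Arguments faithful_irr_classes {gT} H.

(* [counting] is the cardinality, or +oo if the set is infinite. *)
Definition num_faithful_irr (R : realType) (gT : finGroupType)
    (H : {group gT}) : \bar R := counting (faithful_irr_classes H).

Definition sum_faithful_irr (R : realType) (I : choiceType)
    (gT : I -> finGroupType) (H : forall i, {group gT i}) : \bar R :=
  esum [set: I] (fun i => num_faithful_irr R (H i)).
End Count.

(* Main.v *)
(* For q not in {4, 5, 9} with PSL_2(q) simple, SL_2(q) has no nontrivial perfect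
   central extension: Sylow subgroups for r <> p are cyclic or generalized
   quaternion, so transfer kills the r-part of the kernel, and the lifts of the
   unipotent subgroup commute: this is clear for q prime, and otherwise a
   commutator of lifts is invariant under the torus, which scales by squares, and
   1 is a sum s^2 + t^2 of two nonzero squares with (st)^2 <> 1. Hence every H over
   PSL_2(q) is a quotient of SL_2(q), and inequivalent faithful irreducible
   representations of the groups H over PSL_2(q) pull back to inequivalent
   irreducible representations of SL_2(q).

   In cross characteristic the restriction of such a representation to the
   unipotent subgroup splits into weight spaces for additive characters, permuted
   by the torus. If weight 0 occurs, the torus acts on a highest weight vector by
   a character and the representation is a quotient of a principal series;
   otherwise it is cuspidal and its trace is determined up to a scalar on the
   elements with no eigenvalue in F_q. The coefficients of inequivalent
   absolutely irreducible representations are linearly independent, which bounds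
   the number of representations of degree q + 1, q, q - 1 and (q +- 1)/2.

   Degree n thus only sees q in {n - 1, n, n + 1, 2n - 1, 2n + 1}, and the sum
   exceeds n + 3 only if n - 1, n + 1 and, for n even, n are all prime powers;
   this is excluded because powers of 2 and 3 are rarely neighbours. *)
Require Import Defs.
From HB Require Import structures.
From mathcomp Require Import all_boot all_order all_algebra all_fingroup.
From mathcomp Require Import all_solvable all_field mxpoly mxrepresentation.
From mathcomp Require Import ring zify.
From mathcomp Require boolp.

Set Implicit Arguments.
Unset Strict Implicit.
Unset Printing Implicit Defensive.

(** * Arithmetic of the degrees *)

(** Characters in characteristic [l] satisfy no orthogonality relations, so two substitutes carry
    the proof. The unipotent subgroup has order prime to [l], hence there are projectors on its
    weight spaces; and the independence of matrix coefficients bounds every family whose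
    coefficients fit into a small space. Multiplicity one for nonzero weights is Gelfand's trick,
    with an anti-automorphism fixing the unipotent subgroup, and the degrees (q +- 1)/2 are
    controlled by comparing a representation with its twist by a diagonal automorphism from GL_2.

    The constant 3 comes from the extreme case: for even n without a contribution of q = n, the
    fields with q = n - 1 and q = n + 1 give at most (n - 4)/2 and (n + 2)/2 representations, and q
    = 2n - 1, 2n + 1 give at most 2 each. *)

Definition prime_power (q : nat) : Prop := exists p k, [/\ prime p, 0 < k & q = p ^ k].

Lemma prime_power_dvd p q : prime p -> prime_power q -> p %| q -> exists2 k, 0 < k & q = p ^ k.
Proof.
move=> p_pr [r [k [r_pr k0 ->]]]; rewrite Euclid_dvdX // => /andP[+ _].
by rewrite dvdn_prime2 // => /eqP<-; exists k.
Qed.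

Lemma even_prime_power q : prime_power q -> ~~ odd q -> exists2 k, 0 < k & q = 2 ^ k.
Proof. by move=> qp qe; apply: prime_power_dvd => //; rewrite dvdn2. Qed.

Lemma exp2_mod e m : 2 ^ (m + e) %% 2 ^ m = 0.
Proof. by rewrite expnD modnMr. Qed.

(* The powers of 3 modulo 16 are 1, 3, 9, 11, and 3 ^ 4 is 1 modulo 5. *)
Lemma exp3_near_exp2 a e : 3 < e -> 3 ^ a <> (2 ^ e).-1 /\ 3 ^ a <> (2 ^ e).+1.
Proof.
move=> e4; have e0 : 2 ^ e %% 16 = 0 by rewrite -(subnKC e4) (exp2_mod _ 4).
have per d : 3 ^ 4 %% d = 1 %% d -> 3 ^ a = 3 ^ (a %% 4) %[mod d].
  move=> d4; have P b : 3 ^ (4 * b) = 1 %[mod d].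
    by elim: b => // b IH; rewrite mulnS expnD -modnMmr IH modnMmr muln1.
  by rewrite {1}(divn_eq a 4) expnD mulnC [_ * 4]mulnC -modnMmr P modnMmr muln1.
have m16 : 3 ^ a %% 16 = 3 ^ (a %% 4) %% 16 by apply: per.
have r4 : a %% 4 < 4 by rewrite ltn_mod.
have e5 : 2 ^ e %% 5 != 0 by rewrite -/(5 %| 2 ^ e) Euclid_dvdX.
have E0 : 0 < 2 ^ e by rewrite expn_gt0.
split=> E.
  have : (3 ^ a).+1 %% 16 = 0 by rewrite E prednK.
  rewrite -addn1 -modnDml m16.
  by case: (a %% 4) r4 => [|[|[|[|]]]].
have m5 : 3 ^ a %% 5 = 3 ^ (a %% 4) %% 5 by apply: per.
(* Being 1 modulo 16 forces 4 to divide [a]; then [3 ^ a] is 1 modulo 5, and 5 would divide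
   [2 ^ e]. *)
have : 3 ^ a %% 16 = 1 by rewrite E -addn1 -modnDml e0.
rewrite m16; move: m5; case: (a %% 4) r4 => [|[|[|[|]]]] // _; rewrite E => m5 _.
by move: e5 m5; rewrite -addn1; lia.
Qed.

(** For odd [n] both neighbours would be multiples of 4 at distance 2. For even [n], a power of 2,
    one neighbour is a multiple of 3, hence a power of 3; excluding 9 discards [n = 8], so that [n]
    is at least 16. *)
Lemma prime_power_neighbours n : prime_power n.-1 -> prime_power n.+1 -> 6 < n ->
  (~~ odd n -> prime_power n) -> n.+1 <> 9 -> False.
Proof.
move=> q1 q2 n6 q0 n9; have [on|en] := boolP (odd n).
  have [i i0 Ei] := even_prime_power q1 ltac:(by move: on n6; case: (n) => //= d; rewrite negbK).
  have [j j0 Ej] := even_prime_power q2 ltac:(by rewrite /= on).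
  have i3 : 2 < i by rewrite -(ltn_exp2l _ _ (ltnSn 1)) -Ei; lia.
  have j3 : 2 < j by rewrite -(ltn_exp2l _ _ (ltnSn 1)) -Ej; lia.
  have : 2 ^ i %% 4 = 0 by rewrite -(subnKC (ltnW i3)) (exp2_mod _ 2).
  have : 2 ^ j %% 4 = 0 by rewrite -(subnKC (ltnW j3)) (exp2_mod _ 2).
  by rewrite -Ei -Ej; lia.
have [e e0 En] := even_prime_power (q0 en) en.
have e4 : 3 < e.
  case: e En {e0} => [|[|[|[|e]]]] // En; move: n6 n9; rewrite En //.
have n3 : ~~ (3 %| n) by rewrite En Euclid_dvdX.
have [d3|d3] := boolP (3 %| n.-1).
  have [a _ Ea] := prime_power_dvd (isT : prime 3) q1 d3.
  by have [H _] := exp3_near_exp2 a e4; apply: H; rewrite -Ea En.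
have d3' : 3 %| n.+1 by lia.
have [a _ Ea] := prime_power_dvd (isT : prime 3) q2 d3'.
by have [_ H] := exp3_near_exp2 a e4; apply: H; rewrite -Ea En.
Qed.

(** [k] counts inequivalent irreducible representations of degree [n] of SL_2(q). The bounds are
    crude (over the complex numbers only the Steinberg representation has degree q), but the sum
    leaves room for that. *)
Definition degree_table (n q k : nat) : Prop :=
  (n = q.+1 /\ 2 * k <= q - 2) \/ (n = q /\ k <= 2) \/ (n = q.-1 /\ 2 * k <= q.+1) \/
  ((2 * n = q.+1 \/ 2 * n = q.-1) /\ k <= 2).

Lemma degree_table_sum n (m : nat -> nat) : 1 < n ->
  (forall q, 0 < m q -> [/\ prime_power q, q \notin [:: 2; 3; 4; 5; 9] & degree_table n q (m q)]) ->
  m n.-1 + m n + m n.+1 + m (2 * n).-1 + m (2 * n).+1 <= n + 3.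
Proof.
move=> n1 mP.
have bad q : q \in [:: 2; 3; 4; 5; 9] -> m q = 0.
  by move=> qb; case: (posnP (m q)) => // /mP[_]; rewrite qb.
have notpp q : ~ prime_power q -> m q = 0.
  by move=> qb; case: (posnP (m q)) => // /mP[].
have tab q : 0 < m q -> degree_table n q (m q) by case/mP.
have ev q : ~~ odd q -> 0 < m q -> exists2 k, 0 < k & q = 2 ^ k.
  by move=> qe /mP[qp _ _]; apply: even_prime_power.
(* For small [n] the excluded prime powers, together with 1 and 6, leave few nonzero terms. *)
have [n6|n6] := leqP n 6.
  have n15 : m 6 = 0.
    by apply: notpp => /(prime_power_dvd (isT : prime 3))/(_ isT)[[|[|k]] // _ /eqP]; rewrite !expnS; lia.
  have := (tab n.-1, tab n, tab n.+1, tab (2 * n).-1, tab (2 * n).+1).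
  case=> [[[[]]]]; rewrite /degree_table.
  have [[b2 b3] [b4 [b5 b9]]] := ((bad 2 isT, bad 3 isT), (bad 4 isT, (bad 5 isT, bad 9 isT))).
  have m1 : m 1 = 0 by apply: notpp => -[p [k [/prime_gt1 p1 k0 E]]]; have := ltn_exp2l 0 k p1; rewrite k0 expn0 -E.
  move: n1 n6; clear -b2 b3 b4 b5 b9 m1 n15; case: n => [|[|[|[|[|[|[|n]]]]]]] // _ _;
    rewrite ?[2 * 2]/4 ?[2 * 3]/6 ?[2 * 4]/8 ?[2 * 5]/10 ?[2 * 6]/12 /= ?m1 ?n15 ?b2 ?b3 ?b4 ?b5 ?b9; lia.
(* Otherwise the bounds would add up to [n + 5]. *)
have nz : m n.-1 = 0 \/ m n.+1 = 0 \/ (m n = 0 /\ ~~ odd n).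
  case: (posnP (m n.-1)) => [|p1]; first by left.
  case: (posnP (m n.+1)) => [|p2]; first by right; left.
  right; right; have [[q1 _ _] [q2 b2 _]] := (mP _ p1, mP _ p2).
  have n9 : n.+1 <> 9 by move=> e; rewrite e in b2.
  have [on|en] := boolP (odd n).
    by have [] := prime_power_neighbours q1 q2 n6 _ n9; rewrite on.
  split=> //; case: (posnP (m n)) => // /mP[q0 _ _].
  by have [] := prime_power_neighbours q1 q2 n6 (fun=> q0) n9.
have [[t1 t2] [t3 [t4 t5]]] := ((tab n.-1, tab n), (tab n.+1, (tab (2 * n).-1, tab (2 * n).+1))).
move: t1 t2 t3 t4 t5 nz; rewrite /degree_table.
move: (m n.-1) (m n) (m n.+1) (m (2 * n).-1) (m (2 * n).+1) => a b c d e.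
clear -n6 => ta tb tc td te.
have {}ta : 2 * a <= n - 3 by clear tb tc td te; case: (posnP a) => [->|/ta] //; lia.
have {}tb : b <= 2 by case: (posnP b) => [->|/tb] //; lia.
have {}tc : 2 * c <= n + 2 by case: (posnP c) => [->|/tc] //; lia.
have {}td : d <= 2 by case: (posnP d) => [->|/td] //; lia.
have {}te : e <= 2 by case: (posnP e) => [->|/te] //; lia.
case=> [|[|[]]]; lia.
Qed.

Lemma degree_table_mem n q k : 0 < q -> degree_table n q k ->
  q \in [:: n.-1; n; n.+1; (2 * n).-1; (2 * n).+1].
Proof. by rewrite /degree_table !inE; lia. Qed.

Import GRing.Theory.
Local Open Scope ring_scope.

(** * Irreducible matrix representations of monoids *)

Lemma col_mul (R : pzSemiRingType) m n p j (A : 'M[R]_(m, n)) (B : 'M[R]_(n, p)) :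
  col j (A *m B) = A *m col j B.
Proof. by rewrite !colE mulmxA. Qed.

Lemma mulmx_deltaE (R : pzRingType) m n p (A : 'M[R]_(m, n)) k l i (j : 'I_p) :
  (A *m delta_mx k l) i j = A i k *+ (j == l).
Proof.
rewrite !mxE (bigD1 k) //= big1 ?addr0 => [|u uk]; last by rewrite !mxE (negPf uk) mulr0.
by rewrite !mxE eqxx /= mulr_natr.
Qed.

Section MonoidReps.

Variables (F : fieldType) (T : finType) (D : {pred T}) (one : T) (mul : T -> T -> T).
Hypothesis D1 : one \in D.
Hypothesis DM : {in D &, forall g h, mul g h \in D}.

(** Representations are total functions, constrained only on [D]: SL_2 can then be a predicate on 2
    x 2 matrices, whose identities are left to [ring] and [field]. *)
Definition mrep n (r : T -> 'M[F]_n) :=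
  r one = 1%:M /\ {in D &, forall g h, r (mul g h) = r g *m r h}.

(* By Burnside's theorem this is absolute irreducibility. *)
Definition airr n (r : T -> 'M[F]_n) :=
  forall C : 'M_n, {in D, forall g, \tr (C *m r g) = 0} -> C = 0.

(* For irreducible representations, this is equivalence. *)
Definition intertwined n1 n2 (r1 : T -> 'M[F]_n1) (r2 : T -> 'M[F]_n2) :=
  exists2 B : 'M_(n1, n2), B != 0 & {in D, forall g, r1 g *m B = B *m r2 g}.

(** A list of weighted elements stands for an element of the monoid algebra, on which [lext r] is
    the linear extension of [r]. *)
Definition lext n (r : T -> 'M[F]_n) (a : seq (F * T)) : 'M[F]_n :=
  \sum_(x <- a) x.1 *: r x.2.

Definition supp (a : seq (F * T)) := all (fun x => x.2 \in D) a.

Lemma lext_cat n (r : T -> 'M[F]_n) a b : lext r (a ++ b) = lext r a + lext r b.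
Proof. by rewrite /lext big_cat. Qed.

Lemma lextZ n (r : T -> 'M[F]_n) c a :
  lext r [seq (c * x.1, x.2) | x <- a] = c *: lext r a.
Proof.
by rewrite /lext big_map scaler_sumr; apply: eq_bigr => x _; rewrite scalerA.
Qed.

Lemma supp_cat a b : supp (a ++ b) = supp a && supp b.
Proof. exact: all_cat. Qed.

Lemma supp_mul g a : g \in D -> supp a -> supp [seq (x.1, mul g x.2) | x <- a].
Proof.
move=> gD; rewrite /supp all_map => /allP sa; apply/allP => x xa /=.
by apply: DM => //; apply: sa.
Qed.

Lemma lext_mul n (r : T -> 'M[F]_n) g a : mrep r -> g \in D -> supp a ->
  lext r [seq (x.1, mul g x.2) | x <- a] = r g *m lext r a.
Proof.
move=> [_ rM] gD /allP sa; rewrite /lext big_map mulmx_sumr big_seq_cond.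
rewrite [RHS]big_seq_cond; apply: eq_bigr => x /andP[/sa xD _] /=.
by rewrite rM // -scalemxAr.
Qed.

Lemma mxvec_trace m n (A B : 'M[F]_(m, n)) :
  (mxvec A *m (mxvec B)^T) 0 0 = \tr (A *m B^T).
Proof.
rewrite mxE (reindex _ (curry_mxvec_bij m n)) /=.
transitivity (\sum_i \sum_j A i j * B i j).
  by rewrite pair_bigA; apply: eq_bigr => -[i j] _; rewrite mxE /= !mxvecE.
by apply: eq_bigr => i _; rewrite mxE; apply: eq_bigr => j _; rewrite mxE.
Qed.

(** Every linear form on matrices is a trace form, and [airr] says that none but 0 vanishes on all
    [r g]. *)
Lemma airr_span n (r : T -> 'M[F]_n) : airr r ->
  forall M, exists2 a, supp a & lext r a = M.
Proof.
move=> ri M.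
pose A : 'M_(#|D|, n * n) := \matrix_i mxvec (r (enum_val i)).
have fullA : row_full A.
  rewrite -cokermx_eq0; apply/eqP/trmx_inj/row_matrixP => j; rewrite trmx0 row0.
  rewrite -tr_col; set y := (col j _)^T.
  have Ay : A *m y^T = 0 by rewrite /y trmxK -col_mul mulmx_coker colE mul0mx.
  suff C0 : (vec_mx y)^T = 0 by rewrite -[y]vec_mxK -[vec_mx y]trmxK C0 trmx0 linear0.
  apply: ri => g gD; rewrite mxtrace_mulC -mxvec_trace vec_mxK.
  move/(congr1 (row (enum_rank_in gD g))): Ay; rewrite row_mul rowK row0.
  by rewrite enum_rankK_in // => ->; rewrite mxE.
have [x Ax] : exists x, mxvec M = x *m A by apply/submxP/submx_full.
exists [seq (x 0 i, enum_val i) | i <- enum 'I_#|D|].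
  by rewrite /supp all_map; apply/allP => i _ /=; apply: enum_valP.
rewrite -[RHS]mxvecK Ax mulmx_sum_row linear_sum /lext big_map big_enum /=.
by apply: eq_bigr => i _; rewrite linearZ /= rowK mxvecK.
Qed.

Lemma airr_eq0 n (r : T -> 'M[F]_n) (W : lmodType F) (f : {linear 'M[F]_n -> W}) :
  airr r -> {in D, forall g, f (r g) = 0} -> forall M, f M = 0.
Proof.
move=> ri fr M; have [a sa <-] := airr_span ri M.
rewrite /lext linear_sum big_seq_cond big1 // => x; rewrite andbT => xa.
by rewrite linearZ /= fr ?scaler0 //; apply: (allP sa).
Qed.

Section Independence.

Variables (I : finType) (d : I -> nat) (r : forall i, T -> 'M[F]_(d i)).
Arguments r : clear implicits.
Hypothesis rM : forall i, mrep (r i).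
Hypothesis ri : forall i, airr (r i).
Hypothesis rN : forall i j, i != j -> ~ intertwined (r i) (r j).

Let rel (s : seq I) (C : forall i, 'M[F]_(d i)) :=
  {in D, forall g, \sum_(i <- s) \tr (C i *m r i g) = 0}.

Let rel_mulr s C a : supp a -> rel s C -> rel s (fun i => C i *m lext (r i) a).
Proof.
move=> /allP sa Cs g gD; transitivity
  (\sum_(x <- a) x.1 * \sum_(i <- s) \tr (C i *m r i (mul x.2 g))); last first.
  by rewrite big_seq_cond big1 // => x /andP[/sa xD _]; rewrite Cs ?mulr0 ?DM.
under [RHS]eq_bigr do rewrite mulr_sumr.
rewrite [RHS]exchange_big; apply: eq_bigr => i _ /=.
rewrite /lext mulmx_sumr mulmx_suml linear_sum [LHS]big_seq_cond.
rewrite [RHS]big_seq_cond; apply: eq_bigr => x /andP[/sa xD _].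
by rewrite (rM i).2 // -scalemxAr -scalemxAl mulmxA linearZ.
Qed.

Let rel_mull s C a : supp a -> rel s C -> rel s (fun i => lext (r i) a *m C i).
Proof.
move=> /allP sa Cs g gD; transitivity
  (\sum_(x <- a) x.1 * \sum_(i <- s) \tr (C i *m r i (mul g x.2))); last first.
  by rewrite big_seq_cond big1 // => x /andP[/sa xD _]; rewrite Cs ?mulr0 ?DM.
under [RHS]eq_bigr do rewrite mulr_sumr.
rewrite [RHS]exchange_big; apply: eq_bigr => i _ /=.
rewrite -mulmxA mxtrace_mulC.
rewrite /lext mulmx_sumr linear_sum [LHS]big_seq_cond.
rewrite [RHS]big_seq_cond; apply: eq_bigr => x /andP[/sa xD _].
by rewrite (rM i).2 // -scalemxAr linearZ /= mulmxA.
Qed.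

(** Induction on [s]. A relation with [C j] nonzero is multiplied on both sides until its [j]-th
    coefficient is a matrix unit. An algebra element killing that coefficient leaves a shorter
    relation, so it kills the other coefficients too. This gives a well-defined module map from a
    column of [C1 j] to a column of [C1 i], which intertwines the two representations. *)
Lemma coef_independence_seq s C : uniq s -> rel s C -> {in s, forall i, C i = 0}.
Proof.
elim: s C => [|j s IH] // C /= /andP[js us] Cs.
have [Cj0|/matrix0Pn[k [l Ckl]]] := eqVneq (C j) 0.
  have {}Cs : rel s C.
    by move=> g gD; have:= Cs g gD; rewrite big_cons Cj0 mul0mx linear0 add0r.
  by move=> i /[!inE] /predU1P[-> //|]; apply: IH.
exfalso.
have [b sb bl] := airr_span (@ri j) (delta_mx l l).
have [a sa al] := airr_span (@ri j) ((C j k l)^-1 *: delta_mx l k).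
pose C1 i := lext (r i) a *m (C i *m lext (r i) b).
have C1j : C1 j = delta_mx l l.
  rewrite /C1 al bl -scalemxAl mulmxA; apply/matrixP => u v; rewrite !mxE.
  rewrite (bigD1 l) //= big1 ?addr0 => [|i il]; last by rewrite !mxE (negPf il) mulr0.
  rewrite !mxE eqxx (bigD1 k) //= big1 ?addr0 => [|i il]; last first.
    by rewrite !mxE (negPf il) andbF mul0r.
  rewrite !mxE eqxx andbT; case: eqP => ul; rewrite ?mul0r ?mulr0 //= mul1r.
  by rewrite mulrA mulVf // mul1r.
have C1s : rel (j :: s) C1 by apply/rel_mull/rel_mulr.
have kill c : supp c -> lext (r j) c *m C1 j = 0 ->
    {in s, forall i, lext (r i) c *m C1 i = 0}.
  move=> sc cj; apply: IH us _ => g gD; have := rel_mull sc C1s gD.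
  by rewrite big_cons cj mul0mx linear0 add0r.
have [/hasP[i si C1i]|/hasPn nC] := boolP (has (fun i => C1 i != 0) s); last first.
  have : C1 j = 0.
    apply: ri => g gD; have := C1s g gD; rewrite big_cons big_seq_cond big1 ?addr0 //.
    by move=> i /andP[/nC /negPn /eqP-> _]; rewrite mul0mx linear0.
  by rewrite C1j => /matrixP/(_ l l); rewrite !mxE !eqxx => /eqP; rewrite oner_eq0.
have /matrix0Pn[u [v Cuv]] := C1i.
pose c := col v (C1 i).
have /fin_all_exists2[A sA AE] (m : 'I_(d j)) :
  exists2 A, supp A & lext (r j) A = delta_mx m l by apply: airr_span.
(* In [r j], [A m] moves the [l]-th basis vector to the [m]-th one; so the module map must send the
   [m]-th basis vector to [A m] applied to [c]. *)
pose B : 'M_(d i, d j) := \matrix_(x, m) (lext (r i) (A m) *m c) x 0.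
have colB m : col m B = lext (r i) (A m) *m c by apply/colP => x; rewrite !mxE.
have colBE (w : 'cV_(d j)) : B *m w = \sum_m w m 0 *: col m B.
  by apply/colP => x; rewrite !mxE summxE; apply: eq_bigr => m _; rewrite !mxE mulrC.
have BP e : supp e -> lext (r i) e *m c = B *m col l (lext (r j) e).
  move=> se; pose z m := lext (r j) e m l.
  (* [E] is [e] minus the combination of the [A m] with the same [l]-th column in [r j], so it
     annihilates [C1 j] and hence [C1 i]. *)
  pose E := e ++ flatten [seq [seq (- z m * x.1, x.2) | x <- A m] | m <- enum 'I_(d j)].
  have lE i' : lext (r i') E = lext (r i') e - \sum_m z m *: lext (r i') (A m).
    rewrite lext_cat; congr (_ + _); rewrite /lext big_flatten big_map big_enum /=.
    rewrite -sumrN; apply: eq_bigr => m _; rewrite -scaleNr -/(lext _ _).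
    exact: lextZ.
  have sE : supp E.
    rewrite supp_cat se /= /supp; apply/allP => x /flattenP[_ /mapP[m _ ->]].
    by move=> /mapP[y yA ->] /=; apply: (allP (sA m)).
  have Ej : lext (r j) E *m C1 j = 0.
    rewrite lE C1j mulmxBl; apply/eqP; rewrite subr_eq0; apply/eqP/matrixP => x y.
    rewrite !mulmx_deltaE; congr (_ *+ _); rewrite -[LHS]/(z x) summxE.
    rewrite (bigD1 x) //= big1 ?addr0 => [|m mx]; first by rewrite mxE AE mxE !eqxx mulr1.
    by rewrite mxE AE mxE eq_sym (negPf mx) mulr0.
  have /eqP := congr1 (col v) (kill E sE Ej i si).
  rewrite col_mul -/c lE mulmxBl [col v 0]colE mul0mx subr_eq0 => /eqP->.
  rewrite mulmx_suml colBE; apply: eq_bigr => m _.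
  by rewrite -scalemxAl colB !mxE.
apply: (rN (i := i) (j := j)).
  by apply: contraNneq js => <-.
exists B.
  have s1 : supp [:: (1, one)] by rewrite /supp /= D1.
  have l1 i' : lext (r i') [:: (1, one)] = 1%:M.
    by rewrite /lext big_seq1 scale1r (rM i').1.
  have := BP _ s1; rewrite !l1 mul1mx => cE.
  have cu : c u 0 = C1 i u v by rewrite [LHS]mxE.
  by apply: contraNneq Cuv => B0; rewrite -cu cE B0 mul0mx mxE.
move=> g gD; apply/trmx_inj/row_matrixP => m; rewrite -!tr_col; congr (_^T).
rewrite !col_mul colB mulmxA -lext_mul ?BP ?supp_mul //.
rewrite lext_mul // AE; congr (_ *m _); apply/colP => x; rewrite !mxE.
rewrite (bigD1 m) //= big1 ?addr0 => [|y ym]; first by rewrite !mxE !eqxx mulr1.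
by rewrite !mxE (negPf ym) mulr0.
Qed.

Lemma coef_independence (C : forall i, 'M[F]_(d i)) :
  {in D, forall g, \sum_i \tr (C i *m r i g) = 0} -> forall i, C i = 0.
Proof.
move=> Cs i; apply: (@coef_independence_seq (enum I)); rewrite ?enum_uniq ?mem_enum //.
by move=> g gD; rewrite big_enum /= Cs.
Qed.

End Independence.

End MonoidReps.

(** * Representations of SL2(K) restricted to the Borel subgroup *)

Section Matrices2.

Variable K : fieldType.
Implicit Types (a b c d : K) (g h : 'M[K]_2).

Definition mx2 a b c d : 'M[K]_2 :=
  \matrix_(i, j) if i == 0 then if j == 0 then a else b else if j == 0 then c else d.

Lemma ord2P (i : 'I_2) : i = 0 \/ i = 1.
Proof. by case: i => [[|[|//]] lt]; [left | right]; apply: val_inj. Qed.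

Lemma mx2E g : g = mx2 (g 0 0) (g 0 1) (g 1 0) (g 1 1).
Proof.
apply/matrixP => i j; rewrite mxE; by case: (ord2P i) => ->; case: (ord2P j) => ->.
Qed.

Lemma mx2_00 a b c d : mx2 a b c d 0 0 = a. Proof. by rewrite mxE. Qed.
Lemma mx2_01 a b c d : mx2 a b c d 0 1 = b. Proof. by rewrite mxE. Qed.
Lemma mx2_10 a b c d : mx2 a b c d 1 0 = c. Proof. by rewrite mxE. Qed.
Lemma mx2_11 a b c d : mx2 a b c d 1 1 = d. Proof. by rewrite mxE. Qed.
Definition mx2s := (mx2_00, mx2_01, mx2_10, mx2_11).

Lemma mx2M a b c d a' b' c' d' : mx2 a b c d *m mx2 a' b' c' d' =
  mx2 (a * a' + b * c') (a * b' + b * d') (c * a' + d * c') (c * b' + d * d').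
Proof.
rewrite [LHS]mx2E ![(_ *m _) _ _]mxE !big_ord_recl !big_ord0 !addr0.
by rewrite !mxE.
Qed.

Lemma mx2_1 : mx2 1 0 0 1 = 1%:M.
Proof. by rewrite [RHS]mx2E !mxE. Qed.

Lemma det_mx2 a b c d : \det (mx2 a b c d) = a * d - b * c.
Proof.
rewrite (expand_det_row _ 0) !big_ord_recl big_ord0 /cofactor !det_mx11 !mxE /=.
by ring.
Qed.

Lemma tr_mx2 a b c d : \tr (mx2 a b c d) = a + d.
Proof. by rewrite /mxtrace !big_ord_recl big_ord0 addr0 !mxE. Qed.

Definition sl2 : {pred 'M[K]_2} := [pred g | \det g == 1].

Lemma sl2E a b c d : (mx2 a b c d \in sl2) = (a * d - b * c == 1).
Proof. by rewrite inE det_mx2. Qed.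

Lemma sl2_1 : 1%:M \in sl2. Proof. by rewrite inE det1. Qed.

Lemma sl2M : {in sl2 &, forall g h, g *m h \in sl2}.
Proof. by move=> g h; rewrite !inE det_mulmx => /eqP-> /eqP->; rewrite mulr1. Qed.

Definition um b := mx2 1 b 0 1.
Definition lm c := mx2 1 0 c 1.
Definition tm a := mx2 a 0 0 a^-1.
Definition wm := mx2 0 (-1) 1 0.

Lemma um_sl b : um b \in sl2. Proof. by rewrite sl2E mulr1 mulr0 subr0. Qed.
Lemma lm_sl b : lm b \in sl2. Proof. by rewrite sl2E mulr1 mul0r subr0. Qed.
Lemma tm_sl a : a != 0 -> tm a \in sl2.
Proof. by move=> a0; rewrite sl2E divff // mulr0 subr0. Qed.
Lemma wm_sl : wm \in sl2. Proof. by rewrite sl2E mulr0 mulr1 sub0r opprK. Qed.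

Lemma umD b c : um b *m um c = um (b + c).
Proof. by rewrite mx2M; congr mx2; ring. Qed.

Lemma um0 : um 0 = 1%:M. Proof. exact: mx2_1. Qed.

Lemma tmM a b : tm a *m tm b = tm (a * b).
Proof. by rewrite mx2M; congr mx2; rewrite ?invfM; ring. Qed.

Lemma tm1 : tm 1 = 1%:M. Proof. by rewrite /tm invr1 mx2_1. Qed.

Lemma tm_um a b : a != 0 -> tm a *m um b = um (a ^+ 2 * b) *m tm a.
Proof. by move=> a0; rewrite !mx2M; congr mx2; field. Qed.

Lemma wm_tm a : wm *m tm a = tm a^-1 *m wm.
Proof. by rewrite !mx2M invrK; congr mx2; ring. Qed.

Lemma wm2 : wm *m wm = tm (-1).
Proof. by rewrite !mx2M /tm invrN1; congr mx2; ring. Qed.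

(** The Borel part of the Bruhat decomposition; [sl2_big_cell] is the other cell. *)
Lemma sl2_borel g : g \in sl2 -> g 1 0 = 0 ->
  g 0 0 != 0 /\ g = tm (g 0 0) *m um (g 0 1 / g 0 0).
Proof.
rewrite {1}[g]mx2E sl2E => + g10; rewrite g10 mulr0 subr0 => /eqP ad.
have a0 : g 0 0 != 0.
  by apply/eqP => a0; move: ad; rewrite a0 mul0r => /eqP; rewrite eq_sym oner_eq0.
have aV : (g 0 0)^-1 = g 1 1 by apply: (mulfI a0); rewrite divff.
split=> //; rewrite /tm aV mx2M {1}[g]mx2E g10 !(mulr0, addr0, mulr1, mul0r, add0r).
by rewrite mulrCA ad mulr1.
Qed.

Lemma sl2_big_cell g : g \in sl2 -> g 1 0 != 0 ->
  g = um (g 0 0 / g 1 0) *m tm (g 1 0)^-1 *m wm *m um (g 1 1 / g 1 0).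
Proof.
rewrite {1}[g]mx2E sl2E => /eqP ad c0; rewrite {1}[g]mx2E !mx2M invrK.
have b01 : g 0 1 = (g 0 0 * g 1 1 - 1) / g 1 0.
  apply: (mulIf c0); rewrite mulfVK //; apply/eqP.
  by rewrite eq_sym subr_eq addrC -subr_eq; apply/eqP.
by rewrite b01; congr mx2; field.
Qed.



Lemma lm_conj c : lm c *m wm = wm *m um (- c).
Proof. by rewrite !mx2M; congr mx2; ring. Qed.

(* wm = u(-1) l(1) u(-1) and t(a) = u(a) l(-1/a) u(a) wm. *)
Lemma sl2_ind (P : 'M[K]_2 -> Prop) :
  (forall b, P (um b)) -> (forall c, P (lm c)) ->
  {in sl2 &, forall g h, P g -> P h -> P (g *m h)} -> {in sl2, forall g, P g}.
Proof.
move=> Pu Pl PM; pose Q g := g \in sl2 /\ P g.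
have QM g h : Q g -> Q h -> Q (g *m h) by case=> ? ? [? ?]; split; [apply: sl2M|apply: PM].
have Qu b : Q (um b) by split; [apply: um_sl|].
have Ql c : Q (lm c) by split; [apply: lm_sl|].
have Qw : Q wm.
  have -> : wm = um (-1) *m lm 1 *m um (-1) by rewrite !mx2M; congr mx2; ring.
  exact: QM _ _ (QM _ _ (Qu _) (Ql _)) (Qu _).
have Qt a : a != 0 -> Q (tm a).
  move=> a0; have -> : tm a = um a *m lm (- a^-1) *m um a *m wm.
    by rewrite !mx2M; congr mx2; field.
  exact: QM _ _ (QM _ _ (QM _ _ (Qu _) (Ql _)) (Qu _)) Qw.
move=> g gsl; suff [] : Q g by [].
have [c0|c0] := eqVneq (g 1 0) 0.
  by have [a0 ->] := sl2_borel gsl c0; apply: (QM _ _ (Qt _ a0) (Qu _)).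
rewrite (sl2_big_cell gsl c0).
apply: (QM _ _ (QM _ _ (QM _ _ (Qu _) (Qt _ _)) Qw) (Qu _)).
by rewrite invr_eq0.
Qed.

(* The anti-automorphism of transposition along the antidiagonal. *)
Definition flip2 g := mx2 (g 1 1) (g 0 1) (g 1 0) (g 0 0).

Lemma flip2_sl g : g \in sl2 -> flip2 g \in sl2.
Proof. by rewrite {1}[g]mx2E !sl2E mulrC. Qed.

Lemma flip2M g h : flip2 (g *m h) = flip2 h *m flip2 g.
Proof.
rewrite {1}[g]mx2E {1}[h]mx2E mx2M /flip2 !mx2s mx2M; congr mx2; ring.
Qed.

Lemma flip2_um b : flip2 (um b) = um b.
Proof. by rewrite /flip2 !mx2s. Qed.

End Matrices2.

Arguments wm {K}.
Arguments sl2 {K}.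

(** * Ranks and corner algebras of idempotent matrices *)

Section Idempotents.

Variable F : fieldType.

Lemma rank_orthogonal_idem n (A B : 'M[F]_n) :
  A *m A = A -> B *m B = B -> A *m B = 0 -> B *m A = 0 ->
  \rank (A + B)%R = (\rank A + \rank B)%N.
Proof.
move=> AA BB AB BA.
have e : ((A + B)%R == A + B)%MS.
  apply/andP; split; first by rewrite addmx_sub_adds ?submx_refl.
  rewrite addsmx_sub; apply/andP; split.
    by apply/submxP; exists A; rewrite mulmxDr AA AB addr0.
  by apply/submxP; exists B; rewrite mulmxDr BA BB add0r.
rewrite (eqmx_rank e); apply: mxrank_disjoint_sum; apply/eqP/rowV0P => v.
rewrite sub_capmx => /andP[/submxP[x vx] /submxP[y vy]].
by rewrite vx -AA mulmxA -vx vy -mulmxA BA mulmx0.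
Qed.

Lemma sum_rank_orthogonal_idem n (S : finType) (A : S -> 'M[F]_n) :
  (forall s s', A s *m A s' = if s == s' then A s else 0) ->
  \sum_s A s = 1%:M -> (\sum_s \rank (A s) = n)%N.
Proof.
move=> AE A1; rewrite -[RHS](mxrank1 F) -A1.
have R0 l s : s \notin l -> A s *m (\sum_(i <- l) A i) = 0.
  move=> sl; rewrite mulmx_sumr big_seq_cond big1 // => i /andP[il _].
  by rewrite AE; case: eqP sl => // ->; rewrite il.
have L0 l s : s \notin l -> (\sum_(i <- l) A i) *m A s = 0.
  move=> sl; rewrite mulmx_suml big_seq_cond big1 // => i /andP[il _].
  by rewrite AE; case: eqP sl => // <-; rewrite il.
have LL l : uniq l -> (\sum_(i <- l) A i) *m (\sum_(i <- l) A i) = \sum_(i <- l) A i.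
  elim: l => [|s l IH] /=; first by rewrite big_nil mulmx0.
  move=> /andP[sl ul]; rewrite !big_cons mulmxDl !mulmxDr IH // R0 // L0 //.
  by rewrite AE eqxx addr0 add0r.
have : uniq (index_enum S) by apply: index_enum_uniq.
elim: (index_enum S) => [|s l IH] /=; first by rewrite !big_nil mxrank0.
move=> /andP[sl ul]; rewrite !big_cons IH // rank_orthogonal_idem ?AE ?eqxx //.
- exact: LL.
- exact: R0.
- exact: L0.
Qed.

Lemma idem_factor n (E : 'M[F]_n) : E *m E = E ->
  exists C : 'M_(n, \rank E), exists2 R : 'M_(\rank E, n), E = C *m R & R *m C = 1%:M.
Proof.
move=> EE; exists (col_base E), (row_base E); first by rewrite mulmx_base.
apply: (row_full_inj (col_base_full E)); rewrite mulmx1 mulmxA.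
apply: (row_free_inj (row_base_free E)); rewrite /= mulmx_base -mulmxA mulmx_base.
exact: EE.
Qed.

(** The corner algebra of [E] is the full matrix algebra of size [\rank E], which is commutative
    only up to size 1. *)
Lemma idem_corner_comm n (E : 'M[F]_n) : E *m E = E ->
  (forall M N, E *m M *m E *m N *m E = E *m N *m E *m M *m E) -> (\rank E <= 1)%N.
Proof.
move=> EE cE; have [C [R ECR RC]] := idem_factor EE.
move: (\rank E) C R ECR RC => k C R ECR RC.
have comm (M N : 'M[F]_k) : M *m N = N *m M.
  have kE X : E *m (C *m X *m R) *m E = C *m X *m R.
    by rewrite ECR !mulmxA -(mulmxA C R C) RC mulmx1 -!mulmxA (mulmxA R) RC mul1mx.
  have := cE (C *m M *m R) (C *m N *m R); rewrite kE.
  have e X Y : C *m X *m R *m (C *m Y *m R) *m E = C *m (X *m Y) *m R.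
    by rewrite ECR !mulmxA -(mulmxA _ R C) RC mulmx1 -(mulmxA _ R C) RC mulmx1.
  rewrite e kE e => H.
  have {}H := congr1 (fun Z => R *m Z *m C) H.
  by move: H; rewrite !mulmxA RC !mul1mx -!(mulmxA _ R C) RC !mulmx1.
case: k {C R ECR RC} comm => [|[|k]] // comm.
have /matrixP/(_ 0 0) := comm (delta_mx 0 1) (delta_mx 1 0).
rewrite !mulmx_deltaE !mxE /= => /eqP.
by rewrite ?mulr0n ?mulr1n ?oner_eq0.
Qed.

Lemma rank1_idem_trace n (E : 'M[F]_n) : E *m E = E -> (\rank E <= 1)%N ->
  \tr E = (\rank E)%:R.
Proof.
move=> EE; have [C [R ECR RC]] := idem_factor EE.
move=> _; move: (\rank E) C R ECR RC => k C R -> RC.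
by rewrite mxtrace_mulC RC mxtrace1.
Qed.

End Idempotents.

Lemma closed_eigenvector (F : closedFieldType) m n (V : 'M[F]_(m, n)) (X : 'M[F]_n) :
  V != 0 -> (V *m X <= V)%MS ->
  exists2 v : 'rV_n, v != 0 /\ (v <= V)%MS & exists a, v *m X = a *: v.
Proof.
rewrite -mxrank_eq0 -lt0n => V0 VX.
have /submxP[Y BX] : (row_base V *m X <= row_base V)%MS.
  by rewrite (eqmxMr _ (eq_row_base V)) eq_row_base.
have [a Ya] : exists a, root (char_poly Y) a.
  by apply: closed_rootP; rewrite size_char_poly; case: (\rank V) V0.
rewrite -eigenvalue_root_char in Ya; have [y yY y0] := eigenvalueP Ya.
exists (y *m row_base V); last by exists a; rewrite -mulmxA BX mulmxA yY scalemxAl.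
split; last by rewrite (submx_trans (submxMl _ _)) // eq_row_base.
apply: contraNneq y0 => yB; apply/eqP/(row_free_inj (row_base_free V)).
by rewrite yB mul0mx.
Qed.

(** * Weight spaces of the unipotent subgroup *)

Notation sl2_rep := (mrep (sl2) 1%:M (@mulmx _ _ _ _)).

(** The second clause is the orthogonality of the characters [psi (s * b)]; it encodes that [psi] is
    nontrivial. *)
Definition additive_character (K : finFieldType) (F : fieldType) (psi : K -> F) :=
  (forall a b, psi (a + b) = psi a * psi b)
  /\ forall s, \sum_b psi (s * b) = #|K|%:R *+ (s == 0).

Section Fourier.

Variables (K : finFieldType) (F : fieldType) (psi : K -> F).
Hypothesis qF : #|K|%:R != 0 :> F.
Hypothesis psiP : additive_character psi.

Let psiD a b : psi (a + b) = psi a * psi b. Proof. exact: psiP.1. Qed.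

Lemma psi0 : psi 0 = 1.
Proof.
have := psiP.2 0; rewrite eqxx mulr1n.
rewrite (eq_bigr (fun=> psi 0)) => [|b _]; last by rewrite mul0r.
by rewrite sumr_const => pK; apply: (mulIf qF); rewrite mul1r mulr_natr.
Qed.

Variables (n : nat) (r : 'M[K]_2 -> 'M[F]_n).
Hypothesis rP : sl2_rep r.

Lemma repM g h : g \in sl2 -> h \in sl2 -> r (g *m h) = r g *m r h.
Proof. exact: rP.2. Qed.

Lemma rep1 : r 1%:M = 1%:M. Proof. exact: rP.1. Qed.

Lemma repK g h : g \in sl2 -> h \in sl2 -> g *m h = 1%:M -> r g *m r h = 1%:M.
Proof. by move=> gs hs gh; rewrite -repM // gh rep1. Qed.

(** The projector on the weight space of the character [psi (s * b)] of the unipotent subgroup,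
    locked so that the sum is not unfolded by accident. *)
Definition isotyp (s : K) : 'M[F]_n :=
  locked (#|K|%:R^-1 *: \sum_b psi (- (s * b)) *: r (um b)).

Lemma isotypE s :
  isotyp s = #|K|%:R^-1 *: \sum_b psi (- (s * b)) *: r (um b).
Proof. by rewrite /isotyp -lock. Qed.

Lemma rep_um_isotyp b s : r (um b) *m isotyp s = psi (s * b) *: isotyp s.
Proof.
rewrite !isotypE -scalemxAr scalerA mulrC -scalerA; congr (_ *: _).
rewrite mulmx_sumr scaler_sumr (reindex (fun c => c - b)) /=; last first.
  by exists (fun c => c + b) => c _; rewrite ?addrK ?subrK.
apply: eq_bigr => c _; rewrite -scalemxAr -repM ?um_sl // umD scalerA -psiD.
by rewrite (addrC b) subrK; congr (psi _ *: _); ring.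
Qed.

Lemma isotyp_rep_um b s : isotyp s *m r (um b) = psi (s * b) *: isotyp s.
Proof.
rewrite -rep_um_isotyp !isotypE -scalemxAl -scalemxAr; congr (_ *: _).
rewrite mulmx_sumr mulmx_suml; apply: eq_bigr => c _.
by rewrite -scalemxAl -scalemxAr -!repM ?um_sl // !umD addrC.
Qed.

Lemma isotypM s s' : isotyp s *m isotyp s' = if s == s' then isotyp s else 0.
Proof.
rewrite {1}isotypE -scalemxAl mulmx_suml.
under eq_bigr => b _ do rewrite -scalemxAl rep_um_isotyp scalerA -psiD -mulNr -mulrDl.
rewrite -scaler_suml psiP.2 scalerA addrC subr_eq0 eq_sym.
by case: eqP => [->|_]; rewrite ?mulr0 ?scale0r // mulr1n mulVf // scale1r.
Qed.

Lemma isotyp_idem s : isotyp s *m isotyp s = isotyp s.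
Proof. by rewrite isotypM eqxx. Qed.

Lemma sum_isotyp : \sum_s isotyp s = 1%:M.
Proof.
under eq_bigr do rewrite isotypE.
rewrite -scaler_sumr exchange_big /= (bigD1 0) //= [X in _ + X]big1 ?addr0 => [|b b0].
  rewrite (eq_bigr (fun=> 1%:M)) => [|s _].
    by rewrite sumr_const -[1%:M *+ _]scaler_nat scalerA mulVf // scale1r.
  by rewrite mulr0 oppr0 psi0 scale1r um0 rep1.
rewrite -scaler_suml (eq_bigr (fun s => psi (- b * s))) => [|s _].
  by rewrite psiP.2 oppr_eq0 (negPf b0) scale0r.
by congr psi; ring.
Qed.

Lemma sum_rank_isotyp : (\sum_s \rank (isotyp s))%N = n.
Proof. exact: sum_rank_orthogonal_idem isotypM sum_isotyp. Qed.

Lemma rep_tm_isotyp a s : a != 0 ->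
  r (tm a) *m isotyp (a ^+ 2 * s) = isotyp s *m r (tm a).
Proof.
move=> a0; rewrite !isotypE -scalemxAl -scalemxAr; congr (_ *: _).
rewrite mulmx_suml mulmx_sumr [RHS](reindex (fun b => a ^+ 2 * b)) /=; last first.
  exists (fun b => (a ^+ 2)^-1 * b) => b _.
    by rewrite mulKf // expf_neq0.
  by rewrite mulVKf // expf_neq0.
apply: eq_bigr => b _.
rewrite -scalemxAl -scalemxAr -!repM ?um_sl ?tm_sl // tm_um //.
by congr (psi _ *: _); ring.
Qed.

Lemma rank_isotyp_tm a s : a != 0 -> \rank (isotyp (a ^+ 2 * s)) = \rank (isotyp s).
Proof.
move=> a0; have ts := tm_sl a0; have ai0 : a^-1 != 0 by rewrite invr_eq0.
have tK : r (tm a) *m r (tm a^-1) = 1%:M.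
  by rewrite repK ?tm_sl // tmM divff // tm1.
have /mulmx1_unit[u1 _] := tK.
have := rep_tm_isotyp s a0 => /(congr1 mxrank).
by rewrite (eqmxMfull _ _) ?row_full_unit // mxrankMfree // row_free_unit.
Qed.

(** On the big cell [flip2] exchanges the two unipotent factors, and the weight only sees the sum of
    their parameters. On the Borel subgroup the torus moves the weight [s] to another one, unless
    the square of the diagonal entry is 1, and then [flip2] fixes [x]. *)
Lemma isotyp_flip s x : s != 0 -> x \in sl2 ->
  isotyp s *m r x *m isotyp s = isotyp s *m r (flip2 x) *m isotyp s.
Proof.
move=> s0 xs; have fs := flip2_sl xs.
have big g c e f : c != 0 -> g = um e *m tm c *m wm *m um f ->
  isotyp s *m r g *m isotyp s =
    psi (s * (e + f)) *: (isotyp s *m r (tm c *m wm) *m isotyp s).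
  move=> c0 ->; rewrite !repM ?sl2M ?um_sl ?tm_sl ?wm_sl //.
  rewrite !mulmxA isotyp_rep_um -!scalemxAl -(mulmxA _ (r (um f))) rep_um_isotyp.
  by rewrite -scalemxAr scalerA -psiD -mulrDr.
have [c0|c0] := eqVneq (x 1 0) 0; last first.
  have ci : (x 1 0)^-1 != 0 by rewrite invr_eq0.
  rewrite (big _ _ _ _ ci (sl2_big_cell xs c0)).
  have := sl2_big_cell fs; rewrite {1}/flip2 mx2_10 => /(_ c0) fE.
  rewrite /flip2 !mx2s in fE; rewrite (big _ _ _ _ ci fE).
  by rewrite addrC.
have low g : g \in sl2 -> g 1 0 = 0 -> (g 0 0) ^+ 2 != 1 ->
    isotyp s *m r g *m isotyp s = 0.
  move=> gs g10 g2; have [a0 ->] := sl2_borel gs g10.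
  rewrite repM ?tm_sl ?um_sl // -!mulmxA rep_um_isotyp -!scalemxAr mulmxA.
  rewrite -rep_tm_isotyp // -mulmxA isotypM; case: eqP => [/eqP|_]; last first.
    by rewrite mulmx0 scaler0.
  by rewrite -subr_eq0 -{2}[s]mul1r -mulrBl mulf_eq0 subr_eq0 (negPf g2) (negPf s0).
have [a2|a2] := eqVneq (x 0 0 ^+ 2) 1.
  congr (_ *m r _ *m _); rewrite {1}[x]mx2E /flip2.
  have : x 0 0 * x 1 1 = 1.
    by move: xs; rewrite {1}[x]mx2E sl2E c0 mulr0 subr0 => /eqP.
  rewrite -a2 expr2 => /mulfI ->//.
  by apply/eqP => x0; move: a2; rewrite x0 expr0n => /eqP; rewrite eq_sym oner_eq0.
rewrite !low // /flip2 ?mx2_10 // mx2_00.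
apply: contraNneq a2 => d2; move: xs; rewrite {1}[x]mx2E sl2E c0 mulr0 subr0 => /eqP ad.
have : (x 0 0 * x 1 1) ^+ 2 = 1 by rewrite ad expr1n.
by rewrite exprMn d2 mulr1 => ->.
Qed.

Hypothesis ri : airr (sl2) r.

(** Gelfand's trick: [flip2] reverses products and fixes the unipotent subgroup, so by [isotyp_flip]
    the corner algebra of [isotyp s] is commutative. *)
Lemma rank_isotyp_le1 s : s != 0 -> (\rank (isotyp s) <= 1)%N.
Proof.
move=> s0; apply: idem_corner_comm; first exact: isotyp_idem.
pose E := isotyp s.
have flp g h : g \in sl2 -> h \in sl2 ->
    E *m r g *m E *m r h *m E = E *m r h *m E *m r g *m E.
  (* Expanding the middle [E] turns the product into an average of terms [E *m r x *m E], to which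
     [isotyp_flip] applies. *)
  move=> gs hs; pose G x y := #|K|%:R^-1 *: \sum_b psi (- (s * b)) *: (E *m r (x *m um b *m y) *m E).
  have GE x y : x \in sl2 -> y \in sl2 -> E *m r x *m E *m r y *m E = G x y.
    move=> xs ys; rewrite -(mulmxA _ E) {2}/E isotypE -!scalemxAl -!scalemxAr -!scalemxAl.
    congr (_ *: _); rewrite mulmx_suml mulmx_sumr mulmx_suml; apply: eq_bigr => b _.
    by rewrite -scalemxAl -scalemxAr -scalemxAl !repM ?sl2M ?um_sl // !mulmxA.
  rewrite GE //; transitivity (G (flip2 h) (flip2 g)).
    congr (_ *: _); apply: eq_bigr => b _; congr (_ *: _).
    by rewrite isotyp_flip ?sl2M ?um_sl // !flip2M flip2_um mulmxA.
  rewrite -GE ?flip2_sl // -(isotyp_flip s0 hs) -/E.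
  transitivity (E *m r h *m (E *m r (flip2 g) *m E)); first by rewrite !mulmxA.
  by rewrite -(isotyp_flip s0 gs) !mulmxA.
move=> M N; apply/eqP; rewrite -subr_eq0; apply/eqP; move: N M.
have E2 g : g \in sl2 -> forall M, E *m M *m E *m r g *m E - E *m r g *m E *m M *m E = 0.
  move=> gs; pose f1 M := E *m M *m E *m r g *m E - E *m r g *m E *m M *m E.
  have f1l : linear f1.
    move=> c A B; rewrite /f1 !(mulmxDr, mulmxDl) -!(scalemxAl, scalemxAr) scalerBr opprD.
    by rewrite addrACA.
  pose F1 : {linear 'M[F]_n -> 'M[F]_n} := HB.pack f1 (GRing.isLinear.Build _ _ _ _ f1 f1l).
  by apply: (airr_eq0 (f := F1) ri) => h hs; rewrite /= /f1 flp // subrr.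
move=> N M; move: N; pose f1 N := E *m M *m E *m N *m E - E *m N *m E *m M *m E.
have f1l : linear f1.
  move=> c A B; rewrite /f1 !(mulmxDr, mulmxDl) -!(scalemxAl, scalemxAr) scalerBr opprD.
  by rewrite addrACA.
pose F1 : {linear 'M[F]_n -> 'M[F]_n} := HB.pack f1 (GRing.isLinear.Build _ _ _ _ f1 f1l).
by apply: (airr_eq0 (f := F1) ri) => h hs; rewrite /= /f1 E2.
Qed.

End Fourier.

Lemma finField_generator (K : finFieldType) :
  exists2 z : K, z != 0 & forall a, a != 0 -> exists k, a = z ^+ k.
Proof.
have [z zP] := cyclicP (field_unit_group_cyclic [set: {unit K}]).
exists (val z) => [|a a0]; first by rewrite -unitfE (valP z).
have au : a \is a GRing.unit by rewrite unitfE.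
have : FinRing.unit K au \in <[z]>%g by rewrite -zP inE.
by case/cycleP => k /(congr1 val) /= ->; exists k; rewrite FinRing.val_unitX.
Qed.

(** * Highest weight vectors and the projective line *)

Section HighestWeight.

Variables (K : finFieldType) (F : fieldType).
Implicit Types (la : K -> F).

(** Vectors are rows, acted on from the right; the value of [la] at 0 is left free. *)
Definition hwv n (r : 'M[K]_2 -> 'M[F]_n) la (v : 'rV_n) :=
  (forall b, v *m r (um b) = v) /\ (forall a, a != 0 -> v *m r (tm a) = la a *: v).

Section OneRep.

Variables (n : nat) (r : 'M[K]_2 -> 'M[F]_n).
Hypotheses (rP : sl2_rep r).

Lemma rep_trace_conj k g h : k \in sl2 -> g \in sl2 -> h \in sl2 ->
  k *m g = h *m k -> \tr (r g) = \tr (r h).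
Proof.
move=> ks gs hs kg.
have ku : k \in unitmx by move: ks; rewrite unitmxE inE => /eqP->; apply: unitr1.
have kis : invmx k \in sl2.
  by move: ks; rewrite !inE det_inv => /eqP->; rewrite invr1.
have -> : g = invmx k *m (h *m k) by rewrite -kg mulKmx.
rewrite !(repM rP) ?sl2M // mulmxA mxtrace_mulC !mulmxA -(repM rP) // mulmxV //.
by rewrite rep1 // mul1mx.
Qed.

Lemma hwv_orbit la v g : hwv r la v -> g \in sl2 ->
  exists c, v *m r g = c *: v \/ exists b, v *m r g = c *: (v *m r (wm *m um b)).
Proof.
move=> [vu vt] gs; have [c0|c0] := eqVneq (g 1 0) 0.
  have [a0 ->] := sl2_borel gs c0; exists (la (g 0 0)); left.
  by rewrite (repM rP) ?tm_sl ?um_sl // mulmxA vt // -scalemxAl vu.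
exists (la (g 1 0)^-1); right; exists (g 1 1 / g 1 0).
have ci : (g 1 0)^-1 != 0 by rewrite invr_eq0.
rewrite {1}(sl2_big_cell gs c0) -mulmxA -mulmxA mulmxA.
rewrite !(repM rP) ?sl2M ?tm_sl ?um_sl ?wm_sl // !mulmxA vu vt //.
by rewrite -!scalemxAl.
Qed.

(* The function la below is constantly 1, so v generates a quotient of the
   permutation module on the projective line; this is the orbit sum. *)
Lemma hwv1_fixed v : hwv r (fun=> 1) v ->
  let y := v + \sum_b v *m r (wm *m um b) in {in sl2, forall g, y *m r g = y}.
Proof.
move=> [vu vt] y.
have yu b : y *m r (um b) = y.
  rewrite mulmxDl vu; congr (_ + _); rewrite mulmx_suml.
  rewrite [RHS](reindex (fun c => c + b)) /=; last first.
    by exists (fun c => c - b) => c _; rewrite ?addrK ?subrK.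
  apply: eq_bigr => c _.
  by rewrite -mulmxA -(repM rP) ?sl2M ?wm_sl ?um_sl // -mulmxA umD.
have yw : y *m r wm = y.
  rewrite mulmxDl mulmx_suml (bigD1 0) //= /y [in RHS](bigD1 0) //= addrCA.
  congr (_ + (_ + _)).
  - rewrite um0 mulmx1 -mulmxA -(repM rP) ?wm_sl // wm2 vt ?scale1r //.
    by rewrite oppr_eq0 oner_eq0.
  - by rewrite um0 mulmx1.
  rewrite [RHS](reindex (fun b => - b^-1)) /=; last first.
    by exists (fun b => - b^-1) => b _; rewrite invrN invrK opprK.
  apply: eq_big => b; first by rewrite oppr_eq0 invr_eq0.
  move=> b0; rewrite -mulmxA -(repM rP) ?sl2M ?um_sl ?wm_sl //.
  have -> : wm *m um b *m wm = um (- b^-1) *m tm b^-1 *m (wm *m um (- b^-1)).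
    by rewrite !mx2M invrK; congr mx2; field.
  rewrite (repM rP) ?sl2M ?um_sl ?wm_sl ?tm_sl ?invr_eq0 // mulmxA.
  by rewrite (repM rP) ?um_sl ?tm_sl ?invr_eq0 // mulmxA vu vt ?invr_eq0 // scale1r.
apply: sl2_ind => // [c|g h gs hs yg yh]; last by rewrite (repM rP) // mulmxA yg yh.
have wK : r wm *m r (tm (-1) *m wm) = 1%:M.
  rewrite repK ?sl2M ?wm_sl ?tm_sl ?oppr_eq0 ?oner_eq0 //.
  by rewrite /tm !mx2M -mx2_1 invrN1; congr mx2; ring.
rewrite -[r (lm c)]mulmx1 -wK 2!mulmxA -(mulmxA y) -(repM rP) ?lm_sl ?wm_sl //.
rewrite lm_conj (repM rP) ?um_sl ?wm_sl // mulmxA yw yu.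
by rewrite -{1}yw -mulmxA wK mulmx1.
Qed.

Hypothesis ri : airr sl2 r.

Lemma airr_fixed (y : 'rV_n) : (1 < n)%N -> {in sl2, forall g, y *m r g = y} -> y = 0.
Proof.
move=> n1 yr; apply/eqP/rV0Pn => -[k yk].
have [l lk] : exists l : 'I_n, l != k.
  pose o0 := Ordinal (ltnW n1); pose o1 := Ordinal n1.
  by have [->|] := eqVneq k o0; [exists o1 | exists o0; rewrite eq_sym].
(* Since [y] is fixed, a column [x] with [y *m x = 0] makes [x *m y] trace-orthogonal to every
   [r g], hence 0. *)
pose x : 'cV[F]_n := y 0 k *: delta_mx l 0 - y 0 l *: delta_mx k 0.
have yx : y *m x = 0.
  by rewrite mulmxBr -!scalemxAr -!colE; apply/matrixP => i j; rewrite !mxE !ord1 mulrC subrr.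
have /matrixP/(_ l k) : x *m y = 0.
  by apply: ri => g gs; rewrite -mulmxA yr // mxtrace_mulC yx linear0.
rewrite !mxE big_ord1 !mxE !eqxx (negPf lk) mulr1 mulr0 subr0 => /eqP.
by rewrite mulf_eq0 (negPf yk).
Qed.

(** The [r g] span all matrices, so [v] generates the whole space and each row of [E] is a
    combination of rows [v *m r g *m E]. *)
Lemma airr_cyclic (v : 'rV_n) m (E : 'M_(n, m)) p (W : 'M_(p, m)) : v != 0 ->
  {in sl2, forall g, (v *m r g *m E <= W)%MS} -> (E <= W)%MS.
Proof.
move=> /rV0Pn[k vk] vW; apply/row_subP => i.
have [a sa aE] := airr_span ri ((v 0 k)^-1 *: delta_mx k i).
have -> : row i E = v *m lext r a *m E.
  rewrite aE rowE; congr (_ *m _); apply/rowP => j.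
  rewrite -scalemxAr [RHS]mxE mulmx_deltaE mxE eqxx /=.
  by case: (j == i); rewrite ?mulr0n ?mulr0 // mulr1n mulVf.
rewrite /lext mulmx_sumr mulmx_suml big_seq.
apply: (big_ind (fun A : 'rV_m => (A <= W)%MS)) => [|A B|x xa]; [exact: sub0mx|exact: addmx_sub|].
by rewrite -scalemxAr -scalemxAl scalemx_sub // vW //; apply: (allP sa).
Qed.

End OneRep.
End HighestWeight.

Section HighestWeightFamily.

Variables (K : finFieldType) (F : fieldType) (n k : nat).
Variable r : 'I_k -> 'M[K]_2 -> 'M[F]_n.
Hypothesis rP : forall i, sl2_rep (r i).
Hypothesis ri : forall i, airr sl2 (r i).
Hypothesis rN : forall i j, i != j -> ~ intertwined sl2 (r i) (r j).
Variables (la : K -> F) (v : 'I_k -> 'rV[F]_n).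
Hypothesis v0 : forall i, v i != 0.
Hypothesis vP : forall i, hwv (r i) la (v i).

(** [option K] is the projective line, with [None] for the point fixed by the Borel subgroup. *)
Let pt (x : option K) : 'M[K]_2 := if x is Some b then wm *m um b else 1%:M.

Let A : 'M[F]_(#|{: option K}|, k * n) :=
  \matrix_x mxvec (\matrix_(i < k) (v i *m r i (pt (enum_val x)))).

(** A relation between the columns of [A] gives coefficients [(z i)^T *m v i] whose traces cancel at
    the points of the projective line, hence on all of SL_2, since the [v i] share the weight [la];
    independence makes them 0. In other words, the sum of the [r i] is a quotient of a single
    principal series. *)
Let row_fullA : row_full A.
Proof.
rewrite -cokermx_eq0; apply/eqP/trmx_inj/row_matrixP => j; rewrite trmx0 row0.
rewrite -tr_col; set y := (col j _)^T.
have Ay : A *m y^T = 0 by rewrite /y trmxK -col_mul mulmx_coker colE mul0mx.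
pose z i := row i (vec_mx y : 'M[F]_(k, n)).
have pz x : \sum_i (v i *m r i (pt x) *m (z i)^T) 0 0 = 0.
  move/(congr1 (row (enum_rank x))): Ay; rewrite row_mul rowK row0 enum_rankK.
  rewrite -[y]vec_mxK => /rowP/(_ 0); rewrite mxvec_trace mxE => trE.
  rewrite -[RHS]trE /mxtrace; apply: eq_bigr => i _; rewrite [RHS]mxE [LHS]mxE.
  by apply: eq_bigr => l _; rewrite !mxE.
have gz g : g \in sl2 -> \sum_i \tr ((z i)^T *m v i *m r i g) = 0.
  move=> gs; have trE i : \tr ((z i)^T *m v i *m r i g) = (v i *m r i g *m (z i)^T) 0 0.
    by rewrite -mulmxA mxtrace_mulC -trace_mx11.
  under eq_bigr do rewrite trE.
  have [g10|g10] := eqVneq (g 1 0) 0.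
    have [a0 gE] := sl2_borel gs g10.
    transitivity (la (g 0 0) * \sum_i (v i *m r i (pt None) *m (z i)^T) 0 0); last first.
      by rewrite pz mulr0.
    rewrite mulr_sumr; apply: eq_bigr => i _.
    have [vu vt] := vP i; rewrite /= (rep1 (rP i)) mulmx1 gE (repM (rP i)) ?tm_sl ?um_sl //.
    by rewrite (mulmxA (v i)) vt // -scalemxAl vu -scalemxAl mxE -gE.
  have ci : (g 1 0)^-1 != 0 by rewrite invr_eq0.
  transitivity (la (g 1 0)^-1 *
      \sum_i (v i *m r i (pt (Some (g 1 1 / g 1 0))) *m (z i)^T) 0 0); last first.
    by rewrite pz mulr0.
  rewrite mulr_sumr; apply: eq_bigr => i _; have [vu vt] := vP i.
  rewrite {1}(sl2_big_cell gs g10) -mulmxA -mulmxA (mulmxA (v i)).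
  rewrite mulmxA !(repM (rP i)) ?sl2M ?tm_sl ?um_sl ?wm_sl //.
  by rewrite !mulmxA vu vt // -!scalemxAl mxE.
have z0 i : z i = 0.
  have : (z i)^T *m v i = 0.
    by apply: (coef_independence (@sl2_1 K) (@sl2M K) rP ri rN (C := fun i => (z i)^T *m v i)).
  have /rV0Pn[l vl] := v0 i; move=> zv; apply/rowP => m; rewrite [RHS]mxE.
  move/matrixP/(_ m l): zv; rewrite !mxE big_ord1 !mxE => /eqP.
  by rewrite mulf_eq0 (negPf vl) orbF => /eqP.
rewrite -[y]vec_mxK; apply/eqP; rewrite mxvec_eq0; apply/eqP/row_matrixP => i.
by rewrite row0; apply: z0.
Qed.

Let rankA : (k * n)%N = \rank A. Proof. by apply/esym/eqP; exact: row_fullA. Qed.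

Let cardA : #|{: option K}| = #|K|.+1. Proof. exact: card_option. Qed.

Lemma hwv_family_bound : (k * n <= #|K|.+1)%N.
Proof. by rewrite rankA -cardA rank_leq_row. Qed.

(** For the trivial weight the sum over all points is a fixed vector, hence 0: the rows of [A] are
    dependent and one dimension is lost. *)
Lemma hwv1_family_bound : la =1 (fun=> 1) -> (1 < n)%N -> (k * n <= #|K|)%N.
Proof.
move=> la1 n1; rewrite rankA -ltnS -cardA ltn_neqAle rank_leq_row andbT.
apply/negP => Afree; pose e : 'rV[F]_#|{: option K}| := const_mx 1.
have : e = 0.
  apply: (row_free_inj Afree); rewrite /= mul0mx; apply: (can_inj vec_mxK).
  rewrite mulmx_sum_row !linear_sum linear0; apply/row_matrixP => i; rewrite row0.
  have vi1 : hwv (r i) (fun=> 1) (v i).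
    by have [vu vt] := vP i; split=> // a a0; rewrite vt // la1.
  rewrite linear_sum -[RHS](airr_fixed (@ri i) n1 (hwv1_fixed (rP i) vi1)).
  transitivity (\sum_(x : option K) v i *m r i (pt x)).
    rewrite [RHS](reindex (fun x : 'I_#|{: option K}| => enum_val x)) /=; last first.
      by exists enum_rank => x _; rewrite ?enum_valK ?enum_rankK.
    by apply: eq_bigr => x _; rewrite mxE scale1r rowK mxvecK rowK.
  rewrite (bigD1 None) //= (rep1 (rP i)) mulmx1; congr (_ + _).
  rewrite (reindex_omap Some id) => [|[]//]; apply: eq_bigl => b.
  by rewrite eqxx.
move/rowP/(_ (enum_rank None)); rewrite !mxE => /eqP.
by rewrite oner_eq0.
Qed.

End HighestWeightFamily.

(** * Invariants of the unipotent subgroup *)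

Section UnipotentInvariants.

Variables (K : finFieldType) (F : closedFieldType) (psi : K -> F).
Hypothesis qF : #|K|%:R != 0 :> F.
Hypothesis psiP : additive_character psi.

Variables (n : nat) (r : 'M[K]_2 -> 'M[F]_n).
Hypotheses (rP : sl2_rep r) (ri : airr sl2 r).

Local Notation E := (isotyp psi r).

Lemma rep_um_isotyp0 b : r (um b) *m E 0 = E 0.
Proof. by rewrite rep_um_isotyp // mul0r (psi0 qF psiP) scale1r. Qed.

Lemma isotyp0_rep_um b : E 0 *m r (um b) = E 0.
Proof. by rewrite isotyp_rep_um // mul0r (psi0 qF psiP) scale1r. Qed.

Lemma rep_tm_isotyp0 a : a != 0 -> r (tm a) *m E 0 = E 0 *m r (tm a).
Proof. by move=> a0; have := rep_tm_isotyp psi rP 0 a0; rewrite mulr0. Qed.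

(** If only the weight 0 occurs, the unipotent subgroup acts trivially, and so does its conjugate by
    [wm]; together they generate SL_2. *)
Lemma isotyp0_eq1_bound : (forall s, s != 0 -> E s = 0) -> (n <= 1)%N.
Proof.
move=> Es; have E1 : E 0 = 1%:M.
  by have := sum_isotyp qF psiP rP; rewrite (bigD1 0) //= big1 ?addr0.
have ru b : r (um b) = 1%:M by rewrite -[LHS]mulmx1 -E1 rep_um_isotyp0.
have wu : r wm \in unitmx.
  have : r wm *m r (tm (-1) *m wm) = 1%:M.
    rewrite (repK rP) ?sl2M ?wm_sl ?tm_sl ?oppr_eq0 ?oner_eq0 //.
    by rewrite /tm !mx2M -mx2_1 invrN1; congr mx2; ring.
  by case/mulmx1_unit.
have r1 : {in sl2, forall g, r g = 1%:M}.
  apply: sl2_ind => // [c|g h gs hs rg rh]; last by rewrite (repM rP) // rg rh mul1mx.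
  apply: (can_inj (mulmxK wu)); rewrite -(repM rP) ?lm_sl ?wm_sl //.
  by rewrite lm_conj (repM rP) ?um_sl ?wm_sl // ru mulmx1 mul1mx.
case: n r rP ri r1 => [|[|m]] // r' _ r'i r1.
have /matrixP/(_ 0 (lift 0 0)) : delta_mx 0 (lift 0 0) = 0 :> 'M[F]_m.+2.
  apply: r'i => g gs; rewrite r1 // mulmx1 /mxtrace big1 // => i _.
  by rewrite mxE; case: eqP => // ->.
by rewrite !mxE !eqxx /= => /eqP; rewrite oner_eq0.
Qed.

Lemma hwv_isotyp0 la v : hwv r la v -> v *m E 0 = v.
Proof.
move=> [vu _]; rewrite isotypE -scalemxAr mulmx_sumr.
under eq_bigr => b _ do rewrite -scalemxAr vu mul0r oppr0 (psi0 qF psiP) scale1r.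
by rewrite sumr_const -scaler_nat scalerA mulVf // scale1r.
Qed.

Lemma isotyp0_um (v : 'rV_n) b : v *m E 0 = v -> v *m r (um b) = v.
Proof. by move=> vE; rewrite -vE -mulmxA isotyp0_rep_um. Qed.

(** The torus is cyclic and preserves the image of [E 0]; an eigenvector of a generator there is a
    highest weight vector. *)
Lemma hwv_exists : E 0 != 0 -> exists2 v, v != 0 & exists la, hwv r la v.
Proof.
move=> E0; have [z z0 zP] := finField_generator K.
have tE : (E 0 *m r (tm z) <= E 0)%MS by rewrite -rep_tm_isotyp0 // submxMl.
have [v [v0 vE] [c vc]] := closed_eigenvector E0 tE.
have vz j : v *m r (tm (z ^+ j)) = c ^+ j *: v.
  elim: j => [|j IH]; first by rewrite tm1 (rep1 rP) mulmx1 scale1r.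
  rewrite exprS -tmM (repM rP) ?tm_sl ?expf_neq0 // mulmxA vc -scalemxAl IH.
  by rewrite scalerA -exprS.
have {}vE : v *m E 0 = v.
  by case/submxP: vE => x ->; rewrite -mulmxA isotyp_idem.
have /rV0Pn[i vi] := v0.
exists v => //; exists (fun a => (v *m r (tm a)) 0 i / v 0 i); split=> [b|a a0].
  exact: isotyp0_um.
by have [j ->] := zP a a0; rewrite vz mxE mulfK.
Qed.

Lemma hwv_weightM la v : v != 0 -> hwv r la v ->
  (forall a b, a != 0 -> b != 0 -> la (a * b) = la a * la b) /\ la 1 = 1.
Proof.
move=> /rV0Pn[i vi] [vu vt]; split=> [a b a0 b0|].
  have := vt (a * b); rewrite mulf_neq0 // => /(_ isT).
  rewrite -tmM (repM rP) ?tm_sl // mulmxA vt // -scalemxAl vt // scalerA.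
  by move/rowP/(_ i); rewrite !mxE => /(mulIf vi).
have := vt 1; rewrite oner_neq0 tm1 (rep1 rP) mulmx1 => /(_ isT).
by move/rowP/(_ i); rewrite mxE -{1}[v 0 i]mul1r => /(mulIf vi).
Qed.

(** By the Bruhat decomposition a translate of [v] is a multiple of [v] or of a unipotent translate
    of [v *m r wm], and [E 0] does not see the unipotent factor. *)
Lemma hwv_isotyp0_span la v : v != 0 -> hwv r la v ->
  (E 0 <= v + v *m r wm *m E 0)%MS.
Proof.
move=> v0 vP; apply: (airr_cyclic ri v0) => g gs.
have vE := hwv_isotyp0 vP.
have [c [->|[b ->]]] := hwv_orbit rP vP gs; rewrite -scalemxAl scalemx_sub //.
  by rewrite vE addsmxSl.
rewrite (repM rP) ?wm_sl ?um_sl // mulmxA -mulmxA rep_um_isotyp0.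
by rewrite addsmxSr.
Qed.

Lemma hwv_rank_isotyp0 la v : v != 0 -> hwv r la v -> (0 < \rank (E 0%R) <= 2)%N.
Proof.
move=> v0 vP; apply/andP; split.
  by rewrite lt0n mxrank_eq0; apply: contraNneq v0 => E0; rewrite -(hwv_isotyp0 vP) E0 mulmx0.
apply: leq_trans (mxrankS (hwv_isotyp0_span v0 vP)) _.
apply: leq_trans (mxrank_adds_leqif _ _) _.
by rewrite (leq_add (rank_leq_row v) (rank_leq_row _)).
Qed.

Lemma hwv_dual la v : hwv r la v -> hwv r (fun a => la a^-1) (v *m r wm *m E 0).
Proof.
move=> vP; split=> [b|a a0]; first by apply: isotyp0_um; rewrite -mulmxA isotyp_idem.
rewrite -mulmxA -rep_tm_isotyp0 // mulmxA -(mulmxA v) -(repM rP) ?wm_sl ?tm_sl //.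
rewrite wm_tm (repM rP) ?wm_sl ?tm_sl ?invr_eq0 // mulmxA vP.2 ?invr_eq0 //.
by rewrite -!scalemxAl.
Qed.

Lemma hwv_dual_neq0 la v : v != 0 -> hwv r la v -> \rank (E 0) = 2%N ->
  v *m r wm *m E 0 != 0.
Proof.
move=> v0 vP E2; apply/eqP => w0; have := mxrankS (hwv_isotyp0_span v0 vP).
by rewrite E2 w0 addsmx0 => /leq_trans/(_ (rank_leq_row v)).
Qed.

(* When la ^+ 2 = 1 the Hecke operator [r wm *m E 0] stabilizes the weight space of
   la, and an eigenvector of it spans the invariants of the unipotent radical. *)
Lemma hwv_quadratic_rank la v : v != 0 -> hwv r la v ->
  (forall a, a != 0 -> la a ^+ 2 = 1) -> \rank (E 0) = 1%N.
Proof.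
move=> v0 vP la2; have [z z0 zP] := finField_generator K.
have vE := hwv_isotyp0 vP; have [laM la1] := hwv_weightM v0 vP.
pose V := (E 0 :&: eigenspace (r (tm z)) (la z))%MS.
have VP u : (u <= V)%MS = (u *m E 0 == u) && (u *m r (tm z) == la z *: u).
  rewrite sub_capmx; congr (_ && _); last exact/eigenspaceP/eqP.
  apply/idP/eqP => [/submxP[x ->]|<-]; last exact: submxMl.
  by rewrite -mulmxA isotyp_idem.
have V0 : V != 0.
  apply: contraNneq v0 => V0; have : (v <= V)%MS by rewrite VP vE vP.2 // !eqxx.
  by rewrite V0 submx0.
have laV : la z^-1 = la z.
  have zi : z^-1 != 0 by rewrite invr_eq0.
  have lz0 : la z != 0.
    by apply/eqP => e; have := la2 z z0; rewrite e expr0n => /eqP; rewrite eq_sym oner_eq0.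
  by apply: (mulfI lz0); rewrite -laM // divff // la1 -expr2 la2.
have VX : (V *m (r wm *m E 0) <= V)%MS.
  apply/row_subP => i; rewrite row_mul.
  have : (row i V <= V)%MS by apply: row_sub.
  rewrite VP => /andP[/eqP uE /eqP ut]; rewrite VP; apply/andP; split.
    by rewrite -!mulmxA isotyp_idem.
  rewrite -!mulmxA -rep_tm_isotyp0 // (mulmxA (r wm)) -(repM rP) ?wm_sl ?tm_sl //.
  rewrite wm_tm (repM rP) ?wm_sl ?tm_sl ?invr_eq0 // !mulmxA.
  suff -> : row i V *m r (tm z^-1) = la z *: row i V by rewrite -!scalemxAl.
  have tK : r (tm z) *m r (tm z^-1) = 1%:M.
    by rewrite (repK rP) ?tm_sl ?invr_eq0 // tmM divff // tm1.
  rewrite -{2}[row i V]mulmx1 -tK mulmxA ut -scalemxAl scalerA -expr2 la2 //.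
  by rewrite scale1r.
have [u [u0 uV] [c uc]] := closed_eigenvector V0 VX.
move: uV; rewrite VP => /andP[/eqP uE /eqP ut].
have uz j : u *m r (tm (z ^+ j)) = la (z ^+ j) *: u.
  elim: j => [|j IH]; first by rewrite tm1 (rep1 rP) mulmx1 la1 scale1r.
  rewrite exprS -tmM (repM rP) ?tm_sl ?expf_neq0 // mulmxA ut -scalemxAl IH.
  by rewrite scalerA laM // expf_neq0.
have uP : hwv r la u.
  by split=> [b|a a0]; [exact: isotyp0_um | have [j ->] := zP a a0].
have /andP[E0 _] := hwv_rank_isotyp0 u0 uP.
apply/eqP; rewrite eqn_leq E0 andbT.
have uS := hwv_isotyp0_span u0 uP.
have uSu : (u + u *m r wm *m E 0 <= u)%MS.
  by rewrite addsmx_sub submx_refl -mulmxA uc scalemx_sub.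
exact: leq_trans (mxrankS (submx_trans uS uSu)) (rank_leq_row u).
Qed.

(** The torus element permutes the weight spaces by a multiplication with a square other than 1,
    which fixes no nonzero weight; only the weight 0 contributes to the trace. *)
Lemma trace_rep_tm a : a != 0 -> a ^+ 2 != 1 -> \tr (r (tm a)) = \tr (r (tm a) *m E 0).
Proof.
move=> a0 a2; rewrite -[r (tm a) in LHS]mulmx1 -(sum_isotyp qF psiP rP) mulmx_sumr.
rewrite linear_sum (bigD1 0) //= big1 ?addr0 // => s s0.
rewrite -(isotyp_idem qF psiP rP s) mulmxA mxtrace_mulC.
have a20 : a ^+ 2 != 0 by rewrite expf_neq0.
have := rep_tm_isotyp psi rP ((a ^+ 2)^-1 * s) a0; rewrite mulVKf // => ->.
rewrite mulmxA isotypM //; case: eqP => [e|_]; last by rewrite mul0mx linear0.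
move: a2; rewrite -subr_eq0 => /eqP[]; apply: (mulIf s0).
by rewrite mul0r mulrBl mul1r {1}e mulVKf // subrr.
Qed.

(** When the weight 0 has multiplicity one, [la a] is the trace of [r (tm a)] as soon as
    [a ^+ 2 != 1], and [wm] conjugates [tm a] to its inverse. *)
Lemma hwv_rank1_weight la v : v != 0 -> hwv r la v -> \rank (E 0) = 1%N ->
  forall a, a != 0 -> la a ^+ 2 = 1.
Proof.
move=> v0 vP E1; have [laM la1] := hwv_weightM v0 vP.
have vE := hwv_isotyp0 vP.
have [x Ex] : exists x, E 0 = x *m v.
  apply/submxP; have /mxrank_leqif_sup : (v <= E 0)%MS by rewrite -vE submxMl.
  by rewrite E1 rank_rV v0 => -[_ /esym]; rewrite eqxx.
have trE a : a != 0 -> a ^+ 2 != 1 -> \tr (r (tm a)) = la a.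
  move=> a0 a2; rewrite trace_rep_tm // rep_tm_isotyp0 // Ex -mulmxA vP.2 //.
  rewrite -scalemxAr -Ex linearZ /= (rank1_idem_trace (isotyp_idem _ _ _ _)) ?E1 //.
  by rewrite mulr1.
move=> a a0; have ai : a^-1 != 0 by rewrite invr_eq0.
have laV : la a = la a^-1.
  have [a2|a2] := eqVneq (a ^+ 2) 1.
    by congr la; apply: (mulfI a0); rewrite divff // -expr2.
  rewrite -!trE // ?exprVn ?invr_eq1 //.
  by apply: (rep_trace_conj rP (@wm_sl K)); rewrite ?tm_sl // wm_tm.
by rewrite expr2 {2}laV -laM // divff.
Qed.

End UnipotentInvariants.

(** * Twist by a diagonal automorphism *)

Section Twist.

Variables (K : finFieldType) (nu : K).
Hypothesis nu0 : nu != 0.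

(** Conjugation by diag([nu], 1) in GL_2. The twist multiplies the unipotent weights by [nu], so for
    a nonsquare [nu] it exchanges the two square classes of nonzero weights. *)
Definition dconj (g : 'M[K]_2) := mx2 (g 0 0) (nu * g 0 1) (g 1 0 / nu) (g 1 1).

Lemma dconj_sl g : g \in sl2 -> dconj g \in sl2.
Proof.
rewrite {1}[g]mx2E !sl2E => /eqP <-; apply/eqP.
by field.
Qed.

Lemma dconjM g h : dconj (g *m h) = dconj g *m dconj h.
Proof.
rewrite {1}[g]mx2E {1}[h]mx2E mx2M /dconj !mx2s mx2M.
by congr mx2; field.
Qed.

Lemma dconj1 : dconj 1%:M = 1%:M.
Proof. by rewrite -mx2_1 /dconj !mx2s mulr0 mul0r. Qed.

Lemma dconj_um b : dconj (um b) = um (nu * b).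
Proof. by rewrite /dconj !mx2s mul0r. Qed.

Lemma dconj_tm a : dconj (tm a) = tm a.
Proof. by rewrite /dconj !mx2s mulr0 mul0r. Qed.

End Twist.

Lemma dconjK (K : finFieldType) (nu : K) : nu != 0 -> cancel (dconj nu^-1) (dconj nu).
Proof.
move=> nu0 g; rewrite /dconj !mx2s invrK mulfK // mulVKf //.
by rewrite -mx2E.
Qed.

Section TwistRep.

Variables (K : finFieldType) (nu : K).
Hypothesis nu0 : nu != 0.
Variables (F : fieldType).

Definition twist n (r : 'M[K]_2 -> 'M[F]_n) g := r (dconj nu g).

Lemma twist_rep n (r : 'M[K]_2 -> 'M[F]_n) : sl2_rep r -> sl2_rep (twist r).
Proof.
move=> rP; split=> [|g h gs hs]; first by rewrite /twist dconj1 (rep1 rP).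
by rewrite /twist dconjM // (repM rP) ?dconj_sl.
Qed.

Lemma twist_airr n (r : 'M[K]_2 -> 'M[F]_n) : airr sl2 r -> airr sl2 (twist r).
Proof.
move=> ri C rC; apply: ri => g gs; have := rC (dconj nu^-1 g).
rewrite dconj_sl ?invr_eq0 // => /(_ isT).
by rewrite /twist dconjK.
Qed.

Lemma twist_intertwined n1 n2 (r1 : 'M[K]_2 -> 'M[F]_n1) (r2 : 'M[K]_2 -> 'M[F]_n2) :
  intertwined sl2 (twist r1) (twist r2) -> intertwined sl2 r1 r2.
Proof.
case=> B B0 rB; exists B => // g gs.
have := rB (dconj nu^-1 g); rewrite dconj_sl ?invr_eq0 // => /(_ isT).
by rewrite /twist dconjK.
Qed.

Lemma twist_hwv n (r : 'M[K]_2 -> 'M[F]_n) la v : hwv r la v -> hwv (twist r) la v.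
Proof.
move=> [vu vt]; split=> [b|a a0]; first by rewrite /twist dconj_um vu.
by rewrite /twist dconj_tm vt.
Qed.

Lemma isotyp_twist (psi : K -> F) n (r : 'M[K]_2 -> 'M[F]_n) s :
  isotyp psi (twist r) (nu * s) = isotyp psi r s.
Proof.
rewrite !isotypE; congr (_ *: _); rewrite [RHS](reindex (fun b => nu * b)) /=; last first.
  by exists (fun b => nu^-1 * b) => b _; rewrite ?mulKf ?mulVKf.
apply: eq_bigr => b _; rewrite /twist dconj_um; congr (psi (- _) *: _); ring.
Qed.

End TwistRep.

Section IntertwinedRank.

Variables (K : finFieldType) (F : fieldType) (psi : K -> F) (n1 n2 : nat).
Variables (r1 : 'M[K]_2 -> 'M[F]_n1) (r2 : 'M[K]_2 -> 'M[F]_n2).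

Lemma intertwined_isotyp (B : 'M_(n1, n2)) s :
  {in sl2, forall g, r1 g *m B = B *m r2 g} ->
  isotyp psi r1 s *m B = B *m isotyp psi r2 s.
Proof.
move=> rB; rewrite !isotypE -scalemxAl -scalemxAr mulmx_suml mulmx_sumr.
congr (_ *: _); apply: eq_bigr => b _.
by rewrite -scalemxAl -scalemxAr rB // um_sl.
Qed.

Hypothesis (r2P : sl2_rep r2) (r1i : airr sl2 r1) (r2i : airr sl2 r2).

(** Schur's lemma. *)
Lemma intertwined_bij (B : 'M_(n1, n2)) :
  B != 0 -> {in sl2, forall g, r1 g *m B = B *m r2 g} -> row_free B /\ row_full B.
Proof.
move=> B0 rB; split.
  rewrite -kermx_eq0; apply/rowV0P => v /sub_kermxP vB; apply: contraNeq B0 => v0.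
  rewrite -submx0; apply: (airr_cyclic r1i v0) => g gs.
  by rewrite -mulmxA rB // mulmxA vB mul0mx sub0mx.
rewrite -cokermx_eq0; apply: contraNT B0 => /matrix0Pn[i [j yij]].
have [y yi By] : exists2 y : 'cV_n2, y i 0 != 0 & B *m y = 0.
  exists (col j (cokermx B)); first by rewrite mxE.
  by rewrite -col_mul mulmx_coker colE mul0mx.
apply/eqP/row_matrixP => k; rewrite row0.
have yB : y *m row k B = 0.
  apply: r2i => g gs; rewrite -mulmxA mxtrace_mulC -row_mul -rB // -row_mul -mulmxA By.
  by rewrite mulmx0 row0 linear0.
apply/rowP => l; move/matrixP/(_ i l): yB; rewrite !mxE big_ord1 !mxE => /eqP.
by rewrite mulf_eq0 (negPf yi) => /eqP.
Qed.

Lemma intertwined_rank_isotyp s :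
  intertwined sl2 r1 r2 -> \rank (isotyp psi r1 s) = \rank (isotyp psi r2 s).
Proof.
case=> B B0 rB; have [Bfree Bfull] := intertwined_bij B0 rB.
have /(congr1 mxrank) := intertwined_isotyp s rB.
by rewrite mxrankMfree // (eqmxMfull _ Bfull).
Qed.

End IntertwinedRank.

(** * Counting representations of a given degree *)

Section SquareClasses.

Variable K : finFieldType.

(** [nu] may itself be a square, so that even [q] is covered as well. *)
Definition square_classes (nu : K) := nu != 0 /\ forall s : K, s != 0 ->
  exists2 a, a != 0 & s = a ^+ 2 \/ s = a ^+ 2 * nu.

Lemma square_classes_exist : exists nu : K, square_classes nu.
Proof.
have [z z0 zP] := finField_generator K; exists z; split=> // s s0.
have [k ->] := zP s s0; exists (z ^+ k./2); first by rewrite expf_neq0.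
rewrite -{1 3}[k]odd_double_half -exprM muln2.
by case: (odd k); [right; rewrite exprD expr1 mulrC | left; rewrite add0n].
Qed.

Variables (f : K -> nat) (nu : K).
Hypothesis nuP : square_classes nu.
Hypothesis fM : forall a s, a != 0 -> f (a ^+ 2 * s) = f s.

(** Each pair [s], [nu * s] contributes [f 1 + f nu], and summing over all [s] counts every term
    twice. *)
Lemma square_classes_sum :
  (2 * \sum_(s | s != 0%R) f s = #|K|.-1 * (f 1%R + f nu))%N.
Proof.
have [nu0 sP] := nuP.
have E s : s != 0 -> (f s + f (nu * s)%R = f 1%R + f nu)%N.
  case/sP => a a0 [->|->].
    by rewrite [nu * _]mulrC -{1}[_ ^+ 2]mulr1 !fM.
  by rewrite mulrCA !fM // -expr2 -[nu ^+ 2]mulr1 fM // addnC.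
rewrite mul2n -addnn {2}(reindex (fun s => nu * s)) /=; last first.
  by exists (fun s => nu^-1 * s) => s _; rewrite ?mulKf ?mulVKf.
rewrite [X in (_ + X)%N](eq_bigl (fun s => s != 0)) => [|s]; last first.
  by rewrite mulf_eq0 (negPf nu0).
rewrite -big_split /= (eq_bigr (fun=> (f 1%R + f nu)%N)) => [|s /E//].
rewrite sum_nat_const; congr (_ * _)%N.
by rewrite -(cardC1 (0 : K)); apply: eq_card => s.
Qed.

End SquareClasses.

Section Dimensions.

Variables (K : finFieldType) (F : closedFieldType) (psi : K -> F).
Hypothesis qF : #|K|%:R != 0 :> F.
Hypothesis psiP : additive_character psi.
Hypothesis q3 : (3 < #|K|)%N.
Variable nu : K.
Hypothesis nuP : square_classes nu.

Let nu0 : nu != 0. Proof. by case: nuP. Qed.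

Lemma hwv_pair_bound n (r1 r2 : 'M[K]_2 -> 'M[F]_n) la v1 v2 :
  sl2_rep r1 -> sl2_rep r2 -> airr sl2 r1 -> airr sl2 r2 ->
  ~ intertwined sl2 r1 r2 -> ~ intertwined sl2 r2 r1 ->
  v1 != 0 -> v2 != 0 -> hwv r1 la v1 -> hwv r2 la v2 ->
  (2 * n <= #|K|.+1)%N /\ (la =1 (fun=> 1) -> (1 < n)%N -> (2 * n <= #|K|)%N).
Proof.
move=> r1P r2P r1i r2i n12 n21 v10 v20 v1P v2P.
pose r (i : 'I_2) := if i == 0 then r1 else r2.
pose v (i : 'I_2) := if i == 0 then v1 else v2.
have rP i : sl2_rep (r i) by rewrite /r; case: ifP.
have ri i : airr sl2 (r i) by rewrite /r; case: ifP.
have rN i j : i != j -> ~ intertwined sl2 (r i) (r j).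
  by case: (ord2P i) => ->; case: (ord2P j) => ->.
have v0 i : v i != 0 by rewrite /v; case: ifP.
have vP i : hwv (r i) la (v i) by rewrite /v /r; case: ifP.
split; first exact: (hwv_family_bound rP ri rN v0 vP).
exact: (hwv1_family_bound rP ri rN v0 vP).
Qed.

Section OneRep.

Variables (n : nat) (r : 'M[K]_2 -> 'M[F]_n).
Hypotheses (rP : sl2_rep r) (ri : airr sl2 r) (n1 : (1 < n)%N).

Local Notation m s := (\rank (isotyp psi r s)).

Lemma twist_nonintertwined : m 1 != m nu ->
  ~ intertwined sl2 r (twist nu r) /\ ~ intertwined sl2 (twist nu r) r.
Proof.
move=> m1nu; have tP := twist_rep nu0 rP; have ti := twist_airr nu0 ri.
have tw : \rank (isotyp psi (twist nu r) nu) = m 1.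
  by rewrite -{2}[nu]mulr1 isotyp_twist.
split=> /intertwined_rank_isotyp E; move: m1nu; rewrite -tw.
  by rewrite -E // eqxx.
by rewrite E // eqxx.
Qed.

Lemma rank_isotyp_scale a s : a != 0 -> m (a ^+ 2 * s) = m s.
Proof. exact: rank_isotyp_tm. Qed.

(** The ranks at nonzero weights are at most 1 and constant on square classes: both classes occur,
    or exactly one, or none, and the last case forces [n <= 1]. *)
Lemma full_or_half :
  ((forall s, s != 0%R -> m s = 1%N) /\ n = (m 0%R + #|K|.-1)%N) \/
  (m 1 != m nu /\ (2 * n = 2 * m 0%R + #|K|.-1)%N).
Proof.
have le1 s : s != 0 -> (m s <= 1)%N by apply: rank_isotyp_le1.
have nE := sum_rank_isotyp qF psiP rP; rewrite (bigD1 0) //= in nE.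
have S := square_classes_sum nuP rank_isotyp_scale.
have ms s : s != 0 -> m s = m 1 \/ m s = m nu.
  case/(nuP.2) => a a0 [->|->]; last by right; rewrite rank_isotyp_scale.
  by left; rewrite -{1}[_ ^+ 2]mulr1 rank_isotyp_scale.
have [m1nu|] := eqVneq (m 1) (m nu); last first.
  move=> m1nu; right; split=> //.
  have : (m 1%R + m nu = 1)%N.
    by move: m1nu (le1 1 (oner_neq0 _)) (le1 nu nu0); lia.
  move=> e; by rewrite e muln1 in S; rewrite -{1}nE mulnDr S.
have [m11|m10] := eqVneq (m 1) 1%N.
  left; split=> [s s0|]; first by case: (ms s s0) => ->; rewrite -?m1nu.
  rewrite -m1nu m11 mulnC in S; rewrite -{1}nE; congr (_ + _)%N.
  by apply/eqP; rewrite -(eqn_pmul2r (isT : (0 < 2)%N)) S.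
have : (n <= 1)%N; last by lia.
apply: (isotyp0_eq1_bound qF psiP rP ri) => s s0; apply/eqP; rewrite -mxrank_eq0.
by case: (ms s s0) => ->; rewrite -?m1nu; move: m10 (le1 1 (oner_neq0 _)); lia.
Qed.

(** [r] and its twist are inequivalent, as their nonzero weights differ, but they share the weight
    [la]. Hence [2 * n <= #|K|.+1], and even [2 * n <= #|K|] for trivial [la], against
    [2 * n = 2 * m 0 + #|K|.-1] with [m 0 > 0]. *)
Lemma half_weight la v : m 1 != m nu -> (2 * n = 2 * m 0%R + #|K|.-1)%N ->
  v != 0 -> hwv r la v ->
  [/\ (2 * n = #|K|.+1)%N, forall a, a != 0 -> la a ^+ 2 = 1
    & ~ (forall a, a != 0 -> la a = 1)].
Proof.
move=> m1nu nE v0 vP; have [nt1 nt2] := twist_nonintertwined m1nu.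
have /andP[m0 _] := hwv_rank_isotyp0 qF psiP rP ri v0 vP.
have tv := twist_hwv nu vP.
have [B1 B2] := hwv_pair_bound rP (twist_rep nu0 rP) ri (twist_airr nu0 ri)
  nt1 nt2 v0 v0 vP tv.
have q0 : (0 < #|K|)%N by lia.
have m01 : m 0 = 1%N by lia.
split; [lia | exact: (hwv_rank1_weight qF psiP rP v0 vP m01) | move=> la1].
have vP1 : hwv r (fun=> 1) v.
  by case: vP => [vu vt]; split=> // a a0; rewrite vt // la1.
have tv1 := twist_hwv nu vP1.
have [_ /(_ (fun _ => erefl) n1)] := hwv_pair_bound rP (twist_rep nu0 rP) ri (twist_airr nu0 ri)
  nt1 nt2 v0 v0 vP1 tv1.
lia.
Qed.

(* The last two alternatives are the cuspidal representations. *)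
Lemma sl2_rep_dimension :
  [\/ n = #|K|.+1 /\ exists la v, [/\ v != 0, hwv r la v, ~ (forall a, a != 0 -> la a ^+ 2 = 1)
        & exists2 v', v' != 0 & hwv r (fun a => la a^-1) v'],
      n = #|K| /\ exists la v, [/\ v != 0, hwv r la v & forall a, a != 0 -> la a ^+ 2 = 1],
      (2 * n = #|K|.+1)%N /\ exists la v, [/\ v != 0, hwv r la v,
        forall a, a != 0 -> la a ^+ 2 = 1 & ~ (forall a, a != 0 -> la a = 1)] |
      isotyp psi r 0 = 0 /\ (n = #|K|.-1 /\ (forall s, s != 0 -> m s = 1%N) \/
        (2 * n = #|K|.-1)%N /\ m 1 != m nu)].
Proof.
have [E0|E0] := eqVneq (isotyp psi r 0) 0.
  apply: Or44; split=> //; have m0 : m 0 = 0%N by rewrite E0 mxrank0.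
  have [[fl nE]|[hf nE]] := full_or_half; [left|right]; split=> //; lia.
have [v v0 [la vP]] := hwv_exists qF psiP rP E0.
have /andP[m0 m02] := hwv_rank_isotyp0 qF psiP rP ri v0 vP.
have [[fl nE]|[hf nE]] := full_or_half; last first.
  have [n2 la2 la1] := half_weight hf nE v0 vP.
  by apply: Or43; split=> //; exists la, v.
have [m01|m0n1] := eqVneq (m 0) 1%N.
  apply: Or42; split; first by lia.
  by exists la, v; split=> //; apply: (hwv_rank1_weight qF psiP rP v0 vP m01).
have m0_2 : m 0 = 2%N by lia.
apply: Or41; split; first by lia.
exists la, v; split=> // [la2|].
  by move: m0n1; rewrite (hwv_quadratic_rank qF psiP rP ri v0 vP la2).
exists (v *m r wm *m isotyp psi r 0); last exact: hwv_dual.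
exact: (hwv_dual_neq0 qF psiP rP ri v0 vP m0_2).
Qed.

End OneRep.

Section Families.

Variables (n k : nat) (r : 'I_k -> 'M[K]_2 -> 'M[F]_n).
Hypothesis rP : forall i, sl2_rep (r i).
Hypothesis ri : forall i, airr sl2 (r i).
Hypothesis rN : forall i j, i != j -> ~ intertwined sl2 (r i) (r j).
Hypothesis n1 : (1 < n)%N.

Let weight_eq_bound i j la la' v v' : i != j -> v != 0 -> v' != 0 ->
  hwv (r i) la v -> hwv (r j) la' v' ->
  (forall a, a != 0 -> la a = la' a) -> (2 * n <= #|K|.+1)%N.
Proof.
move=> ij v0 v'0 vP v'P e.
have v'P1 : hwv (r j) la v'.
  by case: v'P => [vu vt]; split=> // a a0; rewrite vt // e.
have ji : j != i by rewrite eq_sym.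
by have [] := hwv_pair_bound (rP i) (rP j) (@ri i) (@ri j) (rN ij) (rN ji) v0 v'0 vP v'P1.
Qed.

Let weight_gen i la v z j : v != 0 -> z != 0 -> hwv (r i) la v -> la (z ^+ j) = la z ^+ j.
Proof.
move=> v0 z0 vP; have [laM la1] := hwv_weightM (rP i) v0 vP.
elim: j => [|j IH]; first by rewrite !expr0.
by rewrite !exprS laM ?expf_neq0 // IH.
Qed.

Let weight_neq i j la la' v v' z : (#|K|.+1 < 2 * n)%N -> z != 0 ->
  (forall a, a != 0 -> exists l, a = z ^+ l) -> v != 0 -> v' != 0 ->
  hwv (r i) la v -> hwv (r j) la' v' -> la z = la' z -> i = j.
Proof.
move=> n2 z0 zP v0 v'0 vP v'P e; apply/eqP; apply: contraTT n2 => ij; rewrite -leqNgt.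
apply: (weight_eq_bound ij v0 v'0 vP v'P) => a /zP[l ->].
by rewrite (weight_gen _ v0 z0 vP) (weight_gen _ v'0 z0 v'P) e.
Qed.

(** The values of the weights at a generator [z], their inverses and 1 are [2 * k + 1] distinct
    roots of unity of order dividing [#|K|.-1]: a weight shared by two representations, dual weights
    included, would give [2 * n <= #|K|.+1]. *)
Lemma principal_series_count : n = #|K|.+1 -> (2 * k <= #|K| - 2)%N.
Proof.
move=> nE; have n2 : (#|K|.+1 < 2 * n)%N by lia.
have /fin_all_exists[la /fin_all_exists[v H]] : forall i : 'I_k,
   exists (la : K -> F) (v : 'rV_n),
   [/\ v != 0, hwv (r i) la v, ~ (forall a, a != 0 -> la a ^+ 2 = 1)
        & exists2 v', v' != 0 & hwv (r i) (fun a => la a^-1) v'].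
  move=> i; case: (sl2_rep_dimension (rP i) (@ri i) n1) => [[_ //]|[]|[]|[_ [[]|[]]]]; lia.
have v0 i : v i != 0 by have [] := H i.
have vP i : hwv (r i) (la i) (v i) by have [] := H i.
have la2 i : ~ (forall a, a != 0 -> la i a ^+ 2 = 1) by have [] := H i.
have /fin_all_exists2[v' v'0 v'P] : forall i : 'I_k,
  exists2 v', v' != 0 & hwv (r i) (fun a => la i a^-1) v' by move=> i; have [] := H i.
have [z z0 zP] := finField_generator K.
have zi0 : z^-1 != 0 by rewrite invr_eq0.
pose x i := la i z; pose y i := la i z^-1.
have xy i : x i * y i = 1.
  by have [laM la1] := hwv_weightM (rP i) (v0 i) (vP i); rewrite -laM // divff.
have xV i : y i = (x i)^-1.
  have x0 : x i != 0 by apply/eqP => e; have := xy i; rewrite e mul0r => /eqP; rewrite eq_sym oner_eq0.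
  by apply: (mulfI x0); rewrite xy divff.
have x21 i : x i ^+ 2 != 1.
  apply/eqP => e; apply: (la2 i) => a /zP[l ->].
  by rewrite (weight_gen _ (v0 i) z0 (vP i)) exprAC e expr1n.
have xinj : injective x.
  by move=> i j e; apply: (weight_neq n2 z0 zP (v0 i) (v0 j) (vP i) (vP j)).
have xyn i j : x i != y j.
  have [->|ij] := eqVneq i j.
    by apply: contraNneq (x21 j) => e; rewrite expr2 {2}e xy.
  apply: contraNneq ij => e; apply/eqP.
  exact: (weight_neq n2 z0 zP (v0 i) (v'0 j) (vP i) (v'P j)).
have root1 i : x i ^+ #|K|.-1 = 1.
  rewrite -(weight_gen _ (v0 i) z0 (vP i)) (_ : z ^+ _ = 1).
    by have [] := hwv_weightM (rP i) (v0 i) (vP i).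
  by apply: (mulfI z0); rewrite -exprS prednK ?expf_card ?mulr1 //; lia.
have x1 i : x i != 1 by apply: contraNneq (x21 i) => ->; rewrite expr1n.
pose s := 1 :: ([seq x i | i <- enum 'I_k] ++ [seq y i | i <- enum 'I_k]).
have us : uniq s.
  rewrite /s cons_uniq cat_uniq mem_cat negb_or; apply/andP; split; [apply/andP|apply/and3P]; split.
  - by apply/mapP => -[i _ /esym e]; move: (x1 i); rewrite e eqxx.
  - apply/mapP => -[i _ /esym e]; move: (x1 i).
    by have := xy i; rewrite e mulr1 => ->; rewrite eqxx.
  - by rewrite map_inj_uniq ?enum_uniq.
  - apply/hasPn => _ /mapP[j _ ->]; apply/mapP => -[i _ /esym e].
    by move: (xyn i j); rewrite e eqxx.
  - by rewrite map_inj_uniq ?enum_uniq // => i j; rewrite !xV => /invr_inj/xinj.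
have rs : all #|K|.-1.-unity_root s.
  rewrite /= unity_rootE expr1n eqxx /= all_cat; apply/andP; split; apply/allP => _ /mapP[i _ ->].
    by rewrite unity_rootE root1.
  by rewrite unity_rootE xV exprVn root1 invr1.
have q1 : (0 < #|K|.-1)%N by lia.
have := max_unity_roots q1 rs us.
rewrite /s /= size_cat !size_map -enumT size_enum_ord; lia.
Qed.

(** The weights are pairwise distinct and quadratic, so they are told apart by whether their value
    at [z] is 1. *)
Lemma steinberg_count : n = #|K| -> (k <= 2)%N.
Proof.
move=> nE; have n2 : (#|K|.+1 < 2 * n)%N by lia.
have /fin_all_exists[la /fin_all_exists[v H]] : forall i : 'I_k,
   exists (la : K -> F) (v : 'rV_n),
   [/\ v != 0, hwv (r i) la v & forall a, a != 0 -> la a ^+ 2 = 1].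
  move=> i; case: (sl2_rep_dimension (rP i) (@ri i) n1) => [[]|[_ //]|[]|[_ [[]|[]]]]; lia.
have v0 i : v i != 0 by have [] := H i.
have vP i : hwv (r i) (la i) (v i) by have [] := H i.
have la2 i : (forall a, a != 0 -> la i a ^+ 2 = 1) by have [] := H i.
have [z z0 zP] := finField_generator K.
have : injective (fun i => la i z == 1).
  move=> i j e; apply: (weight_neq n2 z0 zP (v0 i) (v0 j) (vP i) (vP j)).
  have pm l : la l z = if la l z == 1 then 1 else -1.
    by have /eqP := la2 l z z0; rewrite -subr_eq0 subr_sqr_1
      mulf_eq0 subr_eq0 addr_eq0; case: eqP => //= _ /eqP.
  by rewrite pm e -pm.
by move/leq_card; rewrite card_ord card_bool.
Qed.

(** Every weight takes the value -1 at [z], so all weights agree and the family bound gives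
    [k * n <= 2 * n]. *)
Lemma half_principal_count : (2 * n = #|K|.+1)%N -> (k <= 2)%N.
Proof.
move=> nE.
have /fin_all_exists[la /fin_all_exists[v H]] : forall i : 'I_k,
   exists (la : K -> F) (v : 'rV_n), [/\ v != 0, hwv (r i) la v,
        forall a, a != 0 -> la a ^+ 2 = 1 & ~ (forall a, a != 0 -> la a = 1)].
  move=> i; case: (sl2_rep_dimension (rP i) (@ri i) n1) => [[]|[]|[_ //]|[_ [[]|[]]]]; lia.
have v0 i : v i != 0 by have [] := H i.
have vP i : hwv (r i) (la i) (v i) by have [] := H i.
have [z z0 zP] := finField_generator K.
have laz i : la i z = -1.
  have [_ _ la2 la1] := H i.
  have /eqP := la2 z z0; rewrite -subr_eq0 subr_sqr_1.
  rewrite mulf_eq0 subr_eq0 addr_eq0 => /orP[/eqP e|/eqP//]; case: la1 => a /zP[l ->].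
  by rewrite (weight_gen _ (v0 i) z0 (vP i)) e expr1n.
have laE i j a : a != 0 -> la i a = la j a.
  by case/zP => l ->; rewrite !(weight_gen _ (v0 _) z0 (vP _)) !laz.
case: k r rP ri rN v la v0 vP laE {H laz} => [//|k'] r' r'P r'i r'N v la v0 vP laE.
have vP0 i : hwv (r' i) (la 0) (v i).
  by have [vu vt] := vP i; split=> // a a0; rewrite vt // (laE i 0).
have := hwv_family_bound r'P r'i r'N v0 vP0; rewrite -nE leq_pmul2r //; lia.
Qed.

End Families.

End Dimensions.

(** * Conjugacy classes of SL_2(K) *)

Section ConjugacySL2.

Variable K : finFieldType.
Implicit Types g h k : 'M[K]_2.

Definition sl2_conj g h := exists2 k, k \in sl2 & k *m g = h *m k.

Lemma sl2_conj_trace g h : sl2_conj g h -> \tr g = \tr h.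
Proof.
case=> k ks kg; have ku : k \in unitmx.
  by move: ks; rewrite unitmxE inE => /eqP->; apply: unitr1.
by rewrite -[h](mulmxK ku) -kg mxtrace_mulC mulmxA mulVmx // mul1mx.
Qed.

Definition companion2 (t : K) := mx2 0 (-1) 1 t.

Lemma companion2E t : companion2 t = wm *m um t.
Proof. by rewrite mx2M; congr mx2; ring. Qed.

Lemma companion2_sl t : companion2 t \in sl2.
Proof. by rewrite companion2E sl2M ?wm_sl ?um_sl. Qed.

Lemma tr_companion2 t : \tr (companion2 t) = t.
Proof. by rewrite tr_mx2 add0r. Qed.

(* An element with an eigenvalue in K is conjugate into the Borel subgroup. *)
Lemma sl2_split g l : g \in sl2 -> l ^+ 2 - \tr g * l + 1 = 0 ->
  exists2 a, a != 0 & exists b, sl2_conj g (tm a *m um b).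
Proof.
move=> gs lP; have l0 : l != 0.
  by apply/eqP => e; move: lP; rewrite e expr0n mulr0 subrr add0r => /eqP; rewrite oner_eq0.
have [r0|r0] := eqVneq (g 1 0) 0.
  have [a0 gE] := sl2_borel gs r0; exists (g 0 0) => //; exists (g 0 1 / g 0 0).
  by exists 1%:M; rewrite ?sl2_1 // mul1mx mulmx1.
exists l^-1; first by rewrite invr_eq0.
move: gs lP r0; rewrite [g]mx2E tr_mx2 sl2E mx2_10.
move: (g 0 0) (g 0 1) (g 1 0) (g 1 1) => p u r s /eqP ps lP r0.
exists (- l / r), (mx2 0 (- r^-1) r (l - p)).
  by rewrite sl2E; apply/eqP; field.
have sE : s = l + l^-1 - p.
  apply: (mulIf l0); rewrite mulrBl mulrDl mulVf //; apply/esym/eqP.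
  by rewrite -subr_eq0 -lP; apply/eqP; ring.
have uE : u = (p * s - 1) / r.
  by apply: (mulIf r0); rewrite mulfVK // -[X in _ - X]ps; ring.
by rewrite !mx2M invrK uE sE; congr mx2; field; rewrite ?l0 ?r0.
Qed.

Lemma sl2_conj_tm a b : a != 0 -> a ^+ 2 != 1 -> sl2_conj (tm a *m um b) (tm a).
Proof.
move=> a0 a2; exists (um (a ^+ 2 * b / (a ^+ 2 - 1))); first exact: um_sl.
have d0 : a ^+ 2 - 1 != 0 by rewrite subr_eq0.
by rewrite !mx2M; congr mx2; field; rewrite ?a0 ?d0.
Qed.

Lemma char2_all_squares (x : K) : 2 = 0 :> K -> exists a, x = a ^+ 2.
Proof.
move=> K2; have sqI : injective (fun a : K => a ^+ 2).
  move=> a b /= ab; apply/eqP; rewrite -subr_eq0 -sqrf_eq0; apply/eqP.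
  transitivity (a ^+ 2 - b ^+ 2 + 2 * (b ^+ 2 - a * b)); first by ring.
  by rewrite ab K2 mul0r subrr addr0.
have [g _ gK] := injF_bij sqI.
by exists (g x); rewrite gK.
Qed.

(* Otherwise translation by d permutes the squares, and summing them shows that
   their number, (q + 1) / 2, vanishes in K. *)
Lemma nonsquare_shift (r d : K) : (forall a, r != a ^+ 2) -> d != 0 ->
  exists y, forall a, y ^+ 2 - d != a ^+ 2.
Proof.
move=> rN d0; pose S := [set a ^+ 2 | a : K].
have Sq a : a ^+ 2 \in S by apply/imsetP; exists a.
have rS : r \notin S by apply/imsetP => -[a _ /eqP e]; move: (rN a); rewrite e.
have [nu nuP] := square_classes_exist K.
have nuS : nu \notin S.
  apply: contra rS => /imsetP[b _ nE].
  have r0 : r != 0 by move: (rN 0); rewrite expr0n.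
  have [a a0 [->|->]] := nuP.2 r r0; first exact: Sq.
  by rewrite nE -exprMn Sq.
have S1 : 1 \in S by rewrite -(expr1n _ 2) Sq.
have SM a s : a != 0 -> (a ^+ 2 * s \in S) = (s \in S).
  move=> a0; apply/imsetP/imsetP => -[b _ bE]; last by exists (a * b); rewrite ?exprMn ?bE.
  by exists (a^-1 * b); rewrite // exprMn -bE exprVn mulKf // expf_neq0.
have cS : (2 * #|S| = #|K|.+1)%N.
  have fM a s : a != 0 -> nat_of_bool (a ^+ 2 * s \in S) = (s \in S) by move=> a0; rewrite SM.
  have := square_classes_sum (f := fun s => (s \in S) : nat) nuP fM.
  rewrite S1 (negPf nuS) addn0 muln1 => H.
  have S0 : 0 \in S by rewrite -[0](expr0n _ 2) Sq.
  have q0 : (0 < #|K|)%N by apply/card_gt0P; exists 0.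
  rewrite (cardD1 0) S0 mulnDr muln1 (_ : #|_| = \sum_(s | s != 0%R) (s \in S : nat))%N.
    by rewrite H; lia.
  by rewrite -sum1_card big_mkcond [RHS]big_mkcond; apply: eq_bigr => s _;
     rewrite inE /= ; case: (s != 0); case: (s \in S).
have [/existsP[y /forallP yP]|] := boolP [exists y, [forall a, y ^+ 2 - d != a ^+ 2]].
  by exists y.
rewrite negb_exists => /forallP H; exfalso.
have shift s : s \in S -> s - d \in S.
  case/imsetP => y _ ->; have := H y; rewrite negb_forall => /existsP[a].
  by rewrite negbK => /eqP->; apply: Sq.
have dI : injective (fun s => s - d) by move=> x y; apply: addIr.
have sS : [set s - d | s in S] = S.
  apply/eqP; rewrite eqEcard (card_imset (mem S) dI).
  by rewrite leqnn andbT; apply/subsetP => _ /imsetP[s sS ->]; apply: shift.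
have : \sum_(s in S) s = \sum_(s in S) s - d *+ #|S|.
  rewrite -{1}sS big_imset /=; last by move=> x y _ _; apply: dI.
  by rewrite big_split /= sumr_const mulNrn.
move/eqP; rewrite -subr_eq0 opprB addrC subrK => /eqP dS.
have : d *+ (2 * #|S|) = 0 by rewrite mulnC mulrnA dS mul0rn.
rewrite cS mulrS -mulr_natl; have -> : #|K|%:R = 0 :> K.
  have : \sum_(x : K) x = \sum_(x : K) (x + 1).
    by rewrite [LHS](reindex (fun x => x + 1)) //; exists (fun x => x - 1) => x _;
       rewrite ?addrK ?subrK.
  rewrite big_split /= sumr_const -[LHS]addr0 => /addrI; exact: esym.
by rewrite mul0r addr0 => /eqP; rewrite (negPf d0).
Qed.

(** A conjugator has the rows [(x, y)] and minus its image under [g]. Its determinant is a binary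
    quadratic form in [x] and [y]; conjugacy in SL_2, and not only in GL_2, means that this form
    represents 1. *)
Lemma sl2_conj_companion g : g \in sl2 ->
  (forall l, l ^+ 2 - \tr g * l + 1 != 0) -> sl2_conj g (companion2 (\tr g)).
Proof.
move=> gs; rewrite [g]mx2E tr_mx2; move: gs; rewrite {1}[g]mx2E sl2E.
move: (g 0 0) (g 0 1) (g 1 0) (g 1 1) => p u r s /eqP ps lP.
have r0 : r != 0.
  apply/eqP => r0; move: (lP p); rewrite -ps r0 => /eqP[]; ring.
have uE : u = (p * s - 1) / r.
  by apply: (mulIf r0); rewrite mulfVK // -[X in _ - X]ps; ring.
suff [x [y Q]] : exists x y, r * y ^+ 2 + (p - s) * x * y - u * x ^+ 2 = 1.
  exists (mx2 x y (- (x * p + y * r)) (- (x * u + y * s))).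
    by rewrite sl2E -Q; apply/eqP; ring.
  by rewrite uE !mx2M; congr mx2; field.
have [/existsP[a /eqP rE]|] := boolP [exists a, r == a ^+ 2].
  exists 0, a^-1; have a0 : a != 0 by apply: contraNneq r0 => a0; rewrite rE a0 expr0n.
  by rewrite rE; field.
rewrite negb_exists => /forallP rN.
have K2 : 2 != 0 :> K.
  by apply/eqP => K2; have [a /eqP rE] := char2_all_squares r K2; move: (rN a); rewrite rE.
(* Completing the square, [r] times the form is [(r * y + (p - s) / 2 * x) ^+ 2 - d * x ^+ 2]. *)
pose d := ((p - s) / 2) ^+ 2 + u * r.
have d0 : d != 0.
  apply: contraNneq (lP ((p + s) / 2)) => d0; apply/eqP.
  have -> : ((p + s) / 2) ^+ 2 - (p + s) * ((p + s) / 2) + 1 = - d; last by rewrite d0 oppr0.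
  by rewrite /d uE; field; rewrite ?r0 ?K2.
(* [Y ^+ 2 - d] is a nonsquare like [r], so they differ by a square factor, which the choice of [x]
   absorbs. *)
have [Y YN] := nonsquare_shift rN d0.
have t0 : Y ^+ 2 - d != 0 by move: (YN 0); rewrite expr0n.
have [nu nuP] := square_classes_exist K.
have [a a0 [/eqP|rE]] := nuP.2 r r0; first by rewrite (negPf (rN a)).
have [b b0 [/eqP|tE]] := nuP.2 _ t0; first by rewrite (negPf (YN b)).
exists (a / b), ((Y - (p - s) / 2) / r * (a / b)).
apply: (mulfI r0); transitivity ((Y ^+ 2 - d) * (a / b) ^+ 2).
  by rewrite /d; field; rewrite ?b0 ?r0 ?K2.
by rewrite tE rE; field.
Qed.

End ConjugacySL2.

Lemma dconj_conj (K : finFieldType) (nu : K) g a b : nu != 0 ->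
  sl2_conj g (tm a *m um b) -> sl2_conj (dconj nu g) (tm a *m um (nu * b)).
Proof.
move=> nu0 [k ks kg]; exists (dconj nu k); first exact: dconj_sl.
by rewrite -dconjM // kg !dconjM // dconj_tm dconj_um.
Qed.

Lemma tr_dconj (K : finFieldType) (nu : K) g : \tr (dconj nu g) = \tr g.
Proof. by rewrite [g in RHS]mx2E !tr_mx2. Qed.

(** * Traces of cuspidal representations *)

Section CuspidalTraces.

Variables (K : finFieldType) (F : closedFieldType) (psi : K -> F).
Hypothesis qF : #|K|%:R != 0 :> F.
Hypothesis psiP : additive_character psi.

Variables (n : nat) (r : 'M[K]_2 -> 'M[F]_n).
Hypotheses (rP : sl2_rep r) (ri : airr sl2 r).

Lemma rep_trace_sl2_conj g h : g \in sl2 -> h \in sl2 -> sl2_conj g h -> \tr (r g) = \tr (r h).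
Proof. by move=> gs hs [k ks kg]; apply: (rep_trace_conj rP ks gs hs kg). Qed.

Lemma rep_central_scalar : (0 < n)%N -> exists w, r (tm (-1)) = w%:M.
Proof.
move=> n0; have N1 : -1 != 0 :> K by rewrite oppr_eq0 oner_eq0.
have m1 : tm (-1) = - 1%:M :> 'M[K]_2.
  by rewrite /tm invrN1 [RHS]mx2E !mxE /= oppr0.
have one0 : 1%:M != 0 :> 'M[F]_n by case: n n0 => // m _; exact: matrix_nonzero1.
have [v [v0 _] [w vw]] := closed_eigenvector (X := r (tm (-1))) one0 (submx1 _).
exists w; apply/eqP; rewrite -subr_eq0 -submx0; apply: (airr_cyclic ri v0) => g gs.
suff -> : v *m r g *m (r (tm (-1)) - w%:M) = 0 by apply: sub0mx.
rewrite mulmxBr -mulmxA -(repM rP) ?tm_sl // m1 mulmxN mulmx1 -[- g]mul1mx mulmxN -mulNmx -m1.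
by rewrite (repM rP) ?tm_sl // mulmxA vw mul_mx_scalar -scalemxAl subrr.
Qed.

Lemma trace_rep_central w b : r (tm (-1)) = w%:M ->
  \tr (r (tm (-1) *m um b)) = w * \tr (r (um b)).
Proof.
move=> rw; rewrite (repM rP) ?um_sl ?tm_sl ?oppr_eq0 ?oner_eq0 // rw.
by rewrite mul_scalar_mx mxtraceZ.
Qed.

Hypothesis cusp : isotyp psi r 0 = 0.

Lemma cuspidal_trace_um b :
  \tr (r (um b)) = \sum_(s | s != 0) psi (s * b) * (\rank (isotyp psi r s))%:R.
Proof.
rewrite -[r (um b)]mulmx1 -(sum_isotyp qF psiP rP) mulmx_sumr linear_sum.
rewrite (bigD1 0) //= cusp mulmx0 linear0 add0r; apply: eq_bigr => s s0.
rewrite rep_um_isotyp // mxtraceZ rank1_idem_trace ?isotyp_idem //.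
exact: rank_isotyp_le1.
Qed.

Lemma cuspidal_trace_tm a : a != 0 -> a ^+ 2 != 1 -> \tr (r (tm a)) = 0.
Proof. by move=> a0 a2; rewrite (trace_rep_tm qF psiP rP) // cusp mulmx0 linear0. Qed.

Lemma cuspidal_trace_split g a b : g \in sl2 -> a != 0 -> a ^+ 2 != 1 ->
  sl2_conj g (tm a *m um b) -> \tr (r g) = 0.
Proof.
move=> gs a0 a2 gC; rewrite (rep_trace_sl2_conj gs _ gC) ?sl2M ?tm_sl ?um_sl //.
rewrite (rep_trace_sl2_conj _ _ (sl2_conj_tm b a0 a2)) ?sl2M ?tm_sl ?um_sl //.
exact: cuspidal_trace_tm.
Qed.

(** As [companion2 t = wm *m um t], the sum is a multiple of the trace of
    [r wm *m isotyp psi r 0]. *)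
Lemma cuspidal_sum_companion : \sum_t \tr (r (companion2 t)) = 0.
Proof.
transitivity (\tr (r wm *m \sum_b r (um b))).
  rewrite mulmx_sumr linear_sum; apply: eq_bigr => t _.
  by rewrite companion2E (repM rP) ?wm_sl ?um_sl.
have := cusp; rewrite isotypE => /eqP; rewrite scaler_eq0 invr_eq0 (negPf qF) /= => /eqP E.
rewrite -[X in r wm *m X](_ : \sum_b psi (- (0 * b)) *: r (um b) = _).
  by rewrite E mulmx0 linear0.
by apply: eq_bigr => b _; rewrite mul0r oppr0 (psi0 qF psiP) scale1r.
Qed.

End CuspidalTraces.

Section CuspidalFamilies.

Variables (K : finFieldType) (F : closedFieldType) (psi : K -> F).
Hypothesis qF : #|K|%:R != 0 :> F.
Hypothesis psiP : additive_character psi.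

Definition full_cuspidal n (r : 'M[K]_2 -> 'M[F]_n) :=
  isotyp psi r 0 = 0 /\ forall s, s != 0 -> \rank (isotyp psi r s) = 1%N.

Lemma full_cuspidal_trace_um n (r : 'M[K]_2 -> 'M[F]_n) b :
  sl2_rep r -> airr sl2 r -> full_cuspidal r ->
  \tr (r (um b)) = #|K|%:R *+ (b == 0) - 1.
Proof.
move=> rP ri [c fl]; rewrite (cuspidal_trace_um qF psiP rP ri c).
rewrite -(psiP.2 b) [X in _ = X - 1](bigD1 0) //= mulr0 (psi0 qF psiP) addrAC subrr add0r.
by apply: eq_bigr => s s0; rewrite fl // mulr1 mulrC.
Qed.

Lemma sl2_conj_sym (g h : 'M[K]_2) : sl2_conj g h -> sl2_conj h g.
Proof.
case=> k ks kg; have ku : k \in unitmx.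
  by move: ks; rewrite unitmxE inE => /eqP->; apply: unitr1.
exists (invmx k); first by move: ks; rewrite !inE det_inv => /eqP->; rewrite invr1.
by apply: (can_inj (mulKmx ku)); rewrite mulmxA mulmxV // mul1mx mulmxA kg mulmxK.
Qed.

(* The trace of companion2 t determines a + a^-1 = t, hence a = +-1 for t = +-2. *)
Lemma companion2_unipotent (e : K) : e ^+ 2 = 1 ->
  exists2 b, b != 0 & sl2_conj (companion2 (e *+ 2)) (tm e *m um b).
Proof.
move=> e2; have e0 : e != 0 by rewrite -sqrf_eq0 e2 oner_eq0.
have eV : e^-1 = e by apply: (mulfI e0); rewrite divff // -expr2.
have [||a a0 [b C]] := @sl2_split _ (companion2 (e *+ 2)) e.
- exact: companion2_sl.
- rewrite tr_companion2 e2 mulr2n mulrDl -expr2 e2; ring.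
have aE : a = e.
  have := sl2_conj_trace C; rewrite tr_companion2 mx2M tr_mx2 mulr0 addr0 mul0r add0r !mulr1.
  move=> t; apply/eqP; rewrite -subr_eq0 -sqrf_eq0; apply/eqP.
  transitivity (a * (a + a^-1) - a * e *+ 2 + (e ^+ 2 - 1)); first by field.
  by rewrite -t e2 subrr addr0 -mulrnAr subrr.
rewrite aE in C; exists b => //.
apply/eqP => b0; move: C; rewrite b0 um0 mulmx1 => -[k ks].
have -> : tm e = e%:M by rewrite /tm eV [RHS]mx2E !mxE.
rewrite mul_scalar_mx -[e *: k]/(e *: k) => /(congr1 (mulmx (invmx k))).
have ku : k \in unitmx.
  by move: ks; rewrite unitmxE inE => /eqP->; apply: unitr1.
rewrite mulKmx // -scalemxAr mulVmx // => /matrixP/(_ 1 0).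
by rewrite !mxE /= mulr0 => /eqP; rewrite oner_eq0.
Qed.

(* On full cuspidal representations of the same degree, the trace at g is a multiple
   of the trace at a companion matrix, by a factor independent of the representation. *)
Lemma full_cuspidal_trace_companion g n : g \in sl2 -> n = #|K|.-1 ->
  exists x : F, exists t : K, forall r : 'M[K]_2 -> 'M[F]_n,
    sl2_rep r -> airr sl2 r -> full_cuspidal r -> \tr (r g) = x * \tr (r (companion2 t)).
Proof.
move=> gs nE.
have [/existsP[l /eqP lP]|] := boolP [exists l, l ^+ 2 - \tr g * l + 1 == 0]; last first.
  rewrite negb_exists => /forallP lP; exists 1, (\tr g) => r rP ri _; rewrite mul1r.
  by apply: (rep_trace_sl2_conj rP gs (companion2_sl _)); apply: sl2_conj_companion.
have [a a0 [b C]] := sl2_split gs lP.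
have [a2|a2] := eqVneq (a ^+ 2) 1; last first.
  by exists 0, 0 => r rP ri [c _]; rewrite mul0r (cuspidal_trace_split qF psiP rP c gs a0 a2 C).
have [b1 b10 C1] := companion2_unipotent a2.
(* If [tm a] acts by the scalar [w], the trace is [w * n] at [tm a] and [- w] at its products with
   nontrivial unipotents. *)
exists (if b == 0 then - n%:R else 1), (a *+ 2) => r rP ri fl.
have ts x : tm a *m um x \in sl2 by rewrite sl2M ?tm_sl ?um_sl.
rewrite (rep_trace_sl2_conj rP gs (ts b) C).
rewrite (rep_trace_sl2_conj rP (companion2_sl _) (ts b1) C1).
have n0 : (0 < n)%N.
  by rewrite nE -subn1 subn_gt0 finNzRing_gt1.
have qn : #|K|%:R - 1 = n%:R :> F.
  by rewrite nE -subn1 natrB // ltnW // finNzRing_gt1.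
have [w wP] := rep_central_scalar rP ri n0.
have := a2; rewrite -[1](expr1n _ 2) => /eqP; rewrite eqf_sqr => /orP[]/eqP->.
  rewrite tm1 !mul1mx !full_cuspidal_trace_um // (negPf b10) sub0r.
  by case: eqP => _; rewrite ?mulr1n ?qn ?mulrNN ?mulr1 // mul1r sub0r.
rewrite !(trace_rep_central rP _ wP) !full_cuspidal_trace_um // (negPf b10) sub0r.
by case: eqP => _; rewrite ?mulr1n ?qn ?sub0r ?mul1r //; ring.
Qed.

End CuspidalFamilies.

Section SplitTraces.

Variable K : finFieldType.

Definition split_traces : {set K} :=
  [set a + a^-1 | a in [pred a : K | (a != 0) && (a ^+ 2 != 1)]].

Lemma addV_eq (a b : K) : a != 0 -> b != 0 -> a + a^-1 = b + b^-1 -> a = b \/ a = b^-1.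
Proof.
move=> a0 b0 /eqP; rewrite -subr_eq0.
have -> : a + a^-1 - (b + b^-1) = (a - b) * (a - b^-1) * a^-1 by field; rewrite a0.
rewrite !mulf_eq0 invr_eq0 (negPf a0) orbF !subr_eq0 => /orP[]/eqP; first by left.
by right.
Qed.

(** [a + a^-1] is at most two-to-one on the field without 0, 1 and -1. *)
Lemma card_split_traces : (#|K| <= 2 * #|split_traces| + 3)%N.
Proof.
set A : {pred K} := [pred a | (a != 0) && (a ^+ 2 != 1)].
have cA : (#|K| <= #|A| + 3)%N.
  rewrite -(cardC A) leq_add2l -[3%N]/(size [:: 0; 1; -1 : K]).
  apply: leq_trans (card_size _); apply: subset_leq_card; apply/subsetP => a.
  rewrite !inE negb_and !negbK => /orP[->//|]; rewrite -[1 in X in X -> _](expr1n _ 2) eqf_sqr.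
  by move=> /orP[]->; rewrite ?orbT.
suff : (#|A| <= 2 * #|split_traces|)%N by lia.
rewrite -(sum1_card A) (partition_big (fun a => a + a^-1) (mem split_traces)) /=; last first.
  by move=> a aA; apply/imsetP; exists a.
rewrite mulnC -sum_nat_const; apply: leq_sum => _ /imsetP[b bA ->].
rewrite sum1_card -[2%N]/(size [:: b; b^-1]); apply: leq_trans (card_size _).
apply: subset_leq_card; apply/subsetP => a; rewrite !inE => /andP[/andP[a0 _] /eqP ab].
move: bA; rewrite inE => /andP[b0 _].
by case: (addV_eq a0 b0 ab) => ->; rewrite eqxx ?orbT.
Qed.

Lemma double_notin_split_traces (e : K) : e ^+ 2 = 1 -> e *+ 2 \notin split_traces.
Proof.
move=> e2; apply/imsetP => -[a /[!inE] /andP[a0 a2] E].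
have e0 : e != 0 by rewrite -sqrf_eq0 e2 oner_eq0.
have eV : e^-1 = e by apply: (mulfI e0); rewrite divff // -expr2.
move: a2; have : e + e^-1 = a + a^-1 by rewrite eV -mulr2n.
case/(addV_eq e0 a0) => [<-|e_a]; first by rewrite e2 eqxx.
have -> : a = e^-1 by rewrite e_a invrK.
by rewrite exprVn e2 invr1 eqxx.
Qed.

End SplitTraces.

Section CuspidalCounts.

Variables (K : finFieldType) (F : closedFieldType) (psi : K -> F).
Hypothesis qF : #|K|%:R != 0 :> F.
Hypothesis psiP : additive_character psi.

Lemma cuspidal_trace_split_companion n (r : 'M[K]_2 -> 'M[F]_n) t :
  sl2_rep r -> isotyp psi r 0 = 0 -> t \in split_traces K -> \tr (r (companion2 t)) = 0.
Proof.
move=> rP c /imsetP[a /[!inE] /andP[a0 a2] tE].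
have [||d d0 [b C]] := @sl2_split _ (companion2 t) a.
- exact: companion2_sl.
- by rewrite tr_companion2 tE; field.
apply: (cuspidal_trace_split qF psiP rP c (companion2_sl _) d0 _ C).
have : d + d^-1 = a + a^-1.
  by rewrite -tE -[RHS](tr_companion2 t) (sl2_conj_trace C) mx2M tr_mx2; ring.
by case/(addV_eq d0 a0) => ->; rewrite // exprVn invr_eq1.
Qed.

(** The traces at companion matrices determine all others linearly. They vanish at split [t] and sum
    to 0, so their values on [B], which also leaves out [t = 2], determine everything; independence
    gives [k <= #|B|]. *)
Lemma full_cuspidal_count n k (r : 'I_k -> 'M[K]_2 -> 'M[F]_n) :
  (forall i, sl2_rep (r i)) -> (forall i, airr sl2 (r i)) ->
  (forall i j, i != j -> ~ intertwined sl2 (r i) (r j)) ->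
  (forall i, full_cuspidal psi (r i)) -> n = #|K|.-1 -> (2 * k <= #|K|.+1)%N.
Proof.
move=> rP ri rN fl nE; pose f i t := \tr (r i (companion2 t)).
pose B := [pred t : K | (t \notin split_traces K) && (t != 1 *+ 2)].
pose M : 'M[F]_(k, #|B|) := \matrix_(i, j) f i (enum_val j).
have n0 : (0 < n)%N by rewrite nE -subn1 subn_gt0 finNzRing_gt1.
have kB : (k <= #|B|)%N.
  suff /eqP <- : row_free M by apply: rank_leq_col.
  rewrite -kermx_eq0; apply/rowV0P => c /sub_kermxP cM.
  have cB t : t \in B -> \sum_i c 0 i * f i t = 0.
    move=> tB; move/rowP/(_ (enum_rank_in tB t)): cM; rewrite !mxE => cM.
    by rewrite -[RHS]cM; apply: eq_bigr => i _; rewrite mxE enum_rankK_in.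
  have cn2 t : t != 1 *+ 2 -> \sum_i c 0 i * f i t = 0.
    move=> t2; have [ts|ts] := boolP (t \in split_traces K); last by apply: cB; rewrite inE ts.
    by rewrite big1 // => i _; rewrite /f (cuspidal_trace_split_companion (rP i) (fl i).1 ts) mulr0.
  have ct t : \sum_i c 0 i * f i t = 0.
    have [->|] := eqVneq t (1 *+ 2); last exact: cn2.
    have : \sum_t \sum_i c 0 i * f i t = 0.
      rewrite exchange_big big1 // => i _; rewrite -mulr_sumr.
      by rewrite (cuspidal_sum_companion qF psiP (rP i) (fl i).1) mulr0.
    by rewrite (bigD1 (1 *+ 2)) //= [X in _ + X]big1 ?addr0.
  apply/rowP => i; rewrite mxE.
  have : (c 0 i)%:M = 0 :> 'M[F]_n.
    apply: (coef_independence (@sl2_1 K) (@sl2M K) rP ri rN (C := fun i => (c 0 i)%:M)).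
    move=> g gs; have [x [t xt]] := full_cuspidal_trace_companion qF psiP gs nE.
    transitivity (x * \sum_i c 0 i * f i t); last by rewrite ct mulr0.
    rewrite mulr_sumr; apply: eq_bigr => j _.
    by rewrite mul_scalar_mx mxtraceZ xt // mulrCA.
  by move/matrixP/(_ (Ordinal n0) (Ordinal n0)); rewrite !mxE eqxx.
have cB : (#|B| + #|split_traces K| + 1 = #|K|)%N.
  have two : 1 *+ 2 \notin split_traces K by apply: double_notin_split_traces; rewrite expr1n.
  rewrite -(cardsC (split_traces K)) (cardsD1 (1 *+ 2) (~: _)) inE two.
  rewrite (_ : #|B| = #|~: split_traces K :\ (1 *+ 2)|) /=; last first.
    by apply: eq_card => t; rewrite !inE andbC.
  by rewrite addnAC addnC addnA addn1 add1n addnS addnC.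
have := card_split_traces K; lia.
Qed.

(** * Cuspidal representations of degree (q - 1)/2 *)

Section HalfCuspidal.

Variable nu : K.
Hypothesis nuP : square_classes nu.

Let nu0 : nu != 0. Proof. by case: nuP. Qed.

Section Gauss.

Variables (n : nat) (r : 'M[K]_2 -> 'M[F]_n).
Hypotheses (rP : sl2_rep r) (ri : airr sl2 r).
Hypothesis c : isotyp psi r 0 = 0.
Hypothesis half : \rank (isotyp psi r 1) != \rank (isotyp psi r nu).

Let h g := \tr (r g) - \tr (r (dconj nu g)).

Let h_square a b : a != 0 -> h (um (a ^+ 2 * b)) = h (um b).
Proof.
move=> a0; have tu b' : \tr (r (um (a ^+ 2 * b'))) = \tr (r (um b')).
  apply: (rep_trace_sl2_conj rP); rewrite ?um_sl //; apply: sl2_conj_sym.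
  by exists (tm a); rewrite ?tm_sl // tm_um.
by rewrite /h !dconj_um mulrCA !tu.
Qed.

Let h_nu b : h (um (nu * b)) = - h (um b).
Proof.
rewrite /h !dconj_um mulrA -expr2 opprB; congr (_ - _).
apply: (rep_trace_sl2_conj rP); rewrite ?um_sl //; apply: sl2_conj_sym.
by exists (tm nu); rewrite ?tm_sl // tm_um.
Qed.

(** If the difference vanished at one nontrivial unipotent, it would vanish at all of them, and the
    projectors of weights 1 and [nu] would have equal traces; but their ranks are 0 and 1 in some
    order. *)
Lemma half_cuspidal_gauss b : b != 0 -> h (um b) != 0.
Proof.
move=> b0; apply/eqP => hb.
have h1 : h (um 1) = 0.
  have [a a0 [bE|bE]] := nuP.2 b b0; first by rewrite -(h_square 1 a0) mulr1 -bE.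
  by apply/eqP; rewrite -oppr_eq0 -h_nu mulr1 -(h_square nu a0) -bE hb.
have h0 x : h (um x) = 0.
  have [->|x0] := eqVneq x 0; first by rewrite /h dconj_um mulr0 subrr.
  have [a a0 [->|->]] := nuP.2 x x0; first by rewrite -[_ ^+ 2]mulr1 h_square.
  by rewrite h_square // -[nu]mulr1 h_nu h1 oppr0.
have trE s : \tr (isotyp psi r s) = \tr (isotyp psi (twist nu r) s).
  rewrite !isotypE !linearZ /=; congr (_ * _); rewrite !linear_sum; apply: eq_bigr => x _.
  by rewrite !linearZ /=; congr (_ * _); apply/eqP; rewrite -subr_eq0; apply/eqP/h0.
have tr1 : \tr (isotyp psi r 1) = \tr (isotyp psi r nu).
  by rewrite [RHS]trE -(isotyp_twist nu0 psi r 1) mulr1.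
have le1 s : s != 0 -> (\rank (isotyp psi r s) <= 1)%N by apply: rank_isotyp_le1.
move: tr1 half; rewrite !rank1_idem_trace ?isotyp_idem ?le1 ?oner_eq0 //.
case: (\rank _) (le1 1 (oner_neq0 _)) => [|[|//]] _;
  case: (\rank _) (le1 nu nu0) => [|[|//]] _ //= /eqP.
  by rewrite eq_sym oner_eq0.
by rewrite oner_eq0.
Qed.

End Gauss.

(** For cuspidal [r] this is supported on products of 1 or -1 with unipotents, the only elements
    whose conjugacy class the twist can change. *)
Definition twist_gap n (r : 'M[K]_2 -> 'M[F]_n) g := \tr (r g) - \tr (r (dconj nu g)).

Section Gap.

Variables (n : nat) (r : 'M[K]_2 -> 'M[F]_n).
Hypotheses (rP : sl2_rep r) (ri : airr sl2 r).
Hypothesis c : isotyp psi r 0 = 0.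

Let ts a b : a != 0 -> tm a *m um b \in @sl2 K.
Proof. by move=> a0; rewrite sl2M ?tm_sl ?um_sl. Qed.

Lemma twist_gap_conj g a b : g \in sl2 -> a != 0 -> sl2_conj g (tm a *m um b) ->
  twist_gap r g = twist_gap r (tm a *m um b).
Proof.
move=> gs a0 C; congr (_ - _); first exact: (rep_trace_sl2_conj rP gs (ts b a0) C).
rewrite dconjM // dconj_tm dconj_um; apply: (rep_trace_sl2_conj rP); rewrite ?ts ?dconj_sl //.
exact: dconj_conj.
Qed.

Lemma twist_gap_split g a b : g \in sl2 -> a != 0 -> a ^+ 2 != 1 ->
  sl2_conj g (tm a *m um b) -> twist_gap r g = 0.
Proof.
move=> gs a0 a2 C; rewrite /twist_gap (cuspidal_trace_split qF psiP rP c gs a0 a2 C).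
rewrite (cuspidal_trace_split qF psiP rP c (dconj_sl nu0 gs) a0 a2 (dconj_conj nu0 C)).
by rewrite subrr.
Qed.

(** The twist preserves the trace, which determines the class by [sl2_conj_companion]. *)
Lemma twist_gap_elliptic g : g \in sl2 -> (forall l, l ^+ 2 - \tr g * l + 1 != 0) ->
  twist_gap r g = 0.
Proof.
move=> gs lP; have ds := dconj_sl nu0 gs.
have lP' l : l ^+ 2 - \tr (dconj nu g) * l + 1 != 0 by rewrite tr_dconj.
apply/eqP; rewrite subr_eq0; apply/eqP.
rewrite (rep_trace_sl2_conj rP gs (companion2_sl _) (sl2_conj_companion gs lP)).
rewrite (rep_trace_sl2_conj rP ds (companion2_sl _) (sl2_conj_companion ds lP')).
by rewrite tr_dconj.
Qed.

Lemma twist_gap_central w b : r (tm (-1)) = w%:M ->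
  twist_gap r (tm (-1) *m um b) = w * twist_gap r (um b).
Proof.
move=> rw; rewrite /twist_gap dconjM // dconj_tm dconj_um !(trace_rep_central rP _ rw).
by rewrite mulrBr.
Qed.

Lemma twist_gap_sum_companion : \sum_t twist_gap r (companion2 t) = 0.
Proof.
rewrite big_split /= (cuspidal_sum_companion qF psiP rP c) add0r sumrN.
have c' : isotyp psi (twist nu r) 0 = 0 by rewrite -c -[in LHS](mulr0 nu) isotyp_twist.
by have := cuspidal_sum_companion qF psiP (twist_rep nu0 rP) c'; rewrite /twist => ->; rewrite oppr0.
Qed.

Lemma twist_gap_pm2 : 1 *+ 2 != - 1 *+ 2 :> K ->
  twist_gap r (companion2 (1 *+ 2)) + twist_gap r (companion2 (- 1 *+ 2)) = 0.
Proof.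
move=> pm; rewrite -[RHS]twist_gap_sum_companion (bigD1 (1 *+ 2)) //=; congr (_ + _).
rewrite (bigD1 (- 1 *+ 2)) 1?eq_sym //= [X in _ = _ + X]big1 ?addr0 // => t /andP[t2 tm2].
have [/existsP[l /eqP lP]|] := boolP [exists l, l ^+ 2 - \tr (companion2 t) * l + 1 == 0].
  have [a a0 [b C]] := sl2_split (companion2_sl t) lP.
  apply: (twist_gap_split (companion2_sl t) a0 _ C); apply/eqP => a2.
  have aV : a^-1 = a by apply: (mulfI a0); rewrite divff // -expr2.
  have tE : t = a *+ 2.
    by rewrite -[LHS](tr_companion2 t) (sl2_conj_trace C) mx2M tr_mx2 aV; ring.
  move: (a2); rewrite -{1}(expr1n _ 2) => /eqP; rewrite eqf_sqr => /orP[]/eqP aE.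
    by rewrite tE aE eqxx in t2.
  by rewrite tE aE eqxx in tm2.
by rewrite negb_exists => /forallP lP; apply: twist_gap_elliptic (companion2_sl t) lP.
Qed.

End Gap.

(** Equal ranks make the gaps of [r1] and [r2] agree on unipotents. Then [twist_gap_pm2] determines
    the scalar of -1, since the gap at [b2] is nonzero, so the gaps agree everywhere. This is a
    linear relation between the traces of [r1], [r2] and their twists, four inequivalent
    representations. *)
Lemma half_cuspidal_unique n (r1 r2 : 'M[K]_2 -> 'M[F]_n) :
  (0 < n)%N -> sl2_rep r1 -> sl2_rep r2 -> airr sl2 r1 -> airr sl2 r2 ->
  ~ intertwined sl2 r1 r2 -> ~ intertwined sl2 r2 r1 ->
  isotyp psi r1 0 = 0 -> isotyp psi r2 0 = 0 ->
  \rank (isotyp psi r1 1) != \rank (isotyp psi r1 nu) ->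
  \rank (isotyp psi r1 1) = \rank (isotyp psi r2 1) ->
  \rank (isotyp psi r1 nu) = \rank (isotyp psi r2 nu) -> False.
Proof.
move=> n0 r1P r2P r1i r2i n12 n21 c1 c2 half e1 enu.
have half2 : \rank (isotyp psi r2 1) != \rank (isotyp psi r2 nu) by rewrite -e1 -enu.
have ms s : s != 0 -> \rank (isotyp psi r1 s) = \rank (isotyp psi r2 s).
  case/(nuP.2) => a a0 [->|->]; last by rewrite !rank_isotyp_tm.
  by rewrite -[_ ^+ 2]mulr1 !rank_isotyp_tm.
have gU b : twist_gap r1 (um b) = twist_gap r2 (um b).
  rewrite /twist_gap dconj_um // !(cuspidal_trace_um qF psiP) //.
  by congr (_ - _); apply: eq_bigr => s s0; rewrite ms.
have [w1 w1P] := rep_central_scalar r1P r1i n0.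
have [w2 w2P] := rep_central_scalar r2P r2i n0.
have w12 : w1 = w2.
  have [pm|pm] := eqVneq (1 *+ 2 : K) (- 1 *+ 2).
    have N1 : -1 = 1 :> K.
      apply/eqP; rewrite eq_sym -subr_eq0 opprK -sqrf_eq0; apply/eqP.
      by transitivity (1 *+ 2 - (- 1 *+ 2) : K); [ring | rewrite pm subrr].
    have w12M : w1%:M = w2%:M :> 'M[F]_n.
      by rewrite -w1P -w2P N1 tm1 (rep1 r1P) (rep1 r2P).
    by move/matrixP/(_ (Ordinal n0) (Ordinal n0)): w12M; rewrite !mxE eqxx.
  have [b1 b10 C1] := companion2_unipotent (expr1n K 2).
  have [b2 b20 C2] := companion2_unipotent (etrans (sqrrN (1 : K)) (expr1n K 2)).
  have gE x (r : 'M[K]_2 -> 'M[F]_n) (rP : sl2_rep r) b : x ^+ 2 = 1 -> sl2_conj (companion2 (x *+ 2)) (tm x *m um b) ->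
      twist_gap r (companion2 (x *+ 2)) = twist_gap r (tm x *m um b) :> F.
    move=> x2; apply: (twist_gap_conj rP (companion2_sl _)).
    by rewrite -sqrf_eq0 x2 oner_eq0.
  have wE (r : 'M[K]_2 -> 'M[F]_n) w (rP : sl2_rep r) : isotyp psi r 0 = 0 -> r (tm (-1)) = w%:M ->
      twist_gap r (um b1) + w * twist_gap r (um b2) = 0 :> F.
    move=> c wP; rewrite -(twist_gap_pm2 rP c pm).
    rewrite (gE _ _ rP _ (expr1n K 2) C1) tm1 mul1mx.
    rewrite (gE _ _ rP _ _ C2) ?sqrrN ?expr1n //.
    by rewrite (twist_gap_central rP _ wP).
  have b2n := half_cuspidal_gauss r1P r1i half b20.
  have := wE _ _ r2P c2 w2P; rewrite -!gU -[RHS](wE _ _ r1P c1 w1P) => /addrI/(mulIf b2n).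
  exact: esym.
have gap g : g \in sl2 -> twist_gap r1 g = twist_gap r2 g.
  move=> gs.
  have [/existsP[l /eqP lP]|] := boolP [exists l, l ^+ 2 - \tr g * l + 1 == 0]; last first.
    by rewrite negb_exists => /forallP lP; rewrite !twist_gap_elliptic.
  have [a a0 [b C]] := sl2_split gs lP.
  have [a2|a2] := eqVneq (a ^+ 2) 1; last by rewrite !(twist_gap_split _ _ gs a0 a2 C).
  rewrite !(twist_gap_conj _ gs a0 C) //.
  move: (a2); rewrite -{1}(expr1n _ 2) => /eqP; rewrite eqf_sqr => /orP[]/eqP->.
    by rewrite tm1 mul1mx.
  by rewrite (twist_gap_central r1P _ w1P) (twist_gap_central r2P _ w2P) w12 gU.
have tP r : sl2_rep r -> sl2_rep (twist nu r) := @twist_rep _ _ nu0 F n r.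
have ti r : airr sl2 r -> airr sl2 (twist nu r) := @twist_airr _ _ nu0 F n r.
pose rr (i : 'I_2 * bool) := let r := if i.1 == 0 then r1 else r2 in if i.2 then twist nu r else r.
have rrP i : sl2_rep (rr i).
  by case: i => i [] /=; rewrite /rr /=; case: ifP => _ //; apply: tP.
have rri i : airr sl2 (rr i).
  by case: i => i [] /=; rewrite /rr /=; case: ifP => _ //; apply: ti.
have nu0' : nu^-1 != 0 by rewrite invr_eq0.
have rk (b : bool) i : \rank (isotyp psi (rr (i, b)) 1) = \rank (isotyp psi r1 (if b then nu else 1)).
  have tw r : sl2_rep r -> \rank (isotyp psi (twist nu r) 1) = \rank (isotyp psi r nu).
    move=> rP; rewrite -(mulfV nu0) (isotyp_twist nu0) -(rank_isotyp_tm psi rP nu nu0').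
    by congr (\rank (isotyp _ _ _)); field.
  by case: b; case: (ord2P i) => ->; rewrite /rr /= ?tw.
have rrN i j : i != j -> ~ intertwined sl2 (rr i) (rr j).
  case: i j => i b [j b'] ij; have [bb|bb] := eqVneq b b'; last first.
    move=> /(intertwined_rank_isotyp psi (rri _) (rri _) 1).
    rewrite !rk; move: bb half; case: b {ij}; case: b' => // _ h; last by move/eqP; rewrite (negPf h).
    by move/esym/eqP; rewrite (negPf h).
  have tw (b0 : bool) : ~ intertwined sl2 (rr (i, false)) (rr (j, false)) ->
      ~ intertwined sl2 (rr (i, b0)) (rr (j, b0)).
    by case: b0 => // H; rewrite /rr /= => /(twist_intertwined nu0).
  rewrite bb; apply: tw; move: ij; rewrite bb.
  by case: (ord2P i) => ->; case: (ord2P j) => -> //; rewrite ?eqxx // => _; rewrite /rr.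
have := coef_independence (@sl2_1 K) (@sl2M K) rrP rri rrN
  (C := fun i => (if (i.1 == 0) == i.2 then -1 else 1)%:M).
move=> H; have /matrixP/(_ (Ordinal n0) (Ordinal n0)) : 1%:M = 0 :> 'M[F]_n.
  apply: (H _ (0, false)) => g gs.
  rewrite -(pair_bigA _ (fun i b => \tr ((if (i == 0) == b then -1 else 1)%:M *m rr (i, b) g))) /=.
  rewrite !big_ord_recl big_ord0 !big_bool /rr /= !mul_scalar_mx !mxtraceZ !mulN1r !mul1r addr0.
  by rewrite -[RHS](subrr (twist_gap r1 g)) {2}(gap g gs) /twist_gap /twist; ring.
by rewrite !mxE eqxx /= => /eqP; rewrite oner_eq0.
Qed.

End HalfCuspidal.

End CuspidalCounts.

(** A nonzero coordinate of [K] over its prime field is used as exponent of a nontrivial [p]-th root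
    of unity, which exists because [p] is invertible in [F]. *)
Lemma additive_character_exists (K : finFieldType) (F : closedFieldType) :
  #|K|%:R != 0 :> F -> exists psi : K -> F, additive_character psi.
Proof.
move=> qF; have [p pr pK] := finPcharP K.
have pF : p%:R != 0 :> F.
  apply: contraNneq qF => pF; have qE := card_pprimeChar pK; rewrite -/#|K| in qE.
  rewrite (_ : #|K| = (p ^ logn p #|K|)%N) // natrX pF expr0n; case: logn qE => //.
  by move=> q1; have := finNzRing_gt1 K; rewrite q1.
have [z zp z1] : exists2 z : F, z ^+ p = 1 & z != 1.
  have sP : size (\poly_(i < p) 1 : {poly F}) != 1%N.
    by rewrite size_poly_eq ?oner_eq0 //; apply: contraTneq pr => ->.
  have /closed_rootP[z /rootP] := sP; rewrite horner_poly.
  under eq_bigr do rewrite mul1r; move=> H.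
  exists z; first by apply/eqP; rewrite -subr_eq0 subrX1 H mulr0.
  apply: contraNneq pF => z1; move: H; rewrite z1.
  by under eq_bigr do rewrite expr1n; rewrite sumr_const card_ord => ->.
pose R := pPrimeCharType pK.
have [l lD [x0 lx0]] : exists2 l : K -> 'F_p, {morph l : x y / x + y} & exists x, l x != 0.
  pose B := vbasis (fullv : {vspace R}).
  have [i ci] : exists i, coord B i (1 : R) != 0.
    apply/existsP; rewrite -negb_forall; apply/negP => /forallP c0.
    have := oner_eq0 R; rewrite (coord_vbasis (memvf (1 : R))) big1 ?eqxx // => i _.
    by have /eqP -> := c0 i; rewrite scale0r.
  exists (fun x => coord B i (x : R)); last by exists 1.
  by move=> x y; rewrite -linearD.
pose psi x := z ^+ (l x : nat).
have psiD a b : psi (a + b) = psi a * psi b.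
  rewrite /psi lD -exprD /=.
  by rewrite expr_mod // Fp_cast.
have psi0 : psi 0 = 1.
  have l0 : l 0 = 0 by apply: (addrI (l 0)); rewrite -lD !addr0.
  by rewrite /psi l0.
have psix0 : psi x0 != 1.
  rewrite -[psi x0]/(z ^+ (l x0 : nat)); set j := nat_of_ord _.
  have j0 : (0 < j)%N by rewrite lt0n.
  have jp : (j < p)%N by rewrite -[X in (_ < X)%N](Fp_cast pr) ltn_ord.
  have cop : coprime p j by rewrite prime_coprime // gtnNdvd.
  apply: contraNneq z1 => zj.
  have [u v uv _] := egcdnP p j0; rewrite gcdnC (eqP cop) in uv.
  have : z ^+ (u * j) = z by rewrite uv exprD mulnC exprM zp expr1n mul1r.
  by rewrite mulnC exprM zj expr1n => <-.
exists psi; split=> // s; have [->|s0] := eqVneq s 0.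
  rewrite (eq_bigr (fun=> 1)) => [|b _]; first by rewrite sumr_const.
  by rewrite mul0r.
rewrite mulr0n; apply/eqP.
have : (psi x0 - 1) * \sum_b psi (s * b) = 0.
  rewrite mulrBl mul1r [X in _ - X](reindex (fun b => b + x0 / s)) /=; last first.
    by exists (fun b => b - x0 / s) => b _; rewrite ?addrK ?subrK.
  apply/eqP; rewrite subr_eq0 mulr_sumr; apply/eqP/eq_bigr => b _.
  by rewrite mulrDr mulrCA divff // mulr1 psiD mulrC.
by move/eqP; rewrite mulf_eq0 subr_eq0 (negPf psix0).
Qed.

Theorem sl2_family_bound (K : finFieldType) (F : closedFieldType) n k
    (r : 'I_k -> 'M[K]_2 -> 'M[F]_n) :
  #|K|%:R != 0 :> F -> (3 < #|K|)%N -> (1 < n)%N -> (0 < k)%N ->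
  (forall i, sl2_rep (r i)) -> (forall i, airr sl2 (r i)) ->
  (forall i j, i != j -> ~ intertwined sl2 (r i) (r j)) ->
  degree_table n #|K| k.
Proof.
move=> qF q3 n1 k0 rP ri rN.
have [psi psiP] := additive_character_exists qF.
have [nu nuP] := square_classes_exist K.
have dims i := sl2_rep_dimension qF psiP q3 nuP (rP i) (@ri i) n1.
case: (dims (Ordinal k0)) => [[nE _]|[nE _]|[nE _]|[_ [[nE _]|[nE _]]]].
- left; split=> //; exact: (principal_series_count qF psiP q3 nuP rP ri rN n1 nE).
- right; left; split=> //; exact: (steinberg_count qF psiP q3 nuP rP ri rN n1 nE).
- do 3!right; split; first by left.
  exact: (half_principal_count qF psiP q3 nuP rP ri rN n1 nE).
- do 2!right; left; split=> //; apply: (full_cuspidal_count qF psiP rP ri rN _ nE) => i.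
  case: (dims i) => [[n' _]|[n' _]|[n' _]|[c [[_ fl]|[n' _]]]]; by [split|lia].
do 3!right; split; first by right.
have H i : isotyp psi (r i) 0 = 0 /\
    \rank (isotyp psi (r i) 1) != \rank (isotyp psi (r i) nu).
  case: (dims i) => [[n' _]|[n' _]|[n' _]|[c [[n' _]|[_ hf]]]]; by [split|lia].
have le1 i s : s != 0 -> (\rank (isotyp psi (r i) s) <= 1)%N by apply: rank_isotyp_le1.
have nu0 : nu != 0 by case: nuP.
(* A half cuspidal representation is determined by which square class carries its weights. *)
have : injective (fun i => \rank (isotyp psi (r i) 1) == 1%N).
  move=> i j e; apply/eqP/negPn/negP => ij.
  have [[ci hi] [cj hj]] := (H i, H j).
  have ji : j != i by rewrite eq_sym.
  have eq1 : \rank (isotyp psi (r i) 1) = \rank (isotyp psi (r j) 1).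
    move: (le1 i 1 (oner_neq0 _)) (le1 j 1 (oner_neq0 _)) e.
    by case: (\rank _) => [|[|//]] _; case: (\rank _) => [|[|//]].
  apply: (half_cuspidal_unique qF psiP nuP (ltnW n1) (rP i) (rP j) (@ri i) (@ri j)
    (rN _ _ ij) (rN _ _ ji) ci cj hi eq1).
  move: (le1 i 1 (oner_neq0 _)) (le1 i nu nu0) (le1 j nu nu0) hi hj; rewrite -eq1.
  by case: (\rank _) => [|[|//]] _; case: (\rank _) => [|[|//]] _; case: (\rank _) => [|[|//]].
by move/leq_card; rewrite card_ord card_bool.
Qed.

(** * Uniqueness of finite fields *)

(** The minimal polynomial [m] of [a] divides ['X^#|K| - 'X], which vanishes on all of [K'] too, so
    [m] has a root there. *)
Lemma finField_conjugate_root (k : fieldType) (K K' : finFieldType)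
    (u : {rmorphism k -> K}) (u' : {rmorphism k -> K'}) (a : K) : #|K| = #|K'| ->
  exists b : K', forall P : {poly k}, root (map_poly u P) a -> root (map_poly u' P) b.
Proof.
move=> cK; pose Q : {poly k} := 'X^#|K| - 'X.
have sQ : size Q = #|K|.+1.
  by rewrite size_polyDl size_polyXn // size_polyN size_polyX ltnS finNzRing_gt1.
have Q0 : Q != 0 by rewrite -size_poly_eq0 sQ.
have QE (L : finFieldType) (v : {rmorphism k -> L}) x : #|L| = #|K| -> root (map_poly v Q) x.
  move=> cL; rewrite rootE rmorphB /= map_polyXn map_polyX !hornerE -cL expf_card subrr.
  by [].
have [m [m0 mr] mmin] : exists2 m : {poly k}, m != 0 /\ root (map_poly u m) a
    & forall P, root (map_poly u P) a -> m %| P.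
  move: (leqnn (size Q)) (QE K u a erefl) Q0; move: {2}(size Q) => n.
  elim: n (Q) => [|n IH] P; last move=> sP Pr P0.
    by move=> + _ P0; rewrite leqn0 size_poly_eq0 (negPf P0).
  have [[S [S0 Sr sS]]|noS] := boolp.pselect
      (exists S : {poly k}, [/\ S != 0, root (map_poly u S) a & (size S < size P)%N]).
    by apply: (IH S) => //; rewrite -ltnS (leq_trans sS).
  exists P; first by split.
  move=> S Sr; apply/modp_eq0P/eqP/negPn/negP => r0; apply: noS.
  exists (S %% P); split=> //; last by rewrite ltn_modp.
  move: Sr; rewrite {1}(divp_eq S P) rmorphD rmorphM /= rootE hornerD hornerM.
  by rewrite (rootP Pr) mulr0 add0r.
have [S SE] := dvdpP _ _ (mmin _ (QE K u a erefl)).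
have m1 : (1 < size m)%N.
  rewrite ltnNge; apply/negP => /size1_polyC mc; move: m0 mr.
  by rewrite mc map_polyC rootE hornerC polyC_eq0 fmorph_eq0 => /negPf->.
have S0 : S != 0 by apply: contraNneq Q0 => S0; rewrite SE S0 mul0r.
have [b bm] : exists b, root (map_poly u' m) b.
  have [|nb] := boolp.pselect (exists b, root (map_poly u' m) b); first by [].
  (* If [m] had no root, all of [K'] would be roots of the cofactor [S], whose degree is too
     small. *)
  have := @max_poly_roots _ (map_poly u' S) (enum K').
  rewrite map_poly_eq0 S0 enum_uniq size_map_poly -cardE -cK => /(_ isT).
  have -> : all (root (map_poly u' S)) (enum K').
    apply/allP => x _; have := QE K' u' x (esym cK); rewrite SE rmorphM rootM /=.
    by case/orP => // xm; case: nb; exists x.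
  move/(_ isT isT); have := sQ; rewrite SE size_mul //; move: m1.
  by case: (size m) => [|[|d]] // _; rewrite !addnS /= => -[<-]; rewrite ltnNge leq_addr.
exists b => P /mmin/dvdpP[T ->]; rewrite rmorphM rootM bm orbT //.
Qed.

Lemma finField_embed (k : fieldType) (K K' : finFieldType)
    (u : {rmorphism k -> K}) (u' : {rmorphism k -> K'}) :
  #|K| = #|K'| -> inhabited {rmorphism K -> K'}.
Proof.
move=> cK; have [a a0 aP] := finField_generator K.
have [b bP] := finField_conjugate_root u u' a cK.
have ex x : exists P : {poly k}, (map_poly u P).[a] == x.
  have [->|/aP[i ->]] := eqVneq x 0; first by exists 0; rewrite rmorph0 horner0.
  by exists 'X^i; rewrite map_polyXn hornerXn.
pose f x := (map_poly u' (xchoose (ex x))).[b].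
have fE P : f (map_poly u P).[a] = (map_poly u' P).[b].
  rewrite /f; set S := xchoose _; have /eqP SE : (map_poly u S).[a] == (map_poly u P).[a].
    exact: (xchooseP (ex (map_poly u P).[a])).
  apply/eqP; rewrite -subr_eq0 -hornerN -hornerD -rmorphB.
  by apply: bP; rewrite rootE rmorphB /= hornerD hornerN SE subrr.
have fB : {morph f : x y / x - y}.
  move=> x y; have [/eqP<- /eqP<-] := (xchooseP (ex x), xchooseP (ex y)).
  by rewrite -hornerN -hornerD -rmorphB !fE rmorphB hornerD hornerN.
have fM : {morph f : x y / x * y}.
  move=> x y; have [/eqP<- /eqP<-] := (xchooseP (ex x), xchooseP (ex y)).
  by rewrite -hornerM -rmorphM !fE rmorphM hornerM.
have f1 : f 1 = 1 by have := fE 1; rewrite !rmorph1 !hornerC.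
pose fA := GRing.isZmodMorphism.Build _ _ f fB.
pose fP := GRing.isMonoidMorphism.Build _ _ f (f1, fM).
exact: (inhabits (HB.pack_for {rmorphism K -> K'} f fA fP)).
Qed.

(** Each group comes with its own field; this allows groups with the same [q] to be moved to a
    single field. *)
Lemma finField_iso (K K' : finFieldType) : #|K| = #|K'| -> inhabited {rmorphism K -> K'}.
Proof.
move=> cK; have [p p_pr pK] := finPcharP K.
have pK' : p \in [pchar K'].
  have [n cn] : exists n, #|K| = (p ^ n)%N.
    exists (logn p #|pPrimeCharType pK|); exact: card_pprimeChar.
  by apply: (card_finPcharP (n := n)) => //; rewrite -cK.
pose u : {rmorphism 'F_p -> pPrimeCharType pK} := in_alg (pPrimeCharType pK).
pose u' : {rmorphism 'F_p -> pPrimeCharType pK'} := in_alg (pPrimeCharType pK').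
exact: (@finField_embed 'F_p K K' u u' cK).
Qed.

Local Close Scope ring_scope.
Import GroupScope FinRing.Theory.

(** * Perfect central extensions of SL2(K) *)

(** The transfer to [P / [~: P, P]] kills the commutators of [G] and raises a central [z] to the
    power [#|G : P|], which is prime to the order of [P]. *)
Lemma Sylow_center_der1 (gT : finGroupType) (G P : {group gT}) p z :
  p.-Sylow(G) P -> z \in P -> z \in 'Z(G) -> z \in [~: G, G] -> z \in [~: P, P].
Proof.
move=> sylP zP /centerP[zG zC] zG'; have sPG := pHall_sub sylP.
have nP : P \subset 'N([~: P, P]) by apply: normal_norm (der_normal 1 P).
pose al := restrm nP (coset [~: P, P]).
have alE : al @* P = P / [~: P, P] by rewrite morphim_restrm setIid.
have abA : abelian (al @* P) by rewrite alE sub_der1_abelian.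
pose V := transfer_morphism G abA.
have Vz : (V z = FiniteModule.fmod abA (coset [~: P, P] z) *+ #|G : P|)%R.
  rewrite /V /= /transfer -GRing.sumr_const; apply: eq_bigr => _ /rcosetsP[x xG ->].
  have -> : P :* x :* z = P :* x.
    by rewrite -rcosetM -(zC x xG) rcosetM (rcoset_id zP).
  have rG : repr (P :* x) \in G.
    by case: repr_rcosetP => y yP; rewrite groupM // (subsetP sPG).
  by rewrite -(zC _ rG) mulgK.
have V0 : V z = 0%R.
  have : [~: G, G] \subset 'ker V.
    rewrite gen_subG; apply/subsetP => _ /imset2P[x y xG yG ->].
    apply/kerP; first by rewrite groupR.
    rewrite morphR //; apply/eqP/commgP; exact: zmod_mulgC.
  by move/subsetP/(_ z zG')/mker.
have zal : coset [~: P, P] z \in al @* P by rewrite alE mem_quotient.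
set w := coset _ _ in zal Vz *.
have w1 : w ^+ #|G : P| = 1.
  rewrite -(FiniteModule.fmodK abA zal) -FiniteModule.fmvalZ -Vz V0.
  exact: FiniteModule.fmval0.
have : #[w] %| #|G : P| by rewrite order_dvdn w1.
have : #[w] %| #|P|.
  by apply: dvdn_trans (order_dvdG zal) _; rewrite dvdn_morphim.
move=> d1 d2; have : coprime #|P| #|G : P| by case/and3P: sylP => _ pP; apply: pnat_coprime.
move/(coprime_dvdl d1)/(coprime_dvdr d2); rewrite /coprime gcdnn => /eqP o1.
have : w = 1 by apply/eqP; rewrite -order_eq1 o1.
by move/coset_idr; apply; apply: (subsetP nP).
Qed.

Section CentralExtension.

Variables (gT aT : finGroupType) (E : {group gT}) (f : {morphism E >-> aT}).
Hypothesis kerZ : 'ker f \subset 'Z(E).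

Lemma central_ext_ker_mul x y : x \in E -> y \in E -> f x = f y ->
  exists2 z, z \in 'ker f & x = z * y.
Proof.
move=> xE yE e; exists (x * y^-1); last by rewrite mulgKV.
by apply/kerP; rewrite ?groupM ?groupV // morphM ?morphV ?groupV // e mulgV.
Qed.

Lemma central_ext_commg x x' y y' : x \in E -> x' \in E -> y \in E -> y' \in E ->
  f x = f x' -> f y = f y' -> [~ x, y] = [~ x', y'].
Proof.
move=> xE x'E yE y'E fx fy.
have [z zk ->] := central_ext_ker_mul xE x'E fx.
have [w wk ->] := central_ext_ker_mul yE y'E fy.
have /centerP[zE zC] := subsetP kerZ z zk.
have /centerP[wE wC] := subsetP kerZ w wk.
have C a b c : c \in 'ker f -> a \in E -> b \in E -> [~ c * a, b] = [~ a, b].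
  move=> /(subsetP kerZ)/centerP[cE cC] aE bE; rewrite commMgJ.
  have -> : [~ c, b] = 1 by apply/eqP/commgP; apply: cC.
  by rewrite conj1g mul1g.
rewrite C ?groupM //; apply: invg_inj; rewrite !invg_comm; exact: C.
Qed.

(** An element of prime order in the kernel lies in a Sylow subgroup and, as [E] is perfect, in its
    derived subgroup by transfer. *)
Lemma perfect_central_ext_trivial : [~: E, E] = E ->
  (forall (r : nat) (P : {group gT}), prime r -> r.-Sylow(E) P ->
     forall z, z \in [~: P, P] -> z \in 'ker f -> z = 1) ->
  'ker f = 1.
Proof.
move=> perfE triv; apply/eqP/trivgPn => -[z0 z0k z01].
have : 'ker f != 1 by apply/trivgPn; exists z0.
rewrite -cardG_gt1 => /pdivP[r r_pr rd].
have [z zk zr] := Cauchy r_pr rd.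
have zE : z \in E by apply: (subsetP (subsetIl E _)); exact: zk.
have rz : r.-group <[z]> by rewrite /pgroup -orderE zr pnat_id.
have sz : <[z]> \subset E by rewrite cycle_subG.
have [P sylP zP] := Sylow_superset sz rz.
have zP' : z \in P by rewrite -cycle_subG.
have z1 : z = 1.
  apply: (triv r P r_pr sylP) => //; apply: (Sylow_center_der1 sylP) => //.
    exact: (subsetP kerZ).
  by rewrite perfE.
by move: zr r_pr; rewrite z1 order1 => <-.
Qed.

Lemma central_ext_cyclic (P : {group gT}) z : P \subset E -> cyclic (f @* P) ->
  z \in [~: P, P] -> z = 1.
Proof.
move=> sPE cyc zP; suff abP : abelian P.
  by move: zP; rewrite (commG1P abP) => /set1P.
apply: (@cyclic_factor_abelian _ ('ker_P f)%G).
  apply/subsetP => k /setIP[kP /(subsetP kerZ)/centerP[_ kC]].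
  by apply/centerP; split=> // u uP; apply: kC; apply: (subsetP sPE).
by rewrite (isog_cyclic (first_isog_loc f sPE)).
Qed.

(** [[~: P, P]] is generated by the commutator [c] of lifts of [x] and [y]. Up to a central factor
    [X ^+ m] is [Y ^+ 2], so it commutes with [Y] and [c ^+ m = 1]. Its image [x ^- 2] has order
    exactly [m], so no nontrivial power of [c] is in the kernel. *)
Lemma central_ext_quaternion (P : {group gT}) n x y z : P \subset E ->
  (1 < n)%N -> f @* P = <[x]> * <[y]> -> #[x] = (2 ^ n)%N -> y ^+ 2 = x ^+ (2 ^ n.-1) -> x ^ y = x^-1 ->
  z \in [~: P, P] -> z \in 'ker f -> z = 1.
Proof.
move=> sPE n1 fP ox y2 xy zP zk.
have /morphimP[X XE XP fX] : x \in f @* P by rewrite fP (subsetP (mulG_subl _ _)) ?cycle_id.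
have /morphimP[Y YE YP fY] : y \in f @* P by rewrite fP (subsetP (mulG_subr _ _)) ?cycle_id.
pose c := [~ X, Y]; pose m := (2 ^ n.-1)%N.
have [w wk XY] : exists2 w, w \in 'ker f & X ^ Y = w * X^-1.
  apply: central_ext_ker_mul; rewrite ?groupJ ?groupV // morphJ // morphV // -fX -fY.
  exact: xy.
have /centerP[wE wC] := subsetP kerZ w wk.
have cE : c = w * X ^- 2.
  rewrite /c commgEl XY mulgA -(wC _ (groupVr XE)) -mulgA -invMg.
  by congr (_ * _^-1); rewrite expgS expg1.
have wX : commute w X by apply: wC.
have cX : commute X c.
  by rewrite cE; apply: commuteM; [apply: commute_sym | apply/commuteV/commuteX].
have XYE : X ^ Y = X * c by rewrite conjg_mulR.
have cm : c ^+ m = 1.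
  have [v vk Xm] : exists2 v, v \in 'ker f & X ^+ m = v * Y ^+ 2.
    by apply: central_ext_ker_mul; rewrite ?groupX // !morphX // -fX -fY y2.
  have /centerP[vE vC] := subsetP kerZ v vk.
  have XmY : (X ^+ m) ^ Y = X ^+ m.
    apply/conjg_fixP/commgP; rewrite Xm; apply: commute_sym; apply: commuteM.
      by apply: commute_sym; apply: vC.
    exact: commuteX.
  by move: XmY; rewrite conjXg XYE expgMn // -[RHS]mulg1 => /mulgI.
have cY : c ^ Y = c^-1.
  have wY : w ^ Y = w by apply/conjg_fixP/commgP; apply: wC.
  have wV : commute w X^-1 by apply: commuteV.
  have wX2 : commute w (X ^+ 2) by apply: commuteX.
  rewrite cE conjMg conjVg conjXg wY XY expgMn // expVgn (invMg (w ^+ 2)) (invMg w) !invgK.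
  by rewrite mulgA wX2 -mulgA mulKVg [RHS]invMg invgK.
have cN u : c ^ u \in <[c]> -> u \in 'N(<[c]>).
  by move=> cu; rewrite inE -cycleJ cycle_subG.
have XN : X \in 'N(<[c]>) by apply: cN; rewrite conjgE -cX mulKg cycle_id.
have YN : Y \in 'N(<[c]>) by apply: cN; rewrite cY groupV cycle_id.
have sub : [~: P, P] \subset <[c]>.
  rewrite gen_subG; apply/subsetP => _ /imset2P[p q pP qP ->].
  have lift p' : p' \in P -> exists i j, f p' = f (X ^+ i * Y ^+ j).
    move=> p'P; have : f p' \in f @* P by rewrite mem_morphim ?(subsetP sPE).
    rewrite fP => /mulsgP[_ _ /cycleP[i ->] /cycleP[j ->] ->].
    by exists i, j; rewrite morphM ?groupX // !morphX // -fX -fY.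
  have [[i [j e1]] [k [l e2]]] := (lift p pP, lift q qP).
  have -> : [~ p, q] = [~ X ^+ i * Y ^+ j, X ^+ k * Y ^+ l].
    by apply: central_ext_commg; rewrite ?groupM ?groupX ?(subsetP sPE).
  apply: coset_idr; first by rewrite groupR ?groupM ?groupX.
  rewrite morphR ?groupM ?groupX //; apply/eqP/commgP.
  have XYC : commute (coset <[c]> X) (coset <[c]> Y).
    by apply/commgP; rewrite -morphR //; apply/eqP/coset_id/cycle_id.
  rewrite !morphM ?groupX // !morphX //.
  have h a b : commute (coset <[c]> X ^+ a) (coset <[c]> Y ^+ b).
    by apply: commuteX2.
  apply: commuteM; apply: commute_sym; apply: commuteM.
  - exact: commuteX2.
  - exact: h.
  - exact/commute_sym/h.
  - exact: commuteX2.
have /cycleP[i zi] := subsetP sub z zP.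
have fc : f c = x ^- 2.
  by rewrite cE morphM ?groupV ?groupX // (mker wk) mul1g morphV ?groupX // morphX // -fX.
have : x ^+ (2 * i) = 1.
  move/mker: zk; rewrite zi morphX ?groupR // fc expgVn -expgM => /eqP.
  by rewrite invg_eq1 => /eqP.
move/eqP; rewrite -order_dvdn ox -(prednK (ltnW n1)) expnS dvdn_pmul2l // => /dvdnP[j jE].
by rewrite zi jE mulnC expgM cm expg1n.
Qed.

End CentralExtension.

Lemma sum_ord2 (V : nmodType) (f : 'I_2 -> V) : (\sum_(i < 2) f i = f 0 + f 1)%R.
Proof.
by rewrite !big_ord_recl big_ord0 addr0; congr (f _ + f _)%R; apply: val_inj.
Qed.

Lemma natr_card_eq0 (R : finNzRingType) : (#|R|%:R = 0 :> R)%R.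
Proof.
have : (\sum_(x : R) x = \sum_(x : R) (x + 1))%R.
  by rewrite [LHS](reindex (fun x => x + 1)%R) //; exists (fun x => x - 1)%R => x _;
     rewrite ?addrK ?subrK.
by rewrite big_split /= sumr_const -[LHS]addr0 => /addrI; exact: esym.
Qed.

(** * SL_2(K) as a finite group *)

Section SL2Group.

Variable K : finFieldType.
Local Notation G := (SL2_group K).

(* The junk value 1 is only reached outside sl2. *)
Definition slg (g : 'M[K]_2) : {'GL_2[K]} := insubd (1 : {'GL_2[K]}) g.

Lemma GLval_inj : injective (@GLval 2 K).
Proof. exact: val_inj. Qed.

Lemma slgE g : g \in sl2 -> GLval (slg g) = g.
Proof.
move=> gs; rewrite /slg val_insubd ifT //.
by move: gs; rewrite inE unitmxE => /eqP->; apply: unitr1.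
Qed.

Lemma GLval_sl2 x : x \in G -> GLval x \in sl2.
Proof. by rewrite inE. Qed.

Lemma slg_G g : g \in sl2 -> slg g \in G.
Proof. by move=> gs; rewrite inE slgE. Qed.

Lemma slgK (x : {'GL_2[K]}) : slg (GLval x) = x.
Proof. exact: valKd. Qed.

Lemma slgM : {in sl2 &, forall g h, slg (g *m h) = slg g * slg h}.
Proof. by move=> g h gs hs; apply: GLval_inj; rewrite GL_MxE !slgE ?sl2M. Qed.

Lemma slg1 : slg 1%:M = 1.
Proof. by apply: GLval_inj; rewrite slgE ?sl2_1 // GL_1E. Qed.

Lemma slg_umM a b : slg (um a) * slg (um b) = slg (um (a + b)%R).
Proof. by rewrite -slgM ?um_sl // umD. Qed.

Lemma slg_lmM a b : slg (lm a) * slg (lm b) = slg (lm (a + b)%R).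
Proof. by rewrite -slgM ?lm_sl // !mx2M; congr (slg (mx2 _ _ _ _)); ring. Qed.

Lemma slg_um_tm a b : (a != 0)%R ->
  slg (um b) ^ slg (tm a) = slg (um ((a ^+ 2)^-1 * b)%R).
Proof.
move=> a0; rewrite conjgE; apply: (mulgI (slg (tm a))); rewrite mulKVg.
rewrite -!slgM ?um_sl ?tm_sl // tm_um // mulVKf // expf_neq0 //.
Qed.

Lemma slg_lm_tm a c : (a != 0)%R ->
  slg (lm c) ^ slg (tm a) = slg (lm (a ^+ 2 * c)%R).
Proof.
move=> a0; rewrite conjgE; apply: (mulgI (slg (tm a))); rewrite mulKVg.
rewrite -!slgM ?lm_sl ?tm_sl //; congr slg; rewrite !mx2M; congr mx2; field.
all: by rewrite ?a0.
Qed.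

Lemma slg_ind (P : {'GL_2[K]} -> Prop) :
  (forall b, P (slg (um b))) -> (forall c, P (slg (lm c))) ->
  {in G &, forall x y, P x -> P y -> P (x * y)} -> {in G, forall x, P x}.
Proof.
move=> Pu Pl PM x xG; rewrite -[x]slgK; move: (GLval_sl2 xG); move: (GLval x).
apply: (@sl2_ind K (fun g => P (slg g))) => // g h gs hs Pg Ph.
by rewrite slgM //; apply: PM => //; apply: slg_G.
Qed.

(** A torus element with [a ^+ 2 != 1], which exists for [q > 3], makes every unipotent a
    commutator. *)
Lemma SL2_perfect : (3 < #|K|)%N -> [~: SL2 K, SL2 K] = SL2 K.
Proof.
move=> q3; apply/eqP; rewrite eqEsubset commg_subl normG /=.
have [a a0 a2] : exists2 a : K, (a != 0)%R & (a ^+ 2 != 1)%R.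
  have : [exists a : K, (a != 0) && (a ^+ 2 != 1)]%R.
    apply: contraLR q3; rewrite negb_exists -leqNgt => /forallP H; rewrite -[3%N]/(size [:: 0; 1; -1 : K]%R).
    apply: leq_trans (card_size _); apply: subset_leq_card.
    apply/subsetP => a _; move: (H a); rewrite negb_and !negbK !inE => /orP[->//|].
    by rewrite -[X in _ == X](expr1n _ 2) eqf_sqr => /orP[]->; rewrite ?orbT.
  by case/existsP => a /andP[]; exists a.
have d0 : ((a ^+ 2)^-1 - 1 != 0)%R by rewrite subr_eq0 invr_eq1.
have d0' : (a ^+ 2 - 1 != 0)%R by rewrite subr_eq0.
apply/subsetP; apply: slg_ind => [b|c|x y _ _]; last exact: groupM.
  have -> : slg (um b) = [~ slg (um (b / ((a ^+ 2)^-1 - 1))%R), slg (tm a)].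
    rewrite commgEl slg_um_tm //; apply: (mulgI (slg (um (b / ((a ^+ 2)^-1 - 1))%R))).
    rewrite mulKVg slg_umM; congr (slg (um _)).
    by rewrite -{2}[b](mulfVK d0); set x := (_ / _)%R; ring.
  by rewrite mem_commg ?slg_G ?um_sl ?tm_sl.
have -> : slg (lm c) = [~ slg (lm (c / (a ^+ 2 - 1))%R), slg (tm a)].
  rewrite commgEl slg_lm_tm //; apply: (mulgI (slg (lm (c / (a ^+ 2 - 1))%R))).
  rewrite mulKVg slg_lmM; congr (slg (lm _)).
  by rewrite -{2}[c](mulfVK d0'); set x := (_ / _)%R; ring.
by rewrite mem_commg ?slg_G ?lm_sl ?tm_sl.
Qed.

(* A p-group fixes a nonzero row vector of K^2. *)
Lemma SL2_pgroup_conj p (Q : {group {'GL_2[K]}}) : p \in [pchar K]%R ->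
  Q \subset SL2 K -> p.-group Q ->
  exists2 k, k \in SL2 K & forall x, x \in Q -> exists b, x ^ k = slg (um b).
Proof.
move=> pK sQG pQ.
pose to (v : 'rV[K]_2) (x : {'GL_2[K]}) : 'rV[K]_2 := (v *m GLval x)%R.
have to1 : to^~ 1 =1 id by move=> v; rewrite /to /= mulmx1.
have toM v x y : to v (x * y) = to (to v x) y by rewrite /to GL_MxE mulmxA.
pose act := TotalAction to1 toM.
have actsQ : [acts Q, on [set: 'rV[K]_2] | act] by apply/actsP => x _ v; rewrite !inE.
have p_pr : prime p := pcharf_prime pK.
have fixQ : #|'Fix_([set: 'rV[K]_2] | act)(Q)| = 0 %[mod p].
  rewrite -(pgroup_fix_mod pQ actsQ) cardsT card_mx mul1n; apply/eqP.
  by rewrite mod0n -/(p %| #|K| ^ 2) Euclid_dvdX // andbT (dvdn_pcharf pK) natr_card_eq0.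
have [v [v0 vQ]] : exists v : 'rV[K]_2, v != 0%R /\ forall x, x \in Q -> (v *m GLval x = v)%R.
  have : ~~ ('Fix_([set: 'rV[K]_2] | act)(Q) \subset [set 0%R]).
    apply/negP => s0; have : #|'Fix_([set: 'rV[K]_2] | act)(Q)| = 1%N.
      apply/eqP; rewrite eqn_leq (leq_trans (subset_leq_card s0)) ?cards1 //=.
      apply/card_gt0P; exists 0%R; apply/setIP; split; first by rewrite inE.
      apply/afixP => x xQ.
      by rewrite /= /to mul0mx.
    move=> c1; move: fixQ; rewrite c1 => /eqP; rewrite mod0n -/(dvdn p 1) dvdn1 => /eqP p1.
    by rewrite p1 in p_pr.
  case/subsetPn => v /setIP[_ /afixP vQ]; rewrite inE => v0.
  by exists v; split=> // x /vQ.
have [k ks kv] : exists2 k, k \in @sl2 K & forall g, (v *m g = v)%R -> row 1%R (k *m g)%R = row 1%R k.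
  have vE a b g : (v *m g = v)%R -> row 1%R (mx2 a b (v 0 0)%R (v 0 1)%R *m g)%R
      = row 1%R (mx2 a b (v 0 0)%R (v 0 1)%R).
    have -> : row 1%R (mx2 a b (v 0 0)%R (v 0 1)%R *m g)%R = (v *m g)%R.
      rewrite row_mul; congr (_ *m _)%R; apply/rowP => j; rewrite !mxE.
      by case: (ord2P j) => ->.
    by move=> ->; apply/rowP => j; rewrite !mxE; case: (ord2P j) => ->.
  have [v1|v1] := eqVneq (v 0 1)%R 0%R.
    have v00 : (v 0 0 != 0)%R.
      apply: contraNneq v0 => v00; apply/eqP/rowP => j; rewrite mxE.
      by case: (ord2P j) => ->.
    exists (mx2 0 (- (v 0 0)^-1) (v 0 0) (v 0 1))%R; last exact: vE.
    by rewrite sl2E mul0r sub0r mulNr opprK mulVf.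
  exists (mx2 (v 0 1)^-1 0 (v 0 0) (v 0 1))%R; last exact: vE.
  by rewrite sl2E mulVf // mul0r subr0.
exists (slg k)^-1; first by rewrite groupV slg_G.
move=> x xQ; rewrite conjgE invgK; have xG := subsetP sQG x xQ.
pose h := GLval (slg k * (x * (slg k)^-1)).
have hs : h \in @sl2 K by apply: GLval_sl2; rewrite !groupM ?groupV ?slg_G.
have hk : (h *m k = k *m GLval x)%R.
  rewrite -[in LHS](slgE ks) /h -GL_MxE -!mulgA mulVg mulg1 GL_MxE slgE //.
have ku : k \in unitmx by move: ks; rewrite unitmxE inE => /eqP->; apply: unitr1.
have h1 : row 1%R h = row 1%R 1%:M.
  apply: (can_inj (mulmxK ku)); rewrite -!row_mul hk mul1mx; exact: kv (vQ x xQ).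
have h10 : (h 1 0 = 0)%R by move/rowP/(_ 0%R): h1; rewrite mxE => ->; rewrite !mxE.
have h11 : (h 1 1 = 1)%R by move/rowP/(_ 1%R): h1; rewrite mxE => ->; rewrite !mxE.
exists (h 0 1)%R; rewrite -[LHS]slgK -/h; congr slg; rewrite [LHS]mx2E h10 h11; congr mx2.
by move: hs; rewrite {1}[h]mx2E sl2E h10 h11 mulr1 mulr0 subr0 => /eqP.
Qed.

Lemma sl2_sqr (g : 'M[K]_2) : g \in sl2 -> (g *m g = \tr g *: g - 1%:M)%R.
Proof.
rewrite [g]mx2E tr_mx2 sl2E; move: (g 0 0)%R (g 0 1)%R (g 1 0)%R (g 1 1)%R.
move=> p u r s /eqP ad; rewrite mx2M [RHS]mx2E !mxE /=; rewrite -!ad.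
by congr mx2; ring.
Qed.

Lemma sl2_scalar (g : 'M[K]_2) : g \in sl2 -> (g 0 1 = 0)%R -> (g 1 0 = 0)%R ->
  (g 0 0 = g 1 1)%R -> g = 1%:M%R \/ g = tm (-1)%R.
Proof.
move=> gs g01 g10 g11; move: gs; rewrite [g]mx2E sl2E g01 g10 -g11 mulr0 subr0 -expr2.
rewrite -[X in _ == X](expr1n _ 2) eqf_sqr => /orP[]/eqP->; first by left; rewrite mx2_1.
by right; rewrite /tm invrN1.
Qed.

(** By Cayley-Hamilton the trace times [x] is the scalar 2, so [x] is scalar. *)
Lemma SL2_involution (x : {'GL_2[K]}) : x \in SL2 K -> x ^+ 2 = 1 -> (2 != 0 :> K)%R ->
  x = 1 \/ x = slg (tm (-1)%R).
Proof.
move=> xG x2 K2; have xs := GLval_sl2 xG.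
have gg : (GLval x *m GLval x = 1%:M)%R by rewrite -GL_MxE -[x * x]/(x ^+ 2) x2 GL_1E.
have := sl2_sqr xs; rewrite gg => /eqP; rewrite eq_sym subr_eq => /eqP tg.
have t i j : (\tr (GLval x) * GLval x i j = (1%:M + 1%:M : 'M[K]_2) i j)%R.
  by rewrite -tg mxE.
have t0 : (\tr (GLval x) != 0)%R.
  apply: contraNneq K2 => t0; have := t 0%R 0%R; rewrite t0 mul0r !mxE /= => ->.
  exact: eqxx.
have [] := sl2_scalar xs.
- by apply: (mulfI t0); rewrite t !mxE /= addr0 mulr0.
- by apply: (mulfI t0); rewrite t !mxE /= addr0 mulr0.
- by apply: (mulfI t0); rewrite !t !mxE.
- by move=> g1; left; rewrite -[x]slgK g1 slg1.
- by move=> g1; right; rewrite -[x]slgK g1.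
Qed.

(** Over an algebraic closure, an eigenvector of a nonscalar element of [A] spans its eigenspace, so
    all of [A] has it as eigenvector. The eigenvalue is a faithful character of [A] with values in a
    field. *)
Lemma SL2_abelian_cyclic r (A : {group {'GL_2[K]}}) :
  odd r -> prime r -> r \notin [pchar K]%R -> A \subset SL2 K -> r.-group A ->
  abelian A -> cyclic A.
Proof.
move=> oddr r_pr rK sAG rA abA.
have [A1|/trivgPn[x xA x1]] := eqVneq (gval A) 1; first by rewrite A1 cyclic1.
have xG := subsetP sAG x xA; have xs := GLval_sl2 xG.
have xN : ~ [/\ GLval x 0 1 = 0, GLval x 1 0 = 0 & GLval x 0 0 = GLval x 1 1]%R.
  case=> g01 g10 g11; have x2 : x ^+ 2 = 1.
    case: (sl2_scalar xs g01 g10 g11) => g; rewrite -[x]slgK g ?slg1 ?expg1n //.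
    have n0 : (-1 != 0 :> K)%R by rewrite oppr_eq0 oner_eq0.
    by rewrite expgS expg1 -slgM ?tm_sl // tmM mulrNN mulr1 tm1 slg1.
  have /eqP : #[x] = 1%N.
    have : #[x] %| 2 by rewrite order_dvdn x2.
    have : odd #[x].
      by apply: dvdn_odd (order_dvdG xA) _; apply: odd_pgroup_odd rA.
    by case: #[x] => [|[|[|k]]] // _ /dvdn_leq.
  by rewrite order_eq1 (negPf x1).
have [L [toL _]] := countable_algebraic_closure K.
have one0 : 1%:M%R != 0%R :> 'M[L]_2 by exact: matrix_nonzero1.
pose m (e : {'GL_2[K]}) : 'M[L]_2 := map_mx toL (GLval e).
have mM (e e' : {'GL_2[K]}) : (m (e * e')%g = m e *m m e')%R by rewrite /m GL_MxE map_mxM.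
have [v [v0 _] [l vl]] := closed_eigenvector (X := m x) one0 (submx1 _).
have mult e : e \in A -> exists c, (v *m m e = c *: v)%R.
  move=> eA; have [u uE] : exists u, u = (v *m m e)%R by eexists.
  have ul : (u *m m x = l *: u)%R.
    rewrite uE -mulmxA -mM (centsP abA _ eA _ xA) mM mulmxA vl.
    by rewrite -scalemxAl.
  rewrite -uE; have [c0|c0] := eqVneq (v 0 0 * u 0 1 - v 0 1 * u 0 0)%R 0%R.
    have /rV0Pn[j vj] := v0; exists (u 0 j / v 0 j)%R; apply/rowP => i; rewrite mxE.
    apply: (mulIf vj); rewrite mulrAC mulfVK //; move/eqP: c0; rewrite subr_eq0 => /eqP c0.
    rewrite [LHS]mulrC [RHS]mulrC; case: (ord2P i) => ->; case: (ord2P j) => ->//.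
  pose M := mx2 (v 0 0)%R (v 0 1)%R (u 0 0)%R (u 0 1)%R.
  have Mu : M \in unitmx by rewrite unitmxE det_mx2 unitfE.
  have rM (w : 'rV[L]_2) : (w *m m x = l *: w)%R -> forall j,
      (w 0 0 * m x 0 j + w 0 1 * m x 1 j = l * w 0 j)%R.
    by move=> /rowP wl j; have := wl j; rewrite [LHS]mxE [RHS]mxE sum_ord2.
  have mxl : m x = l%:M%R.
    apply: (can_inj (mulKmx Mu)); rewrite mul_mx_scalar; apply/matrixP => i j.
    rewrite [LHS]mxE sum_ord2 [RHS]mxE ![M _ _]mxE.
    by case: (ord2P i) => ->; rewrite /= rM //; case: (ord2P j) => ->.
  case: xN; split; apply: (fmorph_inj toL).
  - by move/matrixP/(_ 0%R 1%R): mxl; rewrite !mxE rmorph0.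
  - by move/matrixP/(_ 1%R 0%R): mxl; rewrite !mxE rmorph0.
  - have /matrixP ml := mxl; have := ml 0%R 0%R; have := ml 1%R 1%R.
    by rewrite !mxE /= => -> ->.
have /rV0Pn[j vj] := v0.
pose chi e := ((v *m m e) 0 j / v 0 j)%R.
have chiE e : e \in A -> (v *m m e = chi e *: v)%R.
  by case/mult => c vc; rewrite /chi vc mxE mulfK.
apply: (field_mul_group_cyclic (f := chi)) => [e e' eA e'A|e eA].
  have := chiE _ (groupM eA e'A); rewrite mM mulmxA !chiE // -scalemxAl chiE // scalerA.
  by move/rowP/(_ j); rewrite [LHS]mxE [RHS]mxE => /(mulIf vj) <-.
split=> [c1|->]; last by rewrite /chi /m GL_1E map_mx1 mulmx1 divff.
have eG := subsetP sAG e eA; have es := GLval_sl2 eG.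
have ve : (v *m (m e - 1%:M) = 0)%R by rewrite mulmxBr mulmx1 chiE // c1 scale1r subrr.
(* Eigenvalue 1 and determinant 1 give trace 2, so [N] squares to 0 and [e ^+ i] is [1 + i N]; the
   order of [e], a power of [r], is invertible in [K]. *)
have tr2 : (\tr (GLval e) = 2)%R.
  have d0 : (\det (GLval e - 1%:M) = 0)%R.
    apply: (fmorph_inj toL); rewrite rmorph0 -det_map_mx map_mxB map_mx1.
    apply/eqP; apply: contraTT v0 => d0; rewrite negbK; apply/eqP.
    have du : (m e - 1%:M)%R \in unitmx by rewrite unitmxE unitfE.
    by apply: (can_inj (mulmxK du)); rewrite ve mul0mx.
  move: d0 es; rewrite [GLval e]mx2E tr_mx2 sl2E -mx2_1.
  move: (GLval e 0 0)%R (GLval e 0 1)%R (GLval e 1 0)%R (GLval e 1 1)%R => p u q s.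
  have -> : (mx2 p u q s - mx2 1 0 0 1 = mx2 (p - 1) u q (s - 1))%R.
    by rewrite [LHS]mx2E !mxE /= !subr0.
  rewrite det_mx2 => d0 /eqP ad; apply/eqP; rewrite eq_sym -subr_eq0 -d0; apply/eqP.
  by rewrite -[X in (X + 1 - _)%R]ad; ring.
pose N := (GLval e - 1%:M)%R.
have NN : (N *m N = 0)%R.
  have a3 : (GLval e + GLval e - 1%:M - GLval e = GLval e - 1%:M)%R by rewrite addrAC addrK.
  by rewrite mulmxBl !mulmxBr mulmx1 !mul1mx sl2_sqr // tr2 scaler_nat mulr2n a3 subrr.
have eN i : (GLval (e ^+ i) = 1%:M + i%:R *: N)%R.
  elim: i => [|i IH]; first by rewrite expg0 GL_1E scale0r addr0.
  rewrite expgSr GL_MxE IH; have -> : (GLval e = 1%:M + N)%R by rewrite /N addrC subrK.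
  by rewrite mulmxDl mul1mx mulmxDr mulmx1 -scalemxAl NN scaler0 addr0 -addrA mulrS scalerDl scale1r.
have /eqP : ((#[e])%:R *: N = 0)%R.
  by have := eN #[e]; rewrite expg_order GL_1E -[LHS]addr0 => /addrI.
rewrite scaler_eq0 => /orP[/eqP o0|/eqP N0]; last first.
  by apply: GLval_inj; rewrite GL_1E; apply/eqP; rewrite -subr_eq0; apply/eqP.
have [k oe] := p_natP (mem_p_elt rA eA).
move: rK o0; rewrite oe natrX inE r_pr /= => rn /eqP; rewrite expf_eq0 (negPf rn) andbF.
by [].
Qed.

End SL2Group.

Lemma prime_field_nat (K : finFieldType) (x : K) : prime #|K| ->
  exists2 m, (m < #|K|)%N & x = (m%:R)%R.
Proof.
move=> pr; have : x \in <[1%R : K]>%g.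
  suff -> : <[1%R : K]> = [set: K] by rewrite inE.
  apply/eqP; rewrite eqEcard subsetT /= cardsT.
  have : #[1%R : K]%g %| #|K| by rewrite -cardsT order_dvdG ?inE.
  move=> dv; have /primeP[_ H] := pr; have := H _ dv.
  rewrite /= order_eq1 => /orP[|/eqP o1]; last by rewrite -[X in X <= _]o1.
  by rewrite -[X in _ == X]/(0%R : K) oner_eq0.
case/cycleP => m ->; rewrite zmodXgE.
exists (m %% #|K|); first by rewrite ltn_mod prime_gt0.
rewrite {1}(divn_eq m #|K|) mulrnDr mulnC mulrnA natr_card_eq0 mul0rn add0r //.
Qed.

Lemma poly_nonroot (K : finFieldType) (s : seq K) :
  (0 < size s <= #|K|)%N -> (last 1 s != 0)%R -> exists c, (horner_rec s c != 0)%R.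
Proof.
move=> /andP[s0 sK] sl; have [/existsP //|] := boolP [exists c, horner_rec s c != 0]%R.
rewrite negb_exists => /forallP H; exfalso; have PK := PolyK sl.
have P0 : (Poly s != 0)%R by rewrite -size_poly_eq0 PK -lt0n.
have rP : all (root (Poly s)) (enum K).
  by apply/allP => c _; have := H c; rewrite negbK rootE horner_Poly.
have := max_poly_roots P0 rP (enum_uniq K); rewrite -cardE PK => /leq_trans/(_ sK).
by rewrite ltnn.
Qed.

(* In odd characteristic, s = 2c/(1 + c^2) and t = (1 - c^2)/(1 + c^2) for a suitable c. *)
Lemma unit_sum_of_squares (K : finFieldType) :
  (2 = 0 :> K)%R /\ (4 < #|K|)%N \/ (2 != 0 :> K)%R /\ (13 < #|K|)%N ->
  exists s t : K, [/\ s != 0, t != 0, s ^+ 2 + t ^+ 2 = 1 & (s * t) ^+ 2 != 1]%R.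
Proof.
case=> [[K2 q4]|[K2 q13]].
  (* Square roots of [c] and [1 - c] will do, off the roots of a polynomial with five coefficients;
     whence [4 < #|K|]. *)
  have [|/=|c] := @poly_nonroot K [:: 0; -1; 2; -2; 1]%R; rewrite ?oner_eq0 //=.
  have -> : (((((0 * c + 1) * c - 2) * c + 2) * c - 1) * c + 0 =
      c * (c - 1) * (c ^+ 2 - c + 1))%R by ring.
  rewrite !mulf_eq0 !negb_or subr_eq0 => /andP[/andP[c0 c1] c2].
  have [s sE] := char2_all_squares c K2; have [t tE] := char2_all_squares (1 - c)%R K2.
  exists s, t; split.
  - by apply: contraNneq c0 => s0; rewrite sE s0 expr0n.
  - by rewrite eq_sym -subr_eq0 tE sqrf_eq0 in c1.
  - by rewrite -sE -tE addrC subrK.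
  - rewrite exprMn -sE -tE -subr_eq0; apply: contraNneq c2 => e.
    by rewrite -oppr_eq0 -[X in _ == X]e; apply/eqP; ring.
(* This polynomial has degree 13, whence [13 < #|K|]; its factors keep [s], [t] and the denominator
   nonzero and [(s * t) ^+ 2] different from 1. *)
have [|/=|c] := @poly_nonroot K [:: 0; 1; 0; 0; 0; 13; 0; 0; 0; -13; 0; 0; 0; -1]%R.
- exact: q13.
- by rewrite oppr_eq0 oner_eq0.
have -> : horner_rec [:: 0; 1; 0; 0; 0; 13; 0; 0; 0; -13; 0; 0; 0; -1]%R c =
  (c * (1 + c ^+ 2) * (1 - c ^+ 2) *
    ((1 + c ^+ 2) ^+ 4 - 4%:R * (c ^+ 2 * (1 - c ^+ 2) ^+ 2)))%R by rewrite /=; ring.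
rewrite !mulf_eq0 !negb_or => /andP[/andP[/andP[c0 c1] c2] c3].
exists (2 * c / (1 + c ^+ 2))%R, ((1 - c ^+ 2) / (1 + c ^+ 2))%R; split.
- by rewrite !mulf_neq0 ?invr_eq0.
- by rewrite mulf_neq0 ?invr_eq0.
- by field.
rewrite -subr_eq0; apply: contraNneq c3 => e.
rewrite -[X in X == _]opprK -[X in (- X)%R](mulfVK (expf_neq0 4 c1)) oppr_eq0 mulf_eq0.
apply/orP; left; rewrite -[X in _ == X]e; apply/eqP; field; exact: c1.
Qed.

(** * Commutators of lifts of unipotent elements *)

Section UnipotentCommutator.

Variables (K : finFieldType) (gT : finGroupType) (E : {group gT}).
Variable f : {morphism E >-> {'GL_2[K]}}.
Hypothesis fE : f @* E = SL2 K.
Hypothesis kerZ : 'ker f \subset 'Z(E).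
Hypothesis Kbig : prime #|K| \/
  ((2 = 0 :> K)%R /\ (4 < #|K|)%N \/ (2 != 0 :> K)%R /\ (13 < #|K|)%N).

Let lift_ex (x : {'GL_2[K]}) : x \in SL2 K -> exists2 X, X \in E & f X = x.
Proof. by rewrite -fE => /morphimP[X XE _ ->]; exists X. Qed.

Lemma central_ext_unipotent_commute X Y a b : X \in E -> Y \in E ->
  f X = slg (um a) -> f Y = slg (um b) -> commute X Y.
Proof.
move=> XE YE fX fY.
have /fin_all_exists2[L LE fL] : forall a : K, exists2 X, X \in E & f X = slg (um a).
  by move=> a'; apply: lift_ex; rewrite slg_G // um_sl.
pose c x y := [~ L x, L y].
have cE x y U V : U \in E -> V \in E -> f U = slg (um x) -> f V = slg (um y) -> [~ U, V] = c x y.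
  by move=> UE VE fU fV; apply: (central_ext_commg kerZ); rewrite ?fL.
have ck x y : c x y \in 'ker f.
  apply/kerP; first by rewrite groupR.
  by rewrite morphR // !fL; apply/eqP/commgP; rewrite /commute !slg_umM addrC.
have cC x y g : g \in E -> commute (c x y) g.
  by move=> gE; have /centerP[_] := subsetP kerZ _ (ck x y); apply.
have cDl x x' y : c (x + x')%R y = c x y * c x' y.
  rewrite -(cE _ _ (L x * L x') (L y)) ?groupM // ?morphM // ?fL ?slg_umM //.
  by rewrite commMgJ; congr (_ * _); apply/conjg_fixP/commgP/cC.
have cV x y : c x y = (c y x)^-1 by rewrite invg_comm.
have cDr x y y' : c x (y + y')%R = c x y * c x y'.
  rewrite cV cDl invMg -!cV; apply: cC; exact: (subsetP (subsetIl _ _) _ (ck _ _)).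
have cT s x y : (s != 0)%R -> c (s ^+ 2 * x)%R (s ^+ 2 * y)%R = c x y.
  move=> s0; have ti : (s^-1 != 0)%R by rewrite invr_eq0.
  have [T TE fT] := lift_ex (slg_G (tm_sl ti)).
  rewrite -(cE _ _ (L x ^ T) (L y ^ T)) ?groupJ //; first last.
  - by rewrite morphJ // fL fT slg_um_tm // exprVn invrK.
  - by rewrite morphJ // fL fT slg_um_tm // exprVn invrK.
  by rewrite -conjRg; apply/conjg_fixP/commgP/cC.
suff c1 x y : c x y = 1.
  by apply/commgP; rewrite (cE a b) // c1.
have cnl m x' y' : c (x' *+ m)%R y' = c x' y' ^+ m.
  elim: m => [|m IH]; last by rewrite mulrS cDl IH expgS.
  apply: (mulgI (c x' y')); rewrite mulr0n -cDl addr0 expg0 mulg1 //.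
case: Kbig => [pr|/unit_sum_of_squares[s [t [s0 t0 st1 st2]]]].
  (* Over a prime field biadditivity reduces everything to [c 1 1], the commutator of an element
     with itself. *)
  have [[m _ ->] [k _ ->]] := (prime_field_nat x pr, prime_field_nat y pr).
  rewrite cnl cV cnl.
  have -> : c 1%R 1%R = 1 by rewrite /c; apply/eqP/commgP.
  by rewrite expg1n invg1 expg1n.
have sw u x' y' : (u != 0)%R -> c (u ^+ 2 * x')%R y' = c x' ((u ^+ 2)^-1 * y')%R.
  move=> u0; have u20 : (u ^+ 2 != 0)%R by rewrite expf_neq0.
  by rewrite -{1}(mulVKf u20 y') cT.
(* Splitting [x'] by [s ^+ 2 + t ^+ 2 = 1] and moving the squares to the second argument multiplies
   [y'] by [s ^- 2 + t ^- 2], which is [(s * t) ^- 2]. *)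
have key x' y' : c x' y' = c ((s * t) ^+ 2 * x')%R y'.
  have st0 : (s * t != 0)%R by rewrite mulf_neq0.
  rewrite sw // -{1}[x']mul1r -st1 mulrDl cDl !sw // -cDr -mulrDl.
  congr (c _ (_ * _)%R).
  by rewrite -(mulr1 ((s * t) ^+ 2)^-1)%R -[X in _ = (_ * X)%R]st1; field; rewrite s0 t0.
have d0 : ((s * t) ^+ 2 - 1 != 0)%R by rewrite subr_eq0.
rewrite -(mulVKf d0 x); set x' := (_^-1 * x)%R.
apply: (mulIg (c x' y)); rewrite -cDl mul1g [RHS]key.
by congr (c _ _); ring.
Qed.

End UnipotentCommutator.

Section SL2Sylow.

Variable K : finFieldType.

(** A noncyclic group of odd prime power order would contain a noncyclic elementary abelian
    subgroup. *)
Lemma SL2_odd_pgroup_cyclic r (Q : {group {'GL_2[K]}}) :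
  odd r -> prime r -> r \notin [pchar K]%R -> Q \subset SL2 K -> r.-group Q -> cyclic Q.
Proof.
move=> oddr r_pr rK sQG rQ; rewrite (odd_pgroup_rank1_cyclic rQ) ?(odd_pgroup_odd oddr rQ) //.
rewrite leqNgt; apply/negP => /p_rank_geP[A /pnElemP[sAQ abA logA]].
have rA := abelem_pgroup abA.
have cA : cyclic A.
  by apply: (SL2_abelian_cyclic oddr r_pr rK (subset_trans sAQ sQG) rA); apply: abelem_abelian abA.
have := abelem_cyclic abA; rewrite cA logA => /esym.
by [].
Qed.

(** The only involution of SL_2 is -1. *)
Lemma SL2_2group (Q : {group {'GL_2[K]}}) :
  (2 != 0 :> K)%R -> Q \subset SL2 K -> 2.-group Q ->
  cyclic Q || (extremal_class Q == Quaternion).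
Proof.
move=> K2 sQG pQ; have [Q1|Q1] := eqVneq (gval Q) 1; first by rewrite Q1 cyclic1.
suff /(prime_Ohm1P pQ Q1) : #|'Ohm_1(Q)| = 2 by rewrite eqxx.
have sub : 'Ohm_1(Q) \subset <[slg (tm (-1)%R) : {'GL_2[K]}]>.
  rewrite (OhmE 1 pQ) gen_subG; apply/subsetP => x; rewrite !inE expn1 => /andP[xQ /eqP x2].
  by have [->|->] := SL2_involution (subsetP sQG x xQ) x2 K2; [exact: group1 | exact: cycle_id].
have n0 : (-1 != 0 :> K)%R by rewrite oppr_eq0 oner_eq0.
have o2 : #[slg (tm (-1)%R) : {'GL_2[K]}] %| 2.
  by rewrite order_dvdn expgS expg1 -slgM ?tm_sl // tmM mulrNN mulr1 tm1 slg1.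
have : #|'Ohm_1(Q)| %| 2 by apply: dvdn_trans o2; apply: cardSg.
have : 'Ohm_1(Q) != 1 by rewrite Ohm1_eq1.
by rewrite trivg_card1; case: #|_| => [|[|[|k]]] // _ /dvdn_leq => /(_ isT).
Qed.

End SL2Sylow.

(* For #|K| = 4 or 9 the statement fails. *)
Theorem SL2_centrally_closed (K : finFieldType) (gT : finGroupType) (E : {group gT})
    (f : {morphism E >-> {'GL_2[K]}}) :
  prime #|K| \/
    ((2 = 0 :> K)%R /\ (4 < #|K|)%N \/ (2 != 0 :> K)%R /\ (13 < #|K|)%N) ->
  [~: E, E] = E -> f @* E = SL2 K -> 'ker f \subset 'Z(E) -> 'ker f = 1.
Proof.
move=> Kbig perfE fE kerZ; apply: (perfect_central_ext_trivial kerZ perfE).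
move=> r P r_pr sylP z zP zk; have sPE := pHall_sub sylP; have rP := pHall_pgroup sylP.
have sQG : f @* P \subset SL2 K by rewrite -fE morphimS.
have rQ : r.-group (f @* P) by apply: morphim_pgroup.
have [rK|rK] := boolP (r \in [pchar K]%R).
  have [k kG kQ] := SL2_pgroup_conj rK sQG rQ.
  have : k \in f @* E by rewrite fE.
  case/morphimP => T TE _ kE.
  suff abP : abelian P by move: zP; rewrite (commG1P abP) => /set1P.
  apply/centsP => X XP Y YP; have XE := subsetP sPE X XP; have YE := subsetP sPE Y YP.
  have [a aE] := kQ _ (mem_morphim f XE XP); have [b bE] := kQ _ (mem_morphim f YE YP).
  apply: (conjg_inj T); rewrite !conjMg.
  apply: (central_ext_unipotent_commute fE kerZ Kbig (a := a) (b := b)); rewrite ?groupJ //.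
    by rewrite morphJ // -kE.
  by rewrite morphJ // -kE.
have [r2|oddr] := even_prime r_pr; last first.
  exact: (central_ext_cyclic kerZ sPE (SL2_odd_pgroup_cyclic oddr r_pr rK sQG rQ)).
rewrite r2 in rQ rK.
have K2 : (2 != 0 :> K)%R by move: rK; rewrite inE.
have /orP[cQ|/eqP/quaternion_classP[n n2 isoQ]] := SL2_2group K2 sQG rQ.
  exact: (central_ext_cyclic kerZ sPE cQ zP).
have [[x y] genQ [oy y2 xy]] := generators_quaternion n2 isoQ.
have [_ _ _ defQ _] := extremal_generators_facts (isT : prime 2) genQ.
have [_ _ ox _] := genQ.
have n1 : (1 < n.-1)%N by rewrite ltn_predRL.
exact: (central_ext_quaternion kerZ sPE n1 (esym defQ) ox y2 xy zP zk).
Qed.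

(* The derived group of the fibre product is a perfect central extension of G. *)
Lemma perfect_central_cover (aT bT cT : finGroupType) (G : {group aT}) (H : {group bT})
    (pi : {morphism G >-> cT}) (phi : {morphism H >-> cT}) :
  pi @* G = phi @* H -> 'ker phi \subset 'Z(H) -> [~: G, G] = G -> [~: H, H] = H ->
  (forall (gT : finGroupType) (E : {group gT}) (f : {morphism E >-> aT}),
     [~: E, E] = E -> f @* E = G -> 'ker f \subset 'Z(E) -> 'ker f = 1) ->
  exists psi : {morphism G >-> bT}, psi @* G = H.
Proof.
move=> piphi kphi perfG perfH closedG.
pose D := [set x : aT * bT | [&& x.1 \in G, x.2 \in H & pi x.1 == phi x.2]].
have DP x : reflect [/\ x.1 \in G, x.2 \in H & pi x.1 = phi x.2] (x \in D).
  by rewrite inE; apply: (iffP and3P) => -[? ? /eqP].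
have gD : group_set D.
  apply/group_setP; split=> [|x y /DP[x1 x2 xx] /DP[y1 y2 yy]].
    by apply/DP; rewrite /= !group1 !morph1.
  by apply/DP; rewrite /= !groupM // !morphM // xx yy.
pose DG := Group gD.
have p1M : {in DG &, {morph (fun x : aT * bT => x.1) : x y / x * y}} by [].
have p2M : {in DG &, {morph (fun x : aT * bT => x.2) : x y / x * y}} by [].
pose p1 := Morphism p1M; pose p2 := Morphism p2M.
have p1D : p1 @* DG = G.
  apply/eqP; rewrite eqEsubset; apply/andP; split; apply/subsetP => x.
    by case/morphimP => y _ /DP[y1 _ _] ->.
  move=> xG; have : pi x \in phi @* H by rewrite -piphi mem_morphim.
  case/morphimP => h hH _ xh; apply/morphimP; exists (x, h) => //; exact/DP.
have p2D : p2 @* DG = H.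
  apply/eqP; rewrite eqEsubset; apply/andP; split; apply/subsetP => x.
    by case/morphimP => y _ /DP[_ y2 _] ->.
  move=> xH; have : phi x \in pi @* G by rewrite piphi mem_morphim.
  case/morphimP => g gG _ xg; apply/morphimP; exists (g, x) => //; apply/DP; split=> //.
pose E := [~: DG, DG]%G.
have sED : E \subset DG by rewrite commg_subl normG.
have p1E : p1 @* E = G by rewrite morphimR // p1D.
have p2E : p2 @* E = H by rewrite morphimR // p2D.
have k1 : 'ker p1 \subset 'Z(DG).
  apply/subsetP => x /morphpreP[/DP[x1 x2 xx] /set1P x10].
  have : x.2 \in 'Z(H).
    by apply: (subsetP kphi); apply/kerP; rewrite // -xx [x.1]x10 morph1.
  case/centerP => _ zx; apply/centerP; split; first exact/DP.
  move=> y /DP[_ y2 _]; rewrite /commute [x]surjective_pairing [y]surjective_pairing.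
  by congr (_, _); rewrite /= ?zx // [x.1]x10 mul1g mulg1.
have perfE : [~: E, E] = E.
  apply/eqP; rewrite eqEsubset commg_subl normG /= gen_subG.
  apply/subsetP => _ /imset2P[x y xD yD ->].
  have lift u : u \in DG -> exists2 e, e \in E & p1 u = p1 e.
    move=> uD; have : p1 u \in p1 @* E by rewrite p1E -p1D mem_morphim.
    by case/morphimP => e _ eE ->; exists e.
  have [[e eE ee] [e' e'E ee']] := (lift x xD, lift y yD).
  have /= -> := central_ext_commg k1 xD (subsetP sED e eE) yD (subsetP sED e' e'E) ee ee'.
  exact: mem_commg.
have p1EM : {in E &, {morph (fun x : aT * bT => x.1) : x y / x * y}} by [].
pose f := Morphism p1EM.
have fE : f @* E = G.
  rewrite -p1E; apply/setP => x; apply/morphimP/morphimP => -[y yE yE' ->]; exists y => //.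
  exact: (subsetP sED).
have kf : 'ker f \subset 'Z(E).
  apply/subsetP => u /morphpreP[uE /set1P u1].
  have /centerP[_ uC] : u \in 'Z(DG).
    by apply: (subsetP k1); apply/morphpreP; split; [apply: (subsetP sED)|apply/set1P].
  by apply/centerP; split=> // y /(subsetP sED); apply: uC.
have injf : 'injm f by rewrite (closedG _ _ _ perfE fE kf).
have dom : G \subset f @* E by rewrite fE.
have psiM : {in G &, {morph (fun g => p2 (invm injf g)) : x y / x * y}}.
  move=> x y xG yG /=; rewrite morphM ?fE //.
exists (Morphism psiM); apply/setP => h; apply/morphimP/idP => [[g gG _ -> /=]|hH].
  have : g \in f @* E by rewrite fE.
  by case/morphimP => e _ eE ->; rewrite invmE //; case/DP: (subsetP sED e eE).
have : h \in p2 @* E by rewrite p2E.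
case/morphimP => e _ eE ->; have feG : f e \in G by rewrite -fE mem_morphim.
by exists (f e) => //=; rewrite invmE.
Qed.

Theorem SL2_cover (K : finFieldType) (gT : finGroupType) (H : {group gT}) :
  (3 < #|K|)%N -> prime #|K| \/
    ((2 = 0 :> K)%R /\ (4 < #|K|)%N \/ (2 != 0 :> K)%R /\ (13 < #|K|)%N) ->
  [~: H, H] = H -> H / 'Z(H) \isog PSL2 K ->
  exists psi : {morphism SL2_group K >-> gT}, psi @* SL2_group K = H.
Proof.
move=> q3 Kbig perfH /isogP[g injg gE].
have nG : SL2_group K \subset 'N('Z(SL2 K)) by apply: normal_norm; apply: center_normal.
have nH : H \subset 'N('Z(H)) by apply: normal_norm; apply: center_normal.
have cM : {in H &, {morph (fun h => g (coset 'Z(H) h)) : x y / x * y}}.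
  by move=> x y xH yH /=; rewrite morphM ?(subsetP nH) // morphM // mem_quotient.
pose pi := restrm nG (coset 'Z(SL2 K)); pose phi := Morphism cM.
apply: (@perfect_central_cover _ _ _ (SL2_group K) H (restrm_morphism nG (coset_morphism 'Z(SL2 K))) phi).
- transitivity (g @* (H / 'Z(H))); first by rewrite gE morphim_restrm setIid.
  apply/setP => x; apply/morphimP/morphimP => [[y yH _ ->]|[h hH _ ->]].
    by case/morphimP: yH => h nh hH ->; exists h.
  by exists (coset 'Z(H) h); rewrite ?mem_quotient.
- apply/subsetP => h /morphpreP[hH /set1P gh].
  have ch : coset 'Z(H) h = 1.
    by apply: (injmP injg); rewrite ?mem_quotient ?group1 // morph1.
  by apply: coset_idr ch; apply: (subsetP nH).
- exact: SL2_perfect.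
- exact: perfH.
by move=> hT E f; apply: SL2_centrally_closed.
Qed.

(** * Covers of PSL2(K) in the family *)

Lemma natr_eq_mod (R : nzRingType) p m n : p \in [pchar R]%R ->
  (m%:R = n%:R :> R)%R -> m = n %[mod p].
Proof.
move=> pR; wlog le_nm : m n / (n <= m)%N.
  by move=> W; case: (leqP n m) => [|/ltnW] le e; [exact: W | exact/esym/W].
move=> e; apply/eqP; rewrite eqn_mod_dvd // (dvdn_pcharf pR) natrB // e subrr.
by [].
Qed.

(** If [G / 'Z(G)] is perfect, then [G] is the product of its center and its derived subgroup. *)
Lemma quotient_center_perfect_hom (aT bT : finGroupType) (G : {group aT})
    (f : {morphism G >-> bT}) :
  [~: G / 'Z(G), G / 'Z(G)] = G / 'Z(G) -> abelian (f @* G) ->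
  'Z(G) \subset 'ker f -> f @* G = 1.
Proof.
move=> perf abf Zf.
have nZ : G \subset 'N('Z(G)) by apply: normal_norm; apply: center_normal.
have sG'f : [~: G, G] \subset 'ker f.
  have sG' : [~: G, G] \subset G by rewrite commg_subl normG.
  by rewrite ker_trivg_morphim sG' morphimR // (commG1P abf) subxx.
have : G \subset 'Z(G) * [~: G, G].
  by rewrite -quotientSK // quotientR // perf.
move=> sG; have : G \subset 'ker f by apply: subset_trans sG (mul_subG Zf sG'f).
by rewrite ker_trivg_morphim => /andP[_ /trivgP].
Qed.

(** [chi], as a function of the entries, is a homomorphism from SL_2 to the additive group of [K],
    trivial on the center but not at [um 1]. It serves to exclude [q = 2] and [q = 3]. *)
Lemma SL2_additive_not_perfect (K : finFieldType) (chi : K -> K -> K -> K -> K) :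
  (forall a b c d a' b' c' d', a * d - b * c = 1 -> a' * d' - b' * c' = 1 ->
     chi (a * a' + b * c') (a * b' + b * d') (c * a' + d * c') (c * b' + d * d')
     = chi a b c d + chi a' b' c' d')%R ->
  (forall a d, chi a 0 0 d = 0)%R -> (chi 1 1 0 1 != 0)%R ->
  [~: PSL2 K, PSL2 K] <> PSL2 K.
Proof.
move=> chiD chi0 chi1 perf.
pose f (x : {'GL_2[K]}) : K :=
  chi (GLval x 0 0)%R (GLval x 0 1)%R (GLval x 1 0)%R (GLval x 1 1)%R.
have mxM (A B : 'M[K]_2) i j : ((A *m B) i j = A i 0 * B 0 j + A i 1 * B 1 j)%R.
  by rewrite mxE sum_ord2.
have det x : x \in SL2 K -> (GLval x 0 0 * GLval x 1 1 - GLval x 0 1 * GLval x 1 0 = 1)%R.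
  by move/GLval_sl2; rewrite {1}[GLval x]mx2E sl2E => /eqP.
have fM : {in SL2_group K &, {morph f : x y / x * y}}.
  move=> x y xG yG; rewrite /f GL_MxE !mxM.
  exact: chiD (det x xG) (det y yG).
have := @quotient_center_perfect_hom _ _ _ (Morphism fM) perf.
have -> : abelian (Morphism fM @* SL2_group K) by apply/centsP => x _ y _; exact: addrC.
have -> : 'Z(SL2_group K) \subset 'ker (Morphism fM).
  apply/subsetP => z /centerP[zG zC]; apply/kerP => //=.
  have eq0 g : g \in @sl2 K -> (GLval z *m g = g *m GLval z)%R.
    by move=> gs; have := zC (slg g) (slg_G gs) => /(congr1 (@GLval 2 K)); rewrite !GL_MxE slgE.
  have := eq0 _ (um_sl 1%R) => /matrixP E1; have := eq0 _ (lm_sl 1%R) => /matrixP E2.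
  have c0 : (GLval z 1 0 = 0)%R.
    have := E1 0%R 0%R; rewrite !mxM !mxE /= !mulr0 !mulr1 !mul1r addr0.
    by move/eqP; rewrite -subr_eq0 opprD addNKr oppr_eq0 => /eqP.
  have b0 : (GLval z 0 1 = 0)%R.
    have := E2 0%R 0%R; rewrite !mxM !mxE /= !mul0r !mulr1 !mul1r addr0.
    by move/eqP; rewrite -subr_eq0 addrC addKr => /eqP.
  by rewrite /f c0 b0 chi0.
move=> /(_ isT isT) f1; have uG := slg_G (um_sl (1%R : K)).
have : f (slg (um 1%R)) \in Morphism fM @* SL2_group K by apply: (mem_morphim (Morphism fM)).
rewrite f1 => /set1P; rewrite /f slgE ?um_sl // !mxE /= => /eqP.
by apply/negP.
Qed.

Lemma PSL2_perfect_gt3 (K : finFieldType) : [~: PSL2 K, PSL2 K] = PSL2 K -> (3 < #|K|)%N.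
Proof.
move=> perf; rewrite ltnNge; apply/negP => q3.
have pr : prime #|K| by move: q3 (finNzRing_gt1 K); case: #|K| => [|[|[|[|]]]].
have pK : #|K| \in [pchar K]%R by rewrite inE pr natr_card_eq0 /=.
(* Formulas for the surjections of SL_2(2) onto Z/2 and of SL_2(3) onto Z/3, over the naturals so
   that additivity is checked by computation. *)
pose ch p a b c d := (if p == 2%N then (1 + c) * b + c * (a + d + 1)
                      else (1 + 2 * c * c) * b * d + c * (a + d))%N.
pose L p : seq (nat * nat * (nat * nat)) := [seq x <- [seq (y, z) | y <- [seq (a, b) | a <- iota 0 p, b <- iota 0 p],
    z <- [seq (a, b) | a <- iota 0 p, b <- iota 0 p]]
  | (x.1.1 * x.2.2 + (p - 1) * x.1.2 * x.2.1) %% p == 1 %% p]%N.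
have chk p : (1 < p <= 3)%N -> all (fun x => all (fun y =>
    ch p (x.1.1 * y.1.1 + x.1.2 * y.2.1) (x.1.1 * y.1.2 + x.1.2 * y.2.2)
         (x.2.1 * y.1.1 + x.2.2 * y.2.1) (x.2.1 * y.1.2 + x.2.2 * y.2.2)
    == ch p x.1.1 x.1.2 x.2.1 x.2.2 + ch p y.1.1 y.1.2 y.2.1 y.2.2 %[mod p])%N (L p)) (L p).
  by case: p => [|[|[|[|]]]] // _; vm_compute.
have {}chk := chk #|K| (introT andP (conj (finNzRing_gt1 K) q3)).
pose chi (a b c d : K) := (if #|K| == 2%N then (1 + c) * b + c * (a + d + 1)
                      else (1 + 2%:R * c * c) * b * d + c * (a + d))%R.
have chE a b c d : ((ch #|K| a b c d)%:R = chi a%:R b%:R c%:R d%:R)%R.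
  by rewrite /ch /chi; case: ifP => _; rewrite !(natrD, natrM).
apply: (@SL2_additive_not_perfect K chi) perf => [a b c d a' b' c' d'|a d|]; last first.
- rewrite /chi; case: ifP => _; last by rewrite !(mulr0, mul0r, addr0, mulr1) oner_eq0.
  by rewrite addr0 !(mul0r, addr0, mulr1) oner_eq0.
- by rewrite /chi; case: ifP => _; rewrite !(mulr0, mul0r, addr0).
have natK x := prime_field_nat x pr.
have inL (s t u v : nat) : (s < #|K| -> t < #|K| -> u < #|K| -> v < #|K| ->
    (s%:R * v%:R - t%:R * u%:R = 1 :> K)%R -> ((s, t), (u, v)) \in L #|K|)%N.
  move=> la lb lc ld dt; rewrite mem_filter /=; apply/andP; split; last first.
    by apply: allpairs_f; apply: allpairs_f; rewrite mem_iota.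
  apply/eqP/(natr_eq_mod pK); rewrite natrD !natrM natrB ?prime_gt0 // natr_card_eq0 mulr1n -[RHS]dt.
  by ring.
have [[m1 l1 e1] [m2 l2 e2]] := (natK a, natK b); have [[m3 l3 e3] [m4 l4 e4]] := (natK c, natK d).
have [[n1 k1 f1] [n2 k2 f2]] := (natK a', natK b'); have [[n3 k3 f3] [n4 k4 f4]] := (natK c', natK d').
rewrite {}e1 {}e2 {}e3 {}e4 {}f1 {}f2 {}f3 {}f4.
move=> /(inL _ _ _ _ l1 l2 l3 l4) x /(inL _ _ _ _ k1 k2 k3 k4) y.
have modE u v : u = v %[mod #|K|] -> (u%:R = v%:R :> K)%R.
  move=> E; rewrite (divn_eq u #|K|) E [in RHS](divn_eq v #|K|) !natrD !natrM natr_card_eq0.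
  by rewrite !mulr0.
rewrite -!natrM -!natrD -!chE -natrD; apply: modE.
exact/eqP/(allP (allP chk _ x) _ y).
Qed.

(** The cover is kept as a function on matrices, so that all groups over [K] share one source. *)
Definition sl2_onto (K : finFieldType) (gT : finGroupType) (H : {group gT})
    (c : 'M[K]_2 -> gT) : Prop :=
  [/\ {in sl2 &, forall g h, c (g *m h)%R = c g * c h}, {in sl2, forall g, c g \in H}
    & forall x, x \in H -> exists2 g, g \in sl2 & c g = x].

Lemma sl2_onto1 (K : finFieldType) (gT : finGroupType) (H : {group gT}) (c : 'M[K]_2 -> gT) :
  sl2_onto H c -> c (1%:M)%R = 1.
Proof.
case=> cM _ _; apply: (mulgI (c 1%:M%R)).
by rewrite -cM ?sl2_1 // mulmx1 mulg1.
Qed.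

(** * Pulling representations back to SL_2(K) *)

Section Pullback.

Variables (K : finFieldType) (F : closedFieldType) (n : nat).

Section OneGroup.
Variables (gT : finGroupType) (H : {group gT}) (c : 'M[K]_2 -> gT).
Hypothesis cH : sl2_onto H c.

Lemma pullback_rep (rH : mx_representation F H n) : sl2_rep (fun g => rH (c g)).
Proof.
case: (cH) => cM cG _; split; first by rewrite (sl2_onto1 cH) repr_mx1.
by move=> g h gs hs; rewrite cM // repr_mxM ?cG.
Qed.

Lemma pullback_airr (rH : mx_representation F H n) :
  mx_irreducible rH -> airr sl2 (fun g => rH (c g)).
Proof.
move=> irr C trC; case: (cH) => _ _ onto.
have /mx_abs_irrP[_ [a aE]] := group_closure_closed_field irr.
apply/matrixP => i j; rewrite mxE.
have tr0 A : (\tr (C *m A) = 0)%R.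
  rewrite [A]aE mulmx_sumr linear_sum big1 // => x xH.
  by have [g gs <-] := onto x xH; rewrite -scalemxAr linearZ /= trC // mulr0.
have := tr0 (delta_mx j i); rewrite /mxtrace (bigD1 i) //= big1 => [|l li].
  by rewrite mulmx_deltaE eqxx addr0.
by rewrite mulmx_deltaE (negPf li).
Qed.

Lemma pullback_not_intertwined (rH rH' : mx_representation F H n) :
  mx_irreducible rH -> mx_irreducible rH' -> ~ mx_rsim rH rH' ->
  ~ intertwined sl2 (fun g => rH (c g)) (fun g => rH' (c g)).
Proof.
move=> irr irr' nsim [B B0 rB]; apply: nsim.
have [Bfree _] := intertwined_bij (pullback_airr irr) (pullback_airr irr') B0 rB.
apply: (MxReprSim (B := B)) => // x xH.
by case: (cH) => _ _ /(_ x xH)[g gs <-]; apply: rB.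
Qed.

End OneGroup.

(** The intertwiner is invertible, so the pullbacks have the same kernel; by faithfulness this is
    the kernel of both covers. *)
Lemma pullback_intertwined_isog (gT1 gT2 : finGroupType) (H1 : {group gT1}) (H2 : {group gT2})
    (c1 : 'M[K]_2 -> gT1) (c2 : 'M[K]_2 -> gT2) (r1 : mx_representation F H1 n)
    (r2 : mx_representation F H2 n) :
  sl2_onto H1 c1 -> sl2_onto H2 c2 -> mx_irreducible r1 -> mx_irreducible r2 ->
  mx_faithful r1 -> mx_faithful r2 ->
  intertwined sl2 (fun g => r1 (c1 g)) (fun g => r2 (c2 g)) -> H1 \isog H2.
Proof.
move=> cH1 cH2 irr1 irr2 fr1 fr2 [B B0 rB].
have [Bfree Bfull] := intertwined_bij (pullback_airr cH1 irr1)
  (pullback_airr cH2 irr2) B0 rB.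
have [[c1M c1G onto1] [c2M c2G onto2]] := (cH1, cH2).
have c12 g h : g \in sl2 -> h \in sl2 -> (c1 g == c1 h) = (c2 g == c2 h).
  move=> gs hs; apply/eqP/eqP => E.
    apply: (mx_faithful_inj fr2); rewrite ?c2G //; apply: (row_full_inj Bfull).
    by rewrite -!rB // E.
  apply: (mx_faithful_inj fr1); rewrite ?c1G //; apply: (row_free_inj Bfree).
  by rewrite !rB // E.
pose f x := if [pick g : 'M[K]_2 | (g \in sl2) && (c1 g == x)] is Some g then c2 g else 1.
have fE g : g \in sl2 -> f (c1 g) = c2 g.
  move=> gs; rewrite /f; case: pickP => [h /andP[hs e]|/(_ g)]; last by rewrite gs eqxx.
  by apply/eqP; rewrite -c12.
have fM : {in H1 &, {morph f : x y / x * y}}.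
  move=> _ _ /onto1[g gs <-] /onto1[h hs <-]; rewrite -c1M // !fE ?sl2M //; exact: c2M.
apply/isogP; exists (Morphism fM).
  apply/injmP => _ _ /onto1[g gs <-] /onto1[h hs <-] /=; rewrite !fE // => e.
  by apply/eqP; rewrite c12 // e.
apply/eqP; rewrite eqEsubset; apply/andP; split; apply/subsetP => x.
  by case/morphimP => _ _ /onto1[g gs <-] -> /=; rewrite fE // c2G.
case/onto2 => g gs <-; rewrite -fE //.
by apply: (mem_morphim (Morphism fM)); rewrite ?c1G.
Qed.

End Pullback.

Lemma A1_sl2_onto (gT : finGroupType) (H : {group gT}) p k (K : finFieldType) :
  A1 H -> prime p -> (0 < k)%N -> is_PSL2 (p ^ k) (H / 'Z(H)) -> #|K| = (p ^ k)%N ->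
  [/\ (3 < #|K|)%N, #|K| \notin [:: 2; 3; 4; 5; 9]%N & exists c : 'M[K]_2 -> gT, sl2_onto H c].
Proof.
case=> [[perf _ _] _ nsmall] p_pr k0 [L cL iso] cK.
have perfP : [~: PSL2 L, PSL2 L] = PSL2 L.
  have [f _ fE] := isogP iso.
  have {}fE : f @* (H / 'Z(H)) = PSL2 L by rewrite fE.
  have nH : H \subset 'N('Z(H)) by apply: normal_norm; apply: center_normal.
  by rewrite -fE -morphimR // -quotientR // perf.
have q3 : (3 < #|K|)%N by rewrite cK -cL; apply: PSL2_perfect_gt3.
have nq : #|K| \notin [:: 2; 3; 4; 5; 9]%N.
  apply/negP; rewrite !inE => /or4P[/eqP e|/eqP e|/eqP e|/orP[]/eqP e].
  - by rewrite e in q3.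
  - by rewrite e in q3.
  - by apply: nsmall; apply: Or31; exists L => //; rewrite cL -cK e.
  - by apply: nsmall; apply: Or32; exists L => //; rewrite cL -cK e.
  - by apply: nsmall; apply: Or33; exists L => //; rewrite cL -cK e.
split=> //.
have [psi psiH] : exists psi : {morphism SL2_group L >-> gT}, psi @* SL2_group L = H.
  apply: SL2_cover; rewrite ?cL -?cK //.
  have [p2|p2] := eqVneq p 2%N.
    right; left; split; last by move: q3 nq; rewrite cK; case: (p ^ k)%N => [|[|[|[|[|]]]]].
    have := card_finPcharP cL p_pr; rewrite p2 inE => /andP[_ /eqP//].
  have [k1|k1] := eqVneq k 1%N; first by left; rewrite cK k1 expn1.
  (* An odd prime power that is neither a prime nor 9 exceeds 13: it is at least [5 ^ 2] for
     [p >= 5] and at least [3 ^ 3] for [p = 3]. *)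
  right; right; split.
    apply/eqP => e; have := card_finPcharP cL p_pr.
    move=> /dvdn_pcharf/(_ 2%N); rewrite e eqxx => /(dvdn_leq (ltn0Sn _)) le2.
    by move: p2; rewrite eqn_leq le2 prime_gt1.
  have p3 : (3 <= p)%N by rewrite ltn_neqAle eq_sym p2 prime_gt1.
  have k2 : (2 <= k)%N by rewrite ltn_neqAle eq_sym k1.
  move: nq; rewrite cK; have [p5|p5] := leqP 5 p.
    move=> _; apply: (@leq_trans (5 ^ 2)) => //.
    by apply: leq_trans (leq_pexp2l _ k2); rewrite ?leq_exp2r // (leq_trans _ p5).
  have -> : p = 3%N by move: p3 p_pr p5 {p2 cK cL iso}; case: p => [|[|[|[|[|[|]]]]]].
  have [->//|k3 _] := eqVneq k 2%N.
  apply: (@leq_trans (3 ^ 3)) => //; rewrite leq_exp2l //.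
  by rewrite ltn_neqAle eq_sym k3.
have [tau] := finField_iso (etrans cK (esym cL)).
have tauM g h : map_mx tau (g *m h)%R = (map_mx tau g *m map_mx tau h)%R by exact: map_mxM.
have tau_sl g : (map_mx tau g \in sl2) = (g \in sl2) by rewrite !inE det_map_mx fmorph_eq1.
exists (fun g => psi (slg (map_mx tau g))); split=> [g h gs hs|g gs|x].
- by rewrite tauM slgM ?tau_sl // morphM // slg_G ?tau_sl.
- by rewrite -psiH mem_morphim // slg_G ?tau_sl.
have [tau' tauK tau'K] : bijective tau.
  by apply: inj_card_bij; [exact: fmorph_inj | rewrite cK cL].
rewrite -psiH => /morphimP[y _ yG ->]; exists (map_mx tau' (GLval y)).
  rewrite -tau_sl -map_mx_comp (eq_map_mx _ tau'K) map_mx_id //; exact: GLval_sl2.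
by rewrite -map_mx_comp (eq_map_mx _ tau'K) map_mx_id // slgK.
Qed.

Section Families.

Variables (n l : nat) (F : closedFieldType) (iota : {rmorphism 'F_l -> F}).
Variables (I : Type) (gT : I -> finGroupType) (H : forall i, {group gT i}).
Hypotheses (n1 : (1 < n)%N) (l_pr : prime l).
Hypotheses (HA : forall i, A1_cross_char l (H i)) (Hinj : forall i j, H i \isog H j -> i = j).

Local Notation irrep := {i : I & mx_representation F (H i) n}.

Variables (k : nat) (x : 'I_k -> irrep).
Hypothesis xirr : forall j, mx_irreducible (tagged (x j)) /\ mx_faithful (tagged (x j)).
Hypothesis xneq : forall j j' i (a b : mx_representation F (H i) n), j != j' ->
  x j = Tagged _ a -> x j' = Tagged _ b -> ~ mx_rsim a b.

Lemma natr_pow_neq0 p e : prime p -> p <> l -> ((p ^ e)%:R != 0 :> F)%R.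
Proof.
move=> p_pr pl; rewrite natrX expf_neq0 //; apply/eqP => p0; apply: pl.
have lF : l \in [pchar F]%R by apply: rmorph_pchar iota _ _; apply: pchar_Fp.
have pF : p \in [pchar F]%R by rewrite inE p_pr p0 /=.
by have := pcharf_eq lF p; rewrite pF => /esym/eqP.
Qed.

Lemma defining_field_size i : exists q, [/\ prime_power q, is_PSL2 q (H i / 'Z(H i))
  & (q%:R != 0 :> F)%R].
Proof.
have [_ [p pl [p_pr [e e0 PSL]]]] := HA i; exists (p ^ e)%N; split=> //.
  by exists p, e.
exact: natr_pow_neq0.
Qed.

Let q i := projT1 (boolp.cid (defining_field_size i)).
Let m t := #|[set j | q (tag (x j)) == t]|.

(** All representations with field size [t] are pulled back to SL_2 of one field, where those of
    different groups stay inequivalent by [pullback_intertwined_isog]. *)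
Lemma family_table t : (0 < m t)%N ->
  [/\ prime_power t, t \notin [:: 2; 3; 4; 5; 9]%N & degree_table n t (m t)].
Proof.
move=> m0; have [j0] := card_gt0P m0; rewrite inE => /eqP qj0.
have qP i : [/\ prime_power (q i), is_PSL2 (q i) (H i / 'Z(H i))
  & ((q i)%:R != 0 :> F)%R].
  exact: (projT2 (boolp.cid (defining_field_size i))).
have [tp [K cK _] t0] := qP (tag (x j0)); rewrite qj0 in tp cK t0.
have [p [e [p_pr e0 tE]]] := tp.
have on i : q i = t -> [/\ (3 < #|K|)%N, #|K| \notin [:: 2; 3; 4; 5; 9]%N
    & exists c : 'M[K]_2 -> gT i, sl2_onto (H i) c].
  move=> qi; have [_ PSL _] := qP i; have [HAi _] := HA i.
  by apply: (A1_sl2_onto HAi p_pr e0); rewrite ?cK -?tE -?qi.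
have ex i : exists c : 'M[K]_2 -> gT i, q i = t -> sl2_onto (H i) c.
  have [/on[_ _ [c cP]]|nt] := eqVneq (q i) t; first by exists c.
  by exists (fun=> 1) => e'; rewrite e' eqxx in nt.
pose c i := projT1 (boolp.cid (ex i)).
have cP i : q i = t -> sl2_onto (H i) (c i) := projT2 (boolp.cid (ex i)).
pose A := [set j | q (tag (x j)) == t].
have [q3 nq _] := on _ (qj0); rewrite cK in nq; split=> //.
have qA (u : 'I_#|A|) : q (tag (x (enum_val u))) = t.
  by have := enum_valP u; rewrite inE => /eqP.
pose r (u : 'I_#|A|) g := tagged (x (enum_val u)) (c (tag (x (enum_val u))) g).
have rP u : sl2_rep (r u) by apply: pullback_rep (cP _ (qA u)) _.
have ri u : airr sl2 (r u).
  by apply: pullback_airr (cP _ (qA u)) _ _; case: (xirr (enum_val u)).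
have rN u v : u != v -> ~ intertwined sl2 (r u) (r v).
  move=> uv; have {}uv : enum_val u != enum_val v by apply: contra_neq uv; apply: enum_val_inj.
  rewrite /r; have [[iu fu] [iv fv]] := (xirr (enum_val u), xirr (enum_val v)).
  have ne i a b := @xneq _ _ i a b uv; have := (qA u, qA v); move: ne iu fu iv fv.
  move: (x (enum_val u)) (x (enum_val v)) => [s a] [s' b] /= ne iu fu iv fv [qs qs'] tw.
  have ss := Hinj (pullback_intertwined_isog (cP _ qs) (cP _ qs') iu iv fu fv tw).
  subst s'.
  exact: (pullback_not_intertwined (cP _ qs) iu iv (ne _ a b erefl erefl) tw).
rewrite -cK in t0.
by have := sl2_family_bound t0 q3 n1 m0 rP ri rN; rewrite cK.
Qed.

Lemma family_bound : (k <= n + 3)%N.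
Proof.
apply: leq_trans (degree_table_sum n1 family_table).
have mem j : q (tag (x j)) \in [:: n.-1; n; n.+1; (2 * n).-1; (2 * n).+1].
  have m0 : (0 < m (q (tag (x j))))%N by apply/card_gt0P; exists j; rewrite inE.
  have [[p [e [p_pr _ E]]] _ tab] := family_table m0.
  by apply: degree_table_mem tab; rewrite E expn_gt0 prime_gt0.
have -> : (m n.-1 + m n + m n.+1 + m (2 * n).-1 + m (2 * n).+1
   = \sum_(t <- [:: n.-1; n; n.+1; (2 * n).-1; (2 * n).+1]) m t)%N.
  by rewrite !big_cons big_nil addn0 !addnA.
have -> : (\sum_(t <- [:: n.-1; n; n.+1; (2 * n).-1; (2 * n).+1]) m t
   = \sum_(j < k) \sum_(t <- [:: n.-1; n; n.+1; (2 * n).-1; (2 * n).+1]) (q (tag (x j)) == t))%N.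
  rewrite exchange_big /=; apply: eq_bigr => t _.
  by rewrite /m -sum1dep_card big_mkcond; apply: eq_bigr => j _; case: eqP.
rewrite -[X in (X <= _)%N]card_ord -sum1_card leq_sum // => j _.
by rewrite (big_rem _ (mem j)) /= eqxx.
Qed.

End Families.

From mathcomp Require Import finmap all_classical reals ereal esum measure.
Import Order.TTheory Num.Theory.

(** * Summation over the family *)

Section Counting.

Variables (n l : nat) (F : closedFieldType) (iota : {rmorphism 'F_l -> F}).
Variables (I : choiceType) (gT : I -> finGroupType) (H : forall i, {group gT i}).
Hypotheses (n1 : (1 < n)%N) (l_pr : prime l).
Hypothesis (HA : iso_representatives (A1_cross_char l) H).

Local Notation class_of i := (set (mx_representation F (H i) n)).

Lemma rep_class_eq i (a b : mx_representation F (H i) n) :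
  mx_rsim a b -> rep_class a = rep_class b.
Proof.
move=> ab; apply/funext => c; apply/propext; rewrite /rep_class /=; split => s.
  exact: mx_rsim_trans (mx_rsim_sym ab) s.
exact: mx_rsim_trans ab s.
Qed.

Lemma distinct_classes_bound (L : seq {i : I & class_of i}) : uniq L ->
  {in L, forall u, faithful_irr_classes (tagged u)} -> (size L <= n + 3)%N.
Proof.
move=> uL LP.
have ex (j : 'I_(size L)) : exists v : {i : I & mx_representation F (H i) n},
    [/\ mx_irreducible (tagged v), mx_faithful (tagged v)
      & tnth (in_tuple L) j = Tagged (fun i => class_of i) (rep_class (tagged v))].
  have := LP _ (mem_tnth j (in_tuple L)); move: (tnth _ j) => [i C] /= [a [ai af] <-].
  by exists (Tagged (fun i => mx_representation F (H i) n) a).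
pose x j := projT1 (cid (ex j)); have xP j := projT2 (cid (ex j)).
case: HA => HL Hinj _.
apply: (family_bound iota n1 l_pr HL Hinj (x := x)) => [j|j j' i a b jj' xa xb sim].
  by have [] := xP j.
move/negP: jj'; apply; apply/eqP; have [_ _ Ej] := xP j; have [_ _ Ej'] := xP j'.
apply: (tuple_uniqP (in_tuple L) uL).
rewrite Ej Ej' -/(x j) -/(x j') xa xb /=.
by rewrite (rep_class_eq sim).
Qed.

Lemma sum_faithful_irr_le (R : realType) :
  (sum_faithful_irr F n R H <= (n + 3)%:R%:E)%E.
Proof.
pose X i : set (class_of i) := @faithful_irr_classes F n _ (H i).
have bound (s : seq I) (Y : forall i, seq (class_of i)) : uniq s ->
    (forall i, uniq (Y i) /\ {in Y i, forall C, X i C}) ->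
    (\sum_(i <- s) size (Y i) <= n + 3)%N.
  move=> us YP.
  have := @distinct_classes_bound
    [seq Tagged (fun i => class_of i) C | i <- s, C <- Y i].
  rewrite size_allpairs_dep sumnE big_map; apply.
    apply: allpairs_uniq_dep => //= [i _|u v _ _]; first by case: (YP i).
    by case: u v => [i C] [i' C'].
  by move=> u /allpairsPdep[i [C [_ CY ->]]] /=; case: (YP i) => _; apply.
(* An infinite set would contain [n + 4] classes of a single group; finiteness makes [counting] a
   cardinality. *)
have finX i : finite_set (X i).
  apply: contrapT => infX; have [B BX cB] := infinite_set_fset (n + 4) infX.
  have := @distinct_classes_bound [seq Tagged (fun i => class_of i) C | C <- enum_fset B].
  rewrite size_map => /(_ _ _)/leq_trans - E.
  have : (n + 4 <= n + 3)%N.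
    apply: leq_trans cB (E _ _ _ (leqnn _)).
      rewrite map_inj_uniq ?fset_uniq // => C C' /eqP.
      by rewrite -tag_eqE /tag_eq /= eqxx /= tagged_asE => /eqP.
    by move=> u /mapP[C CB ->]; apply: BX.
  by rewrite leq_add2l.
(* [esum] is a supremum of finite partial sums, so a uniform bound on these is enough. *)
rewrite /sum_faithful_irr /esum; apply: ge_ereal_sup => _ [A [finA _] <-].
rewrite fsbig_finite //= (eq_bigr (fun i => (size (fset_set (X i)))%:R%:E)%E); last first.
  by move=> i _; rewrite /num_faithful_irr /counting ifT //; apply/asboolP/finX.
rewrite sumEFin lee_fin -natr_sum ler_nat; apply: bound => [|i]; first exact: fset_uniq.
split=> [|C]; first exact: fset_uniq.
by rewrite (in_fset_set (finX i)) => /set_mem.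
Qed.

End Counting.

(* F is an algebraic closure of 'F_l, given with its embedding iota. *)
Theorem theorem1p2 (R : realType) (n l : nat) (F : closedFieldType)
    (iota : {rmorphism 'F_l -> F}) (I : choiceType)
    (gT : I -> finGroupType) (H : forall i : I, {group gT i}) :
  (1 < n)%N -> prime l -> integralRange iota ->
  iso_representatives (A1_cross_char l) H ->
  (sum_faithful_irr F n R H <= (n + 3)%:R%:E)%E.
Proof. by move=> n1 l_pr _ HA; exact: (sum_faithful_irr_le iota n1 l_pr HA R). Qed.
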